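(* Let $X$ be a toric Calabi-Yau threefold with $n$ outer branes. Let the generating function of the open Gromov-Witten invariants of $X$ be $$Z(\mathbf x^1,\dots,\mathbf x^n)=\sum_{\mu^1,\dots,\mu^n}Z_{\mu^1\cdots\mu^n}\,s_{\mu^1}(\mathbf x^1)\cdots s_{\mu^n}(\mathbf x^n).$$ Assume that the framed ADKMV conjecture (stated in the context) holds. Then: 1) if the toric diagram of $X$ has no loops, there is a Bogoliubov transform $V\in\mathcal F_1\otimes\cdots\otimes\mathcal F_n$ such that $$Z_{\mu^1\cdots\mu^n}=\langle\mu^1|\otimes\cdots\otimes\langle\mu^n|V\rangle$$ for all partitions $\mu^1,\dots,\mu^n$; 2) if the toric diagram of $X$ has $g$ loops, there is a Bogoliubov transform $V\in\mathcal F_1\otimes\cdots\otimes\mathcal F_n$, which is a Laurent series of $g$ formal parameters $\Theta_1,\dots,\Theta_g$, such that $$Z_{\mu^1\cdots\mu^n}=\frac1{(2\pi\sqrt{-1})^g}\oint\frac{\langle\mu^1|\otimes\cdots\otimes\langle\mu^n|V\rangle}{\Theta_1\cdots\Theta_g}\,d\Theta_1\cdots d\Theta_g$$ for all partitions $\mu^1,\dots,\mu^n$, i.e. $Z_{\mu^1\cdots\mu^n}$ is the constant term of $\langle\mu^1|\otimes\cdots\otimes\langle\mu^n|V\rangle$ with respect to $\Theta_1,\dots,\Theta_g$.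
   Context: Partitions. For a partition $\mu=(\mu_1\ge\dots\ge\mu_l>0)$: $|\mu|=\sum\mu_i$, $\kappa_\mu=\sum_i\mu_i(\mu_i-2i+1)$, $\mu^t$ is the conjugate, $s_\mu$ and $s_{\mu/\eta}$ are Schur and skew Schur functions. Fermionic Fock space. A set $A=\{a_1>a_2>\cdots\}\subset\mathbb Z+\frac12$ is admissible if both $\{r\in\mathbb Z+\frac12: r<0\}\setminus A$ and $A\setminus\{r\in\mathbb Z+\frac12: r<0\}$ are finite. $\mathcal F$ is the vector space with orthonormal basis (for a bilinear inner product) the semi-infinite wedges $\underline A=\underline{a_1}\wedge\underline{a_2}\wedge\cdots$, $A$ admissible. For a partition $\mu$, $|\mu\rangle=\underline A$ with $A=\{\mu_i-i+\frac12\}_{i\ge1}$ ($\mu_i=0$ for large $i$); $|0\rangle$ is the vector of the empty partition; $\langle\mu|$ denotes pairing with $|\mu\rangle$. For $r\in\mathbb Z+\frac12$: $\psi_r(\underline A)=(-1)^k\,\underline{a_1}\wedge\cdots\wedge\underline{a_k}\wedge\underline r\wedge\underline{a_{k+1}}\wedge\cdots$ if $a_k>r>a_{k+1}$ ($k=0$ if $r>a_1$), and $0$ if $r\in A$; $\psi_r^*$ is the adjoint: $\psi_r^*(\underline A)=(-1)^{k+1}\,\underline{a_1}\wedge\cdots\wedge\widehat{\underline{a_k}}\wedge\cdots$ if $a_k=r$, and $0$ if $r\notin A$. $\mathcal F_i$ are copies of $\mathcal F$; on a tensor product, $\psi^i_r,\psi^{i*}_r$ act on the $i$-th factor, with the Koszul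 sign convention (operators with different upper indices anticommute); $|0\rangle$ also denotes the tensor product of vacua. A Bogoliubov transform in $\mathcal F_1\otimes\cdots\otimes\mathcal F_n$ is a vector $\exp(\sum_{i,j=1}^n\sum_{m,n'\ge0}A^{ij}_{mn'}\psi^i_{m+1/2}\psi^{j*}_{-n'-1/2})|0\rangle$, with coefficients $A^{ij}_{mn'}$ possibly depending on parameters (here $q$ and its fractional powers, the formal variables $Q$ of the compact edges and their roots, and in 2) also $\Theta_1^{\pm1},\dots,\Theta_g^{\pm1}$; dependence on the $Q$'s is as formal power series). Infinite sums of basis vectors are understood formally. Topological vertex. With $q^{\mu+\rho}=(q^{\mu_i-i+1/2})_{i\ge1}$ and $q^{-\rho}=(q^{i-1/2})_{i\ge1}$ (specializations interpreted as rational functions of $q^{1/2}$), $$W_{\mu^1,\mu^2,\mu^3}(q)=(-1)^{|\mu^2|}q^{\kappa_{\mu^3}/2}s_{(\mu^2)^t}(q^{-\rho})\sum_\eta s_{\mu^1/\eta}(q^{(\mu^2)^t+\rho})\,s_{(\mu^3)^t/\eta}(q^{\mu^2+\rho}),$$ $$W^{(a_1,a_2,a_3)}_{\mu^1,\mu^2,\mu^3}(q)=(-1)^{\sum_i a_i|\mu^i|}q^{\sum_i a_i\kappa_{\mu^i}/2}W_{\mu^1,\mu^2,\mu^3}(q),\qquad (a_1,a_2,a_3)\in\mathbb Z^3 .$$ Framed ADKMV conjecture. For all $\mathbf a=(a_1,a_2,a_3)\in\mathbb Z^3$ and all partitions $\mu^1,\mu^2,\mu^3$, $$W^{(\mathbf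 a)}_{\mu^1,\mu^2,\mu^3}(q)=\langle\mu^1|\otimes\langle\mu^2|\otimes\langle\mu^3|\exp\Big(\sum_{i,j=1}^3\sum_{m,n\ge0}A^{ij}_{mn}(q;\mathbf a)\psi^i_{m+1/2}\psi^{j*}_{-n-1/2}\Big)|0\rangle\otimes|0\rangle\otimes|0\rangle,$$ where, with indices $i\pm1$ taken cyclically in $\{1,2,3\}$, $[k]=q^{k/2}-q^{-k/2}$, $[k]!=\prod_{j=1}^k[j]$, $[0]!=1$, $$A^{ii}_{mn}(q;\mathbf a)=(-1)^{(m+n+1)a_i+n}\frac{q^{(2a_i+1)(m(m+1)-n(n+1))/4}}{[m+n+1][m]![n]!},$$ $$A^{i(i+1)}_{mn}(q;\mathbf a)=(-1)^{ma_i+(n+1)a_{i+1}+n}q^{\frac{(2a_i+1)m(m+1)-(2a_{i+1}+1)n(n+1)}4+\frac16}\sum_{l=0}^{\min(m,n)}\frac{q^{\frac12(l+1)(m+n-l)}}{[m-l]![n-l]!},$$ $$A^{i(i-1)}_{mn}(q;\mathbf a)=-(-1)^{ma_i+(n+1)a_{i-1}+n}q^{\frac{(2a_i+1)m(m+1)-(2a_{i-1}+1)n(n+1)}4-\frac16}\sum_{l=0}^{\min(m,n)}\frac{q^{-\frac12(l+1)(m+n-l)}}{[m-l]![n-l]!}.$$ Generating functions of toric Calabi-Yau threefolds. To $X$ is attached its toric diagram $\Gamma$, a trivalent planar graph with compact and noncompact edges, obtained by gluing trivalent vertices (the diagrams of $\mathbb C^3$) along noncompact edges. The outer branes lie on the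 noncompact edges $L_1,\dots,L_n$, with framings $a_1,\dots,a_n\in\mathbb Z$. The generating function $\tilde Z=\sum\tilde Z_{\mu^1\cdots\mu^n}s_{\mu^1}(\mathbf x^1)\cdots s_{\mu^n}(\mathbf x^n)$ of all Gromov-Witten invariants of $X$ with these framings is computed inductively on the numbers of vertices and loops by the gluing rules of the topological vertex: (0) For $\mathbb C^3$ with edges ordered clockwise and framing $(a_1,a_2,a_3)$: $\tilde Z_{\mu^1\mu^2\mu^3}=W^{(a_1,a_2,a_3)}_{\mu^1,\mu^2,\mu^3}(q)$. (1) If $\Gamma$ is obtained by gluing a toric diagram $\Gamma'$ with noncompact edges $L_1,\dots,L_{n-2},L_a$ to a trivalent vertex with edges $L_b,L_{n-1},L_n$ (clockwise) along $L_a$ and $L_b$, and $Z'$ is the generating function for $\Gamma'$ with framings $a_1,\dots,a_{n-2}$ on $L_1,\dots,L_{n-2}$ and canonical framing $0$ on $L_a$, then $$\tilde Z_{\mu^1\cdots\mu^n}=\sum_\mu Z'_{\mu^1\cdots\mu^{n-2}\mu}\,(-1)^{(f+1)|\mu|}q^{-f\kappa_\mu/2}Q^{|\mu|}\,W^{(0,a_{n-1},a_n)}_{\mu^t,\mu^{n-1},\mu^n}(q).$$ (2) If $\Gamma$ is obtained from a toric diagram $\Gamma''$ with noncompact edges $L_1,\dots,L_n,L_a,L_b$ by gluing $L_a$ and $L_b$, and $Z''$ is the generating function for $\Gamma''$ with framings $a_1,\dots,a_n$ on $L_1,\dots,L_n$ and canonical framing $0$ on $L_a,L_b$, then $$\tilde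 Z_{\mu^1\cdots\mu^n}=\sum_\mu Z''_{\mu^1\cdots\mu^n\mu\mu^t}\,(-1)^{(f+1)|\mu|}q^{-f\kappa_\mu/2}Q^{|\mu|}.$$ In (1) and (2), $Q=e^{-t}$ where $t$ is the Kähler parameter of the new compact edge (treated as a formal variable; parameters of edges giving homologous copies of $\mathbb P^1$ in $X$ are identified), and $f\in\mathbb Z$ is the integer determined by the toric diagram by the requirement that framing $f$ on $L_b$ match the canonical framing on $L_a$. The generating function of closed invariants is $Z_{closed}=\tilde Z_{\emptyset\cdots\emptyset}$, and the generating function of the open Gromov-Witten invariants is $Z=\tilde Z/Z_{closed}$, i.e. $Z_{\mu^1\cdots\mu^n}=\tilde Z_{\mu^1\cdots\mu^n}/Z_{closed}$. *)

(* Defs.v *)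
From HB Require Import structures.
From mathcomp Require Import all_boot all_order all_algebra.
From mathcomp Require Import finmap mathcomp_extra boolp classical_sets.
From mathcomp Require Import functions cardinality fsbigop.

Set Implicit Arguments.
Unset Strict Implicit.
Unset Printing Implicit Defensive.

Import Order.TTheory GRing.Theory Num.Theory.
Local Open Scope classical_set_scope.
Local Open Scope ring_scope.

(* [series K I g] is the ring K[Theta_1^{+-1}, ..., Theta_g^{+-1}][[Q_c : c in I]]:
   formal power series in the Q's whose coefficients are Laurent polynomials in
   the Thetas.  For g = 0 it is K[[Q_c : c in I]]. *)
Definition expo (I : finType) (g : nat) : Type :=
  ({ffun I -> nat} * {ffun 'I_g -> int})%type.

HB.instance Definition _ I g := GRing.Nmodule.on (expo I g).

Record series (K : fieldType) (I : finType) (g : nat) := Series {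
  coef :> expo I g -> K;
  coefP : forall d, finite_set [set th | coef (d, th) != 0] }.

HB.instance Definition _ K I g := gen_eqMixin (series K I g).
HB.instance Definition _ K I g := gen_choiceMixin (series K I g).

Section SeriesRing.
Variables (K : fieldType) (I : finType) (g : nat).
Implicit Types (f h : series K I g) (e : expo I g).

Lemma seriesP f h : coef f =1 coef h -> f = h.
Proof.
case: f h => [f fP] [h hP] /= /funext fh; rewrite fh in fP *.
by rewrite (Prop_irrelevance fP hP).
Qed.

Lemma monomial_coef_finite e (d : {ffun I -> nat}) :
  finite_set [set th : {ffun 'I_g -> int} | ((d, th) == e)%:R != 0 :> K].
Proof.
apply: (sub_finite_set _ (finite_set1 e.2)) => th /=.
by case: ((d, th) =P e) => [<-|]; rewrite ?eqxx.
Qed.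
Definition monomial e : series K I g :=
  @Series K I g (fun e' => (e' == e)%:R) (monomial_coef_finite e).

Lemma add_coef_finite f h (d : {ffun I -> nat}) :
  finite_set [set th | f (d, th) + h (d, th) != 0].
Proof.
apply: (@sub_finite_set _ _ ([set th | f (d, th) != 0] `|` [set th | h (d, th) != 0])).
  move=> th /=; case: (eqVneq (f (d, th)) 0) => [->|?] ; last by left.
  by rewrite add0r; right.
by rewrite finite_setU; split; exact: coefP.
Qed.
Definition add_series f h :=
  @Series K I g (fun e => f e + h e) (add_coef_finite f h).

Lemma scale_coef_finite (c : K) f (d : {ffun I -> nat}) :
  finite_set [set th | c * f (d, th) != 0].
Proof.
apply: sub_finite_set (coefP f d) => th /=.
by apply: contra_neq => ->; rewrite mulr0.
Qed.
Definition scale_series c f :=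
  @Series K I g (fun e => c * f e) (scale_coef_finite c f).

Lemma zero_coef_finite (d : {ffun I -> nat}) :
  finite_set [set th : {ffun 'I_g -> int} | (0 : K) != 0].
Proof. by apply: (sub_finite_set _ (finite_set0 _)) => th /=; rewrite eqxx. Qed.
Definition zero_series := @Series K I g (fun=> 0) zero_coef_finite.

Lemma opp_coef_finite f (d : {ffun I -> nat}) :
  finite_set [set th | - f (d, th) != 0].
Proof. by apply: sub_finite_set (coefP f d) => th /=; rewrite oppr_eq0. Qed.
Definition opp_series f :=
  @Series K I g (fun e => - f e) (opp_coef_finite f).

Lemma add_seriesA : associative add_series.
Proof. by move=> x y z; apply: seriesP => e /=; rewrite addrA. Qed.
Lemma add_seriesC : commutative add_series.
Proof. by move=> x y; apply: seriesP => e /=; rewrite addrC. Qed.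
Lemma add_series0 : left_id zero_series add_series.
Proof. by move=> x; apply: seriesP => e /=; rewrite add0r. Qed.
Lemma add_seriesN : left_inverse zero_series opp_series add_series.
Proof. by move=> x; apply: seriesP => e /=; rewrite addNr. Qed.

HB.instance Definition _ := GRing.isZmodule.Build (series K I g)
  add_seriesA add_seriesC add_series0 add_seriesN.

(* The sum has finite support, cf mul_coefE. *)
Definition mul_coef f h e : K :=
  \sum_(p \in [set p : expo I g * expo I g | p.1 + p.2 = e]) f p.1 * h p.2.

Definition expo_le e e' := [forall i, (e.1 i <= e'.1 i)%N].

Definition covers (s : seq (expo I g)) f e :=
  uniq s /\ forall a, expo_le a e -> f a != 0 -> a \in s.

Lemma covers_ex f e : exists s, covers s f e.
Proof.
pose D := [set d : {ffun I -> nat} | forall i, (d i <= e.1 i)%N].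
have finD : finite_set D.
  pose N := (\max_i e.1 i)%N.
  pose q (u : {ffun I -> 'I_N.+1}) : {ffun I -> nat} := [ffun i => val (u i)].
  apply: (@sub_finite_set _ _ (range q)); last first.
    by apply: finite_image; exact: finite_finset.
  move=> d dD; exists [ffun i => inord (d i)] => //.
  apply/ffunP => i; rewrite /q !ffunE /= inordK// ltnS (leq_trans (dD i))//.
  exact: (leq_bigmax i).
have : finite_set [set a : expo I g | D a.1 /\ f a != 0].
  apply: (@sub_finite_set _ _
    (\bigcup_(d in D) [set (d, th) | th in [set th | f (d, th) != 0]])).
    by move=> [d th] /= [Dd fa]; exists d => //; exists th.
  by apply: bigcup_finite => // d _; apply: finite_image; exact: coefP.
move=> fin; exists (fset_set [set a : expo I g | D a.1 /\ f a != 0]).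
split=> [|a /forallP ale fa]; first exact: fset_uniq.
by rewrite in_fset_set// inE.
Qed.

Lemma expo_leD a b : expo_le a (a + b).
Proof. by apply/forallP => i; rewrite [(a + b).1]/= ffunE leq_addr. Qed.
Lemma expo_leDr a b : expo_le b (a + b).
Proof. by rewrite addrC expo_leD. Qed.
Lemma expo_le_trans : transitive expo_le.
Proof.
move=> b a c /forallP ab /forallP bc; apply/forallP => i.
exact: leq_trans (ab i) (bc i).
Qed.
Lemma covers_le s f e e' : expo_le e' e -> covers s f e -> covers s f e'.
Proof.
by move=> le [us sP]; split=> // a /expo_le_trans-/(_ _ le); exact: sP.
Qed.

Lemma mul_coefE s s' f h e : covers s f e -> covers s' h e ->
  mul_coef f h e =
  \sum_(a <- s) \sum_(b <- s') (a + b == e)%:R * (f a * h b).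
Proof.
move=> [us sP] [us' sP'].
rewrite /mul_coef fsbig_mkcond.
rewrite (fsbigTE [fset p in allpairs pair s s']%fset); last first.
  move=> [a b]; rewrite !inE /= /patch; case: ifP => //.
  rewrite inE /= => abe; apply: contraNeq; rewrite mulf_eq0 negb_or.
  case/andP=> fa hb; apply/allpairsP; exists (a, b); split=> //=.
    by apply: sP => //; rewrite -abe expo_leD.
  by apply: sP' => //; rewrite -abe expo_leDr.
have uss : uniq (allpairs pair s s') by rewrite allpairs_uniq// => -[? ?] [? ?].
rewrite (perm_big (allpairs pair s s')); last first.
  by apply: uniq_perm; rewrite ?fset_uniq// => x; rewrite !inE.
rewrite big_allpairs; apply: eq_bigr => a _; apply: eq_bigr => b _.
rewrite /patch; case: eqP => abe; last first.
  by case: ifP; rewrite ?inE//= ?mul0r.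
by rewrite ifT ?mul1r// inE.
Qed.

Lemma mul_coef_finite f h (d : {ffun I -> nat}) :
  finite_set [set th | mul_coef f h (d, th) != 0].
Proof.
have [s sf] := covers_ex f (d, 0); have [s' sh] := covers_ex h (d, 0).
apply: (@sub_finite_set _ _ [set` [seq (a + b).2 | a <- s, b <- s']]);
  last exact: finite_seq.
move=> th /=; rewrite (@mul_coefE s s')//; apply: contra_neqT => nin.
apply: big1_seq => a /andP[_ sa]; apply: big1_seq => b /andP[_ sb].
case: eqP => [abe|]; last by rewrite mul0r.
case/negP: nin; apply/allpairsP; exists (a, b); split=> //=.
by rewrite -[th]/((d, th).2) -abe.
Qed.
Definition mul_series f h :=
  @Series K I g (mul_coef f h) (mul_coef_finite f h).

Lemma mul_seriesC : commutative mul_series.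
Proof.
move=> f h; apply: seriesP => e /=.
have [s sf] := covers_ex f e; have [s' sh] := covers_ex h e.
rewrite (mul_coefE sf sh) (mul_coefE sh sf) exchange_big.
by under eq_bigr do under eq_bigr do rewrite addrC [X in _ * X]mulrC.
Qed.

Lemma mul_coef_eq0 f h e :
  (forall a b, a + b = e -> f a * h b = 0) -> mul_coef f h e = 0.
Proof. by move=> z; apply: fsbig1 => -[a b] /= /z. Qed.

Lemma sum_eq_in (s : seq (expo I g)) (u : expo I g) (F : expo I g -> K) :
  uniq s -> u \in s -> \sum_(v <- s) (u == v)%:R * F v = F u.
Proof.
move=> us su; rewrite (bigD1_seq u)//= eqxx mul1r big1 ?addr0// => v.
by rewrite eq_sym => /negPf->; rewrite mul0r.
Qed.

Lemma mul_seriesA : associative mul_series.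
Proof.
suff H f1 f2 f3 e : exists s1 s2 s3 : seq (expo I g),
    [/\ covers s1 f1 e, covers s2 f2 e & covers s3 f3 e] /\
    forall s1 s2 s3 : seq (expo I g),
    covers s1 f1 e -> covers s2 f2 e -> covers s3 f3 e ->
    mul_coef (mul_series f1 f2) f3 e =
    \sum_(a <- s1) \sum_(b <- s2) \sum_(c <- s3)
      (a + b + c == e)%:R * (f1 a * f2 b * f3 c).
  move=> f1 f2 f3; apply: seriesP => e.
  rewrite mul_seriesC /=.
  have [s1 [s2 [s3 [[c1 c2 c3] E1]]]] := H f1 f2 f3 e.
  have [_ [_ [_ [_ E2]]]] := H f2 f3 f1 e.
  rewrite (E1 s1 s2 s3)// (E2 s2 s3 s1)//.
  under eq_bigr do rewrite exchange_big /=.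
  rewrite exchange_big /=.
  apply: eq_bigr => a _; apply: eq_bigr => b _; apply: eq_bigr => c _.
  congr (_ %:R * _); last by rewrite mulrC mulrA.
  by rewrite [b + c + a]addrC addrA.
have [s1 c1] := covers_ex f1 e; have [s2 c2] := covers_ex f2 e.
have [s3 c3] := covers_ex f3 e; exists s1, s2, s3; split=> //.
move=> {c1 c2 c3} {}s1 {}s2 {}s3 c1 c2 c3.
pose s12 := undup [seq a + b | a <- s1, b <- s2].
have c12 : covers s12 (mul_series f1 f2) e.
  split=> [|u ule]; first exact: undup_uniq.
  rewrite /= (@mul_coefE s1 s2); [|exact: covers_le c1|exact: covers_le c2].
  apply: contra_neqT => nin.
  apply: big1_seq => a /andP[_ sa]; apply: big1_seq => b /andP[_ sb].
  case: eqP => [abe|]; last by rewrite mul0r.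
  case/negP: nin; rewrite mem_undup; apply/allpairsP.
  by exists (a, b).
rewrite (mul_coefE c12 c3).
have Eu u c : (u + c == e)%:R * (mul_series f1 f2 u * f3 c) =
  \sum_(a <- s1) \sum_(b <- s2)
     (a + b == u)%:R * ((u + c == e)%:R * (f1 a * f2 b * f3 c)).
  case: eqP => [uce|_]; last first.
    by rewrite mul0r big1// => a _; rewrite big1// => b _; rewrite mul0r mulr0.
  have ule : expo_le u e by rewrite -uce expo_leD.
  rewrite mul1r /= (@mul_coefE s1 s2);
    [|exact: covers_le c1|exact: covers_le c2].
  rewrite mulr_suml; apply: eq_bigr => a _.
  by rewrite mulr_suml; apply: eq_bigr => b _; rewrite mul1r -mulrA.
under eq_bigr do under eq_bigr do rewrite Eu.
under eq_bigr do rewrite exchange_big /=.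
rewrite exchange_big /=; rewrite [LHS]big_seq [RHS]big_seq.
apply: eq_bigr => a sa.
under eq_bigr do rewrite exchange_big /=.
rewrite exchange_big /=; rewrite [LHS]big_seq [RHS]big_seq.
apply: eq_bigr => b sb.
rewrite exchange_big /=; apply: eq_bigr => c _.
rewrite (@sum_eq_in s12 (a + b) (fun u => (u + c == e)%:R * _))//.
  exact: undup_uniq.
by rewrite mem_undup; apply/allpairsP; exists (a, b).
Qed.

Lemma mul_series1 : left_id (monomial 0) mul_series.
Proof.
move=> f; apply: seriesP => e /=.
have [s [us sP]] := covers_ex f e.
pose s' := undup (e :: s).
have c : covers s' f e.
  split=> [|a ale fa]; first exact: undup_uniq.
  by rewrite mem_undup inE sP// orbT.
have c1 : covers [:: 0] (monomial 0) e.
  split=> // a _; rewrite inE -[monomial 0 a]/((a == 0)%:R).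
  by case: (a == 0); rewrite // eqxx.
rewrite (mul_coefE c1 c) big_seq1.
under eq_bigr => b _ do rewrite add0r eq_sym /= eqxx mul1r.
rewrite (@sum_eq_in s' e f)//; first exact: undup_uniq.
by rewrite mem_undup inE eqxx.
Qed.

Lemma covers_ex2 f h e : exists s,
  [/\ covers s f e, covers s h e & covers s (f + h) e].
Proof.
have [s [us sP]] := covers_ex f e; have [s' [us' sP']] := covers_ex h e.
exists (undup (s ++ s')); split; split=> [|a ale]; rewrite ?undup_uniq//.
- by move=> fa; rewrite mem_undup mem_cat sP.
- by move=> fa; rewrite mem_undup mem_cat sP' ?orbT.
- rewrite mem_undup mem_cat -[(f + h) a]/(f a + h a) => fha.
  case: (eqVneq (f a) 0) fha => [->|fa _]; last by rewrite sP.
  by rewrite add0r => ha; rewrite sP' ?orbT.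
Qed.

Lemma mul_seriesDl : left_distributive mul_series +%R.
Proof.
move=> f1 f2 f3; apply: seriesP => e.
have [s [c1 c2 c12]] := covers_ex2 f1 f2 e; have [s' c3] := covers_ex f3 e.
rewrite -[RHS]/(mul_coef f1 f3 e + mul_coef f2 f3 e).
rewrite -[LHS]/(mul_coef (f1 + f2) f3 e).
rewrite (mul_coefE c1 c3) (mul_coefE c2 c3) (mul_coefE c12 c3).
rewrite -big_split; apply: eq_bigr => a _; rewrite -big_split /=.
by apply: eq_bigr => b _; rewrite -mulrDr -mulrDl.
Qed.

Lemma one_series_neq0 : monomial 0 != 0.
Proof.
apply/eqP => /(congr1 (fun f : series K I g => f 0)).
change (((0 : expo I g) == 0)%:R = 0 :> K -> False).
by rewrite eqxx => /eqP; rewrite oner_eq0.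
Qed.

HB.instance Definition _ := GRing.Zmodule_isComNzRing.Build (series K I g)
  mul_seriesA mul_seriesC mul_series1 mul_seriesDl one_series_neq0.

Lemma scale_seriesA a b f :
  scale_series a (scale_series b f) = scale_series (a * b) f.
Proof. by apply: seriesP => e /=; rewrite mulrA. Qed.
Lemma scale_series1 : left_id 1 scale_series.
Proof. by move=> f; apply: seriesP => e /=; rewrite mul1r. Qed.
Lemma scale_seriesDr : right_distributive scale_series +%R.
Proof. by move=> c f h; apply: seriesP => e; exact: mulrDr. Qed.
Lemma scale_seriesDl f : {morph scale_series^~ f : a b / a + b}.
Proof. by move=> a b; apply: seriesP => e; exact: mulrDl. Qed.

HB.instance Definition _ := GRing.Zmodule_isLmodule.Build K (series K I g)
  scale_seriesA scale_series1 scale_seriesDr scale_seriesDl.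

Lemma scale_seriesAl (a : K) f h : a *: (f * h) = a *: f * h.
Proof.
apply: seriesP => e.
have [s [us sP]] := covers_ex f e; have [s' c'] := covers_ex h e.
have c : covers s (a *: f) e.
  split=> // u ule afu; apply: sP => //; apply: contra_neq afu.
  by rewrite -[(a *: f) u]/(a * f u) => ->; rewrite mulr0.
rewrite -[LHS]/(a * mul_coef f h e) -[RHS]/(mul_coef (a *: f) h e).
rewrite (mul_coefE (conj us sP) c') (mul_coefE c c') mulr_sumr.
apply: eq_bigr => u _; rewrite mulr_sumr; apply: eq_bigr => v _.
by rewrite -[(a *: f) u]/(a * f u) -mulrA mulrCA.
Qed.
HB.instance Definition _ :=
  GRing.Lmodule_isLalgebra.Build K (series K I g) scale_seriesAl.
HB.instance Definition _ := GRing.Lalgebra_isComAlgebra.Build K (series K I g).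

End SeriesRing.

Section SeriesOperations.
Variables (K : fieldType) (I : finType) (g : nat).

Lemma constant_term_finite (f : series K I g) (d : {ffun I -> nat}) :
  finite_set [set th : {ffun 'I_0 -> int} | f (d, 0) != 0].
Proof.
apply: (sub_finite_set _ (finite_set1 (0 : {ffun 'I_0 -> int}))) => th _ /=.
by apply/ffunP => -[].
Qed.
(* Constant term with respect to Theta_1, ..., Theta_g, that is
   (2 pi sqrt(-1))^-g \oint f / (Theta_1 ... Theta_g) dTheta_1 ... dTheta_g. *)
Definition constant_term (f : series K I g) : series K I 0 :=
  @Series K I 0 (fun e => f (e.1, 0)) (constant_term_finite f).

Definition subst_pow_coef (N : nat) (f : series K I g) (e : expo I g) : K :=
  if [forall c, (N %| e.1 c)%N] then f ([ffun c => (e.1 c %/ N)%N], e.2) else 0.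

Lemma subst_pow_finite N f (d : {ffun I -> nat}) :
  finite_set [set th | subst_pow_coef N f (d, th) != 0].
Proof.
apply: sub_finite_set (coefP f [ffun c => (d c %/ N)%N]) => th /=.
by rewrite /subst_pow_coef /=; case: ifP; rewrite ?eqxx.
Qed.
(* f(Q_c := y_c ^ N): a series in the Q's seen as a series in their N-th roots
   y_c, for N > 0. *)
Definition subst_pow (N : nat) (f : series K I g) : series K I g :=
  @Series K I g (subst_pow_coef N f) (subst_pow_finite N f).

End SeriesOperations.

Definition is_part (s : seq nat) : bool := sorted geq s && (0%N \notin s).

Record part := Part { pval :> seq nat; _ : is_part pval }.
HB.instance Definition _ := [isSub for pval].
HB.instance Definition _ := [Choice of part by <:].

Definition part0 : part := @Part [::] isT.

Definition conj_seq (s : seq nat) : seq nat :=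
  mkseq (fun j => count (fun x => j < x)%N s) (head 0%N s).

Lemma conj_seq_part (mu : part) : is_part (conj_seq mu).
Proof.
case: mu => s /= _; apply/andP; split; last first.
  apply/mapP => -[j]; rewrite mem_iota /= add0n => jh /esym/eqP.
  rewrite -leqn0 leqNgt -has_count => /negP; apply.
  by case: s jh => [|x s] //= ->.
apply/(sortedP 0%N) => i; rewrite size_mkseq => ih.
rewrite !nth_mkseq// ?(ltnW ih)//=; apply: sub_count => x /=.
exact: ltnW.
Qed.
Definition conj_part (mu : part) : part := Part (conj_seq_part mu).

Definition sub_part (eta mu : part) : bool :=
  (size eta <= size mu)%N
    && all (fun i => nth 0 eta i <= nth 0 mu i)%N (iota 0 (size eta)).

Definition kappa (mu : part) : int :=
  \sum_(i < size mu)
    (nth 0%N mu i)%:Z * ((nth 0%N mu i)%:Z - 2 * i.+1%:Z + 1).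

Section TopologicalVertex.
Variable k : fieldType.

(* The field of rational functions in q^{1/6}; all the exponents of q below lie
   in (1/6)Z. *)
Definition qfield : fieldType := {fraction {poly k}}.

(* q^x, for x in (1/6)Z *)
Definition qpow (x : rat) : qfield := (tofrac 'X) ^ Num.floor (6 * x).

(* Power sums sum_{i >= 1} x_i^d, d > 0, as rational functions: the tail
   i > size mu of x_i = q^{mu_i - i + 1/2}, and the whole of x_i = q^{i - 1/2},
   are geometric progressions. *)
Definition psum_rho (mu : part) (d : nat) : qfield :=
  \sum_(i < size mu) qpow (d%:R * ((nth 0%N mu i)%:R - i.+1%:R + 1 / 2))
  + qpow (- (d%:R * ((size mu)%:R + 1 / 2))) / (1 - qpow (- d%:R)).
Definition psum_neg_rho (d : nat) : qfield := qpow (d%:R / 2) / (1 - qpow d%:R).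

(* Complete symmetric functions, from
   sum_n h_n z^n = exp (sum_{d >= 1} p_d z^d / d). *)
Definition hsym (p : nat -> qfield) (n : nat) : qfield :=
  (\sum_(j < n.+1) (j`!%:R)^-1 *:
     (\sum_(1 <= d < n.+1) (p d / d%:R) *: 'X^d) ^+ j)`_n.
Definition hsymz (p : nat -> qfield) (z : int) : qfield :=
  if z is Posz n then hsym p n else 0.

(* Jacobi-Trudi: s_{mu/eta} under the specialization with power sums p *)
Definition skew_schur (mu eta : part) (p : nat -> qfield) : qfield :=
  if sub_part eta mu then
    \det (\matrix_(i < size mu, j < size mu)
      hsymz p ((nth 0%N mu i)%:Z - (nth 0%N eta j)%:Z - i%:Z + j%:Z))
  else 0.
Definition schur (mu : part) (p : nat -> qfield) : qfield :=
  skew_schur mu part0 p.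

Definition vertexW (mu1 mu2 mu3 : part) : qfield :=
  (-1) ^+ sumn mu2 * qpow ((kappa mu3)%:~R / 2)
  * schur (conj_part mu2) psum_neg_rho
  * \sum_(eta \in [set: part])
      skew_schur mu1 eta (psum_rho (conj_part mu2))
      * skew_schur (conj_part mu3) eta (psum_rho mu2).

Definition framed_vertexW (a : 'I_3 -> int) (mu : 'I_3 -> part) : qfield :=
  (-1) ^ (\sum_i a i * (sumn (mu i))%:Z)
  * qpow ((\sum_i a i * kappa (mu i))%:~R / 2)
  * vertexW (mu 0) (mu 1) (mu (1 + 1)).

Definition qint (n : nat) : qfield := qpow (n%:R / 2) - qpow (- (n%:R / 2)).
Definition qfact (n : nat) : qfield := \prod_(1 <= j < n.+1) qint j.

Definition adkmv_coef (a : 'I_3 -> int) (i j : 'I_3) (m n : nat) : qfield :=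
  let am := (2 * a i + 1)%:~R * m%:R * (m%:R + 1) : rat in
  let an := (2 * a j + 1)%:~R * n%:R * (n%:R + 1) : rat in
  if j == i then
    (-1) ^ ((m + n + 1)%:Z * a i + n%:Z)
    * qpow ((am - an) / 4) / (qint (m + n + 1) * qfact m * qfact n)
  else
    let sgn := (-1) ^ (m%:Z * a i + n.+1%:Z * a j + n%:Z) in
    if j == i + 1 then
      sgn * qpow ((am - an) / 4 + 1 / 6)
      * \sum_(l < (minn m n).+1)
          qpow (1 / 2 * l.+1%:R * (m%:R + n%:R - l%:R))
          / (qfact (m - l) * qfact (n - l))
    else
      - sgn * qpow ((am - an) / 4 - 1 / 6)
      * \sum_(l < (minn m n).+1)
          qpow (- (1 / 2 * l.+1%:R * (m%:R + n%:R - l%:R)))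
          / (qfact (m - l) * qfact (n - l)).

End TopologicalVertex.

(* The half-integer r = s + 1/2 is encoded by the integer s: r < 0 iff s < 0,
   m + 1/2 is m, and - n - 1/2 is - n - 1. *)
Definition neg_half : set int := [set r | r < 0].

Definition admissible (A : set int) : Prop :=
  finite_set (neg_half `\` A) /\ finite_set (A `\` neg_half).

Record maya := Maya { mset :> set int; mayaP : admissible mset }.

Lemma admissible_add (A : maya) r : admissible (A `|` [set r]).
Proof.
have [fn fp] := mayaP A; split.
  by apply: sub_finite_set fn => s [ns] /not_orP[].
rewrite setDUl finite_setU; split=> //; apply: finite_setD; exact: finite_set1.
Qed.
Definition maya_add (A : maya) r : maya := Maya (admissible_add A r).

Lemma admissible_del (A : maya) r : admissible (A `\ r).
Proof.
have [fn fp] := mayaP A; split; last first.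
  by apply: sub_finite_set fp => s [[]].
apply: (@sub_finite_set _ _ ((neg_half `\` A) `|` [set r])).
  by move=> s [ns] /not_andP[|/contrapT]; [left|right].
by rewrite finite_setU; split=> //; exact: finite_set1.
Qed.
Definition maya_del (A : maya) r : maya := Maya (admissible_del A r).

Definition part_set (mu : part) : set int :=
  [set (nth 0%N mu i)%:Z - i%:Z - 1 | i in [set: nat]].

Lemma admissible_part mu : admissible (part_set mu).
Proof.
pose s := [seq (nth 0%N mu i)%:Z - i%:Z - 1 | i <- iota 0 (size mu)].
pose s' := [seq - i%:Z - 1 : int | i <- iota 0 (size mu)].
split.
  apply: (@sub_finite_set _ _ [set` s']); last exact: finite_seq.
  move=> [n|n] [ns nA] //=; apply/mapP; exists n;
    last by rewrite NegzE -addn1 PoszD opprD.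
  rewrite mem_iota /= add0n ltnNge; apply/negP => sn; apply: nA.
  by exists n => //; rewrite nth_default// sub0r NegzE -addn1 PoszD opprD.
apply: (@sub_finite_set _ _ [set` s]); last exact: finite_seq.
move=> _ [[i _ <-] pos] /=; apply/mapP; exists i => //.
rewrite mem_iota /= add0n ltnNge; apply/negP => si; apply: pos.
by rewrite /neg_half /= nth_default// sub0r -opprD oppr_lt0 -PoszD addn1.
Qed.
Definition maya_part (mu : part) : maya := Maya (admissible_part mu).

Section Fock.
Variables (K : fieldType) (R : comAlgType K) (n : nat).

(* Formal (possibly infinite) R-linear combinations of the basis vectors of
   F_1 (x) ... (x) F_n, given by their coefficients. *)
Definition fock : Type := ('I_n -> maya) -> R.

Definition bra (mu : 'I_n -> part) (v : fock) : R :=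
  v (fun i => maya_part (mu i)).

Definition vacuum : fock :=
  fun B => if `[< B = (fun=> maya_part part0) >] then 1 else 0.

(* Number of elements of A to the left of r in the wedge *)
Definition before (A : maya) (r : int) : nat :=
  #|` fset_set [set a | mset A a /\ r < a] |.

(* Fermionic degree (mod 2) of a basis vector, the vacuum being even *)
Definition degree (A : maya) : nat :=
  (#|` fset_set (A `\` neg_half)| + #|` fset_set (neg_half `\` A)|)%N.

Definition koszul (i : 'I_n) (B : 'I_n -> maya) : R :=
  (-1) ^+ \sum_(j < n | (j < i)%N) degree (B j).

(* The coefficient on B of psi^i_r v: the only basis vector mapped to +- B has
   i-th factor B_i minus r. *)
Definition psi (i : 'I_n) (r : int) (v : fock) : fock := fun B =>
  if r \in mset (B i) then
    koszul i B * (-1) ^+ before (B i) r * v [eta B with i |-> maya_del (B i) r]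
  else 0.

(* For a_k = r, (-1)^{k+1} = (-1)^{k-1} and k - 1 = before (B i) r. *)
Definition psi_star (i : 'I_n) (r : int) (v : fock) : fock := fun B =>
  if r \in mset (B i) then 0
  else koszul i B * (-1) ^+ before (B i) r
       * v [eta B with i |-> maya_add (B i) r].

(* Applied to v, and read on a given B, the sum over (m, n') has finite
   support: m + 1/2 must be in B and - n' - 1/2 outside B. *)
Definition bilinear (A : 'I_n -> 'I_n -> nat -> nat -> R) (v : fock) : fock :=
  fun B => \sum_i \sum_j \sum_(p \in [set: nat * nat])
    A i j p.1 p.2 * psi i p.1%:Z (psi_star j (- p.2%:Z - 1) v) B.

(* exp (sum A^{ij}_{mn'} psi^i_{m+1/2} psi^{j*}_{-n'-1/2}) |0>; only one l
   contributes to the coefficient on a given B. *)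
Definition exp_vacuum (A : 'I_n -> 'I_n -> nat -> nat -> R) : fock :=
  fun B => \sum_(l \in [set: nat])
    (l`!%:R^-1 : K) *: iter l (bilinear A) vacuum B.

Definition bogoliubov (V : fock) : Prop := exists A, V = exp_vacuum A.

End Fock.

Definition framed_ADKMV (k : fieldType) : Prop :=
  forall (a : 'I_3 -> int) (mu : 'I_3 -> part),
    framed_vertexW k a mu
    = bra mu (@exp_vacuum (qfield k) (qfield k)^o 3 (adkmv_coef k a)).

Definition det2 (u v : int * int) : int := u.1 * v.2 - u.2 * v.1.

(* A (smooth) toric Calabi-Yau threefold: its fan is the fan of cones over the
   lattice triangles of a unimodular triangulation in the plane at height one.
   The vertices of each triangle are listed clockwise.  Two triangles meet along
   a common face, and the dual graph, that is the toric diagram, is connected. *)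
Record toric_cy3 := ToricCY3 {
  ncones : nat;
  vert : 'I_ncones -> 'I_3 -> int * int;
  vert_unimodular : forall t,
    det2 (vert t 1 - vert t 0) (vert t (1 + 1) - vert t 0) = -1;
  vert_neq : forall t t', t != t' -> exists i, forall j, vert t i <> vert t' j;
  vert_face : forall t t' (c c' : 'I_3 -> rat),
    (forall i, 0 <= c i) -> (forall i, 0 <= c' i) ->
    \sum_i c i = 1 -> \sum_i c' i = 1 ->
    \sum_i c i * (vert t i).1%:~R = \sum_i c' i * (vert t' i).1%:~R ->
    \sum_i c i * (vert t i).2%:~R = \sum_i c' i * (vert t' i).2%:~R ->
    forall i, c i != 0 -> exists j, vert t i = vert t' j;
  ncones_gt0 : (0 < ncones)%N;
  vert_connected : forall t t', connect
    (fun u u' => [exists i, exists j,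
       (vert u i == vert u' (j + 1)) && (vert u (i + 1) == vert u' j)]) t t' }.

Section ToricDiagram.
Variables (k : fieldType) (X : toric_cy3).

(* The toric diagram has one vertex for each triangle; its half-edges at the
   vertex t are (t, 0), (t, 1), (t, 2), in clockwise order, (t, i) being dual to
   the side [vert t i, vert t (i + 1)]. *)
Definition half_edge : finType := ('I_(ncones X) * 'I_3)%type.
Implicit Types (h : half_edge) (mu : half_edge -> part) (a : half_edge -> int).

Definition next_edge h : half_edge := (h.1, h.2 + 1).
Definition side_src h : int * int := vert h.1 h.2.
Definition side_tgt h : int * int := vert h.1 (h.2 + 1).
Definition apex h : int * int := vert h.1 (h.2 + 1 + 1).

(* The two half-edges form a compact edge. *)
Definition facing h h' : bool :=
  (side_src h == side_tgt h') && (side_tgt h == side_src h').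
Definition compact_edge h : bool := [exists h', facing h h'].

(* First Betti number: compact edges - vertices + 1 *)
Definition nloops : nat :=
  ((#|[pred h | compact_edge h]|./2).+1 - ncones X)%N.

(* Outward normal to the side *)
Definition direction h : int * int :=
  let e := side_tgt h - side_src h in (- e.2, e.1).

(* Framing a corresponds to the vector f - a v, with v the direction of the edge
   and f the canonical framing, that is the direction of the next edge. *)
Definition framing_vec h (a : int) : int * int :=
  direction (next_edge h) - direction h *~ a.

(* Framing f on hb is the canonical framing on ha; facing edges have opposite
   directions, hence matching framings have opposite vectors. *)
Definition framing_match (ha hb : half_edge) (f : int) : Prop :=
  framing_vec hb f = - framing_vec ha 0.

Definition opposite h : half_edge := odflt h [pick h' | facing h h'].

(* The class in H_2(X) of the copy of P^1 given by the compact edge of h, by its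
   intersection numbers with the toric divisors, i.e. the coefficients of
     apex h + apex (opposite h) = (1 + f) side_src h + (1 - f) side_tgt h
   where f is the framing shift. *)
Definition curve_class_of h : {ffun half_edge -> int} :=
  let f := det2 (direction (next_edge (opposite h))) (direction (next_edge h)) in
  [ffun h0 => let p := side_src h0 in
     (p == apex h)%:R + (p == apex (opposite h))%:R
     - (1 + f) * (p == side_src h)%:R - (1 - f) * (p == side_tgt h)%:R].

(* One variable Q for each class of compact edges *)
Definition curve_class : finType :=
  seq_sub [seq curve_class_of h | h in [pred h | compact_edge h]].

Definition coef_ring (g : nat) := series (qfield k) curve_class g.

(* Q^d, for the Q of the compact edge of h *)
Definition Qpow h (d : nat) : coef_ring 0 :=
  monomial _ ([ffun c => if val c == curve_class_of h then d else 0%N], 0).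

Definition edge_factor h (f : int) (nu : part) : coef_ring 0 :=
  ((-1) ^ ((f + 1) * (sumn nu)%:Z) * qpow k (- (f * kappa nu)%:~R / 2))
    *: Qpow h (sumn nu).

(* W^{(a)}_{mu} at the vertex of h, with edges listed clockwise from h *)
Definition vertex_term a mu h : qfield k :=
  framed_vertexW k (fun i => a (h.1, h.2 + i)) (fun i => mu (h.1, h.2 + i)).

(* S = sum_nu F nu, coefficientwise.  Below F nu is divisible by Q^{|nu|}, so
   that all the supports are finite. *)
Definition is_part_sum (F : part -> coef_ring 0) (S : coef_ring 0) : Prop :=
  forall e, S e = \sum_(nu \in [set: part]) F nu e.

(* gluing T G a Z: Z is a generating function, with framings a, of the toric
   diagram made of the vertices in T, where the half-edges in G have been glued.
   Z mu is the coefficient of prod_h s_{mu h}(x^h); it depends only on the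
   values of a and mu on the half-edges at T outside G. *)
Inductive gluing : {set 'I_(ncones X)} -> {set half_edge} ->
    (half_edge -> int) -> ((half_edge -> part) -> coef_ring 0) -> Prop :=
| gluing_vertex h a Z :
    (forall mu, Z mu = (vertex_term a mu h)%:A) ->
    gluing [set h.1]%SET finset.set0 a Z
| gluing_add_vertex (T : {set 'I_(ncones X)}) (G : {set half_edge}) a
    (ha hb : half_edge) (f : int) Z' Z :
    ha.1 \in T -> ha \notin G -> hb.1 \notin T ->
    facing ha hb -> framing_match ha hb f ->
    gluing T G [eta a with ha |-> 0] Z' ->
    (forall mu, is_part_sum (fun nu =>
       vertex_term [eta a with hb |-> 0] [eta mu with hb |-> conj_part nu] hb
         *: (Z' [eta mu with ha |-> nu] * edge_factor ha f nu)) (Z mu)) ->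
    gluing (hb.1 |: T)%SET (ha |: (hb |: G))%SET a Z
| gluing_add_edge (T : {set 'I_(ncones X)}) (G : {set half_edge}) a
    (ha hb : half_edge) (f : int) Z'' Z :
    ha.1 \in T -> ha \notin G -> hb.1 \in T -> hb \notin G ->
    facing ha hb -> framing_match ha hb f ->
    gluing T G [eta a with ha |-> 0, hb |-> 0] Z'' ->
    (forall mu, is_part_sum (fun nu =>
       Z'' [eta mu with ha |-> nu, hb |-> conj_part nu] * edge_factor ha f nu)
       (Z mu)) ->
    gluing T (ha |: (hb |: G))%SET a Z.

(* L enumerates the noncompact edges. *)
Definition outer_branes (n : nat) (L : 'I_n -> half_edge) : Prop :=
  injective L /\ forall h, ~~ compact_edge h <-> exists i, L i = h.

(* Generating function of all invariants, for the framing a_i on L_i *)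
Definition generating_function (n : nat) (L : 'I_n -> half_edge)
    (a : 'I_n -> int) (Zt : ('I_n -> part) -> coef_ring 0) : Prop :=
  exists (a' : half_edge -> int) (Z' : (half_edge -> part) -> coef_ring 0),
    [/\ gluing finset.setT (finset (fun h => compact_edge h)) a' Z',
        forall i, a' (L i) = a i &
        forall mu, Z' mu = Zt (fun i => mu (L i))].

(* Z = Zt / Z_closed with Z_closed = Zt (empty, ..., empty), which has constant
   term 1 *)
Definition open_generating_function (n : nat) (L : 'I_n -> half_edge)
    (a : 'I_n -> int) (Z : ('I_n -> part) -> coef_ring 0) : Prop :=
  exists2 Zt, generating_function L a Zt &
    forall mu : 'I_n -> part, Z mu * Zt (fun=> part0) = Zt mu.

End ToricDiagram.

(* Main.v *)
(* By Wick's theorem, the pairing of a Bogoliubov transform with <mu| is the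
   determinant of its coefficients on the Frobenius coordinates (arms and legs)
   of mu; the conjecture gives such a determinant for each trivalent vertex.
   Gluing two half-edges sums over a partition nu, that is over two finite sets
   of arms and legs with the same cardinal. Dropping the condition on the
   cardinals, the sum runs over all the finite sets of modes, and the modes can
   be eliminated one at a time by
     det A s + w det A (s, e) = (1 + w A e e) det A' s,
   with A' a rank one perturbation of A; this converges Q-adically once
   Q^(m + n + 1) is shared between the arm m and the leg n, hence the square
   roots of the Q's. For a new vertex, the determinants of the unbalanced sets
   vanish, the matrix being block diagonal. For a new loop, they are discarded
   by the constant term after weighting the arms by Theta and the legs by
   Theta^-1. One ends up with the constant term of c(Theta) det A for a series
   c = 1 + O(Q), and the factor c, divided by its constant term, is absorbed by
   a change of the variables Theta_i. *)
From HB Require Import structures.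
From mathcomp Require Import all_boot all_order all_algebra.
From mathcomp Require Import finmap boolp classical_sets cardinality fsbigop.
From mathcomp Require Import perm zify ring.
Require Import Defs.

Set Implicit Arguments.
Unset Strict Implicit.
Unset Printing Implicit Defensive.

Import Order.TTheory GRing.Theory Num.Theory.
Local Open Scope ring_scope.

(** A scalar factor cannot be spread over the entries of a determinant uniformly in its size,
    whereas a ring homomorphism may be applied entrywise. So the factor c is absorbed by a ring
    endomorphism sigma such that the constant term of sigma f is that of c f for every f. For sigma
    : Theta_i -> Theta_i u_i this says that Theta^m u^m and Theta^m c have the same constant term
    for every integer vector m. At m = 0 it demands that c have constant term 1, and division by the
    closed invariants provides exactly that. For m nonzero it is solved degree by degree in the Q's,
    each time dividing by a nonzero entry of m, hence characteristic 0. Eliminating the modes one at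
    a time is possible because conjugation exchanges arms and legs: arm m of nu at one half-edge is
    leg m of its conjugate at the other. A single mode therefore always adds one row and one column
    to the determinant, even when arms and legs are unequal in number. *)

(** * Congruence modulo powers of the Q's, limits and inverses of series *)

Section SeriesCongruence.
Variables (K : fieldType) (I : finType) (g : nat).
Implicit Types (f h : series K I g) (e : expo I g).

Lemma coefD f h e : (f + h) e = f e + h e. Proof. by []. Qed.
Lemma coefN f e : (- f) e = - f e. Proof. by []. Qed.
Lemma coefB f h e : (f - h) e = f e - h e. Proof. by []. Qed.
Lemma coef0 e : (0 : series K I g) e = 0. Proof. by []. Qed.
Lemma coefZ (c : K) f e : (c *: f) e = c * f e. Proof. by []. Qed.
Lemma coef_monomial a e : monomial K a e = (e == a)%:R. Proof. by []. Qed.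

Lemma coef_sum (T : Type) (s : seq T) (P : pred T) (F : T -> series K I g) e :
  (\sum_(x <- s | P x) F x) e = \sum_(x <- s | P x) F x e.
Proof. by elim/big_rec2: _ => // x c f _ <-. Qed.

Definition qdeg e := (\sum_i e.1 i)%N.

Lemma qdegD a b : qdeg (a + b) = (qdeg a + qdeg b)%N.
Proof. by rewrite /qdeg -big_split; apply: eq_bigr => i _; rewrite ffunE. Qed.

(* Congruence modulo the k-th power of the ideal generated by the Q's. *)
Variant eqm (k : nat) f h : Prop :=
  Eqm of forall e, (qdeg e < k)%N -> f e = h e.

Lemma eqmE k f h e : eqm k f h -> (qdeg e < k)%N -> f e = h e.
Proof. by case=> fh; exact: fh. Qed.

Lemma eqm_refl k f : eqm k f f. Proof. by split. Qed.
Hint Resolve eqm_refl : core.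
Lemma eqm_sym k f h : eqm k f h -> eqm k h f.
Proof. by move=> [fh]; split=> e /fh. Qed.
Lemma eqm_trans k f1 f2 f3 : eqm k f1 f2 -> eqm k f2 f3 -> eqm k f1 f3.
Proof. by move=> [f12] [f23]; split=> e ek; rewrite f12// f23. Qed.
Lemma eqm_leq k j f h : (j <= k)%N -> eqm k f h -> eqm j f h.
Proof. by move=> jk [fh]; split=> e ej; apply: fh; exact: leq_trans jk. Qed.
Lemma eqm0n f h : eqm 0 f h. Proof. by split. Qed.
Lemma eqm_eq f h : (forall k, eqm k f h) -> f = h.
Proof. by move=> fh; apply: seriesP => e; exact: (eqmE (fh (qdeg e).+1)). Qed.
Lemma eqm_sub0 k f h : eqm k f h <-> eqm k (f - h) 0.
Proof.
split=> -[fh]; split=> e /fh; rewrite coefB coef0.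
  by move=> ->; rewrite subrr.
by move/subr0_eq.
Qed.
Lemma eqmD k f f' h h' : eqm k f f' -> eqm k h h' -> eqm k (f + h) (f' + h').
Proof. by move=> [ff'] [hh']; split=> e ek; rewrite !coefD ff'// hh'. Qed.
Lemma eqmN k f f' : eqm k f f' -> eqm k (- f) (- f').
Proof. by move=> [ff']; split=> e ek; rewrite !coefN ff'. Qed.
Lemma eqmB k f f' h h' : eqm k f f' -> eqm k h h' -> eqm k (f - h) (f' - h').
Proof. by move=> ff' hh'; apply/eqmD/eqmN. Qed.
Lemma eqmZ k (c : K) f f' : eqm k f f' -> eqm k (c *: f) (c *: f').
Proof. by move=> [ff']; split=> e ek; rewrite !coefZ ff'. Qed.
Lemma eqm_sum k (T : eqType) (s : seq T) (F F' : T -> series K I g) :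
  (forall x, x \in s -> eqm k (F x) (F' x)) ->
  eqm k (\sum_(x <- s) F x) (\sum_(x <- s) F' x).
Proof.
move=> FF'; split=> e ek; rewrite !coef_sum big_seq [RHS]big_seq.
by apply: eq_bigr => x xs; exact: eqmE (FF' x xs) ek.
Qed.

Lemma eqm_mul0 j k f h : eqm j f 0 -> eqm k h 0 -> eqm (j + k) (f * h) 0.
Proof.
move=> [fj] [hk]; split=> e ejk; apply: mul_coef_eq0 => a b abe.
have [aj|ja] := ltnP (qdeg a) j; first by rewrite fj// coef0 mul0r.
rewrite hk ?coef0 ?mulr0//; move: ejk; rewrite -abe qdegD; lia.
Qed.
Lemma eqm_mulr0 k f h : eqm k f 0 -> eqm k (f * h) 0.
Proof. move=> fk; rewrite -[k]addn0; exact: eqm_mul0 fk (eqm0n _ _). Qed.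
Lemma eqm_mull0 k f h : eqm k h 0 -> eqm k (f * h) 0.
Proof. by rewrite mulrC; exact: eqm_mulr0. Qed.

Lemma eqmM k f f' h h' : eqm k f f' -> eqm k h h' -> eqm k (f * h) (f' * h').
Proof.
move=> /eqm_sub0 ff' /eqm_sub0 hh'; apply/eqm_sub0.
have -> : f * h - f' * h' = (f - f') * h + f' * (h - h') by ring.
by rewrite -[0]addr0; apply: eqmD; [exact: eqm_mulr0|exact: eqm_mull0].
Qed.
Lemma eqmX k f f' n : eqm k f f' -> eqm k (f ^+ n) (f' ^+ n).
Proof. by move=> ff'; elim: n => [|n IHn] //; rewrite !exprS; exact: eqmM. Qed.
Lemma eqm_prod k (T : eqType) (s : seq T) (F F' : T -> series K I g) :
  (forall x, x \in s -> eqm k (F x) (F' x)) ->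
  eqm k (\prod_(x <- s) F x) (\prod_(x <- s) F' x).
Proof.
elim: s => [|x s IHs] FF'; rewrite ?big_nil// !big_cons.
apply: eqmM; first by apply: FF'; rewrite mem_head.
by apply: IHs => y ys; apply: FF'; rewrite inE ys orbT.
Qed.
Lemma eqm_expn k f : eqm 1 f 0 -> eqm k (f ^+ k) 0.
Proof.
by move=> f0; elim: k => [|k IHk]; [exact: eqm0n|rewrite exprS -add1n; exact: eqm_mul0].
Qed.

(** [qdeg (d, th)] does not involve [th], so all the coefficients at a fixed [d] come from one term
    of the sequence, whose Theta-support there is finite. *)
Lemma lim_series_finite (u : nat -> series K I g) (d : {ffun I -> nat}) :
  finite_set [set th | u (qdeg (d, th)).+1 (d, th) != 0].
Proof. exact: (coefP (u (qdeg (d, 0)).+1) d). Qed.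
Definition lim_series (u : nat -> series K I g) :=
  @Series K I g (fun e => u (qdeg e).+1 e) (lim_series_finite u).

Lemma eqm_lim u : (forall k, eqm k (u k) (u k.+1)) ->
  forall k, eqm k (lim_series u) (u k).
Proof.
move=> ustep k; split=> e ek /=.
have H j : u ((qdeg e).+1 + j)%N e = u (qdeg e).+1 e.
  elim: j => [|j IHj]; first by rewrite addn0.
  by rewrite addnS -IHj; symmetry; apply: eqmE (ustep _) _; rewrite addSn ltnS leq_addr.
by rewrite -(H (k - (qdeg e).+1)%N) subnKC.
Qed.

(** Inverses by classical choice, equal to [f] itself off the units, make [f^-1] and integer powers
    of units available. *)
Definition unit_series : pred (series K I g) :=
  fun f => `[< exists h, h * f = 1 >].
Definition inv_series f :=
  if pselect (exists h, h * f = 1) is left ex then sval (cid ex) else f.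

Lemma mulV_series : {in unit_series, left_inverse 1 inv_series *%R}.
Proof.
move=> f /asboolP exf; rewrite /inv_series.
by case: pselect => // ex; exact: (svalP (cid ex)).
Qed.
Lemma unit_seriesP f h : h * f = 1 -> unit_series f.
Proof. by move=> hf; apply/asboolP; exists h. Qed.
Lemma inv_series_out : {in [predC unit_series], inv_series =1 id}.
Proof.
move=> f /= nf; rewrite /inv_series; case: pselect => // ex.
by case/negP: nf; apply/asboolP.
Qed.
HB.instance Definition _ := GRing.ComNzRing_hasMulInverse.Build (series K I g)
  mulV_series unit_seriesP inv_series_out.

(** Truncated Neumann series for the inverse of [f]: multiplied by [f] it gives 1 - (1 - f)^k, and
    (1 - f)^k has Q-order k when f = 1 + O(Q). *)
Definition geom_series f k := \sum_(j < k) (1 - f) ^+ j.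

Lemma eqm1_geom f k : eqm 1 f 1 -> eqm k (f * geom_series f k) 1.
Proof.
move=> /eqm_sub0 /eqmN; rewrite oppr0 opprB => f1.
have -> : f * geom_series f k = 1 - (1 - f) ^+ k.
  rewrite /geom_series.
  have := subrX1 (1 - f) k => /(congr1 -%R); rewrite opprB => ->.
  by rewrite -mulNr opprB opprD addNKr opprK.
by rewrite -[X in eqm _ _ X]subr0; apply: eqmB => //; exact: eqm_expn.
Qed.

Lemma eqm1_unit f : eqm 1 f 1 -> f \is a GRing.unit.
Proof.
move=> f1; apply: (@unit_seriesP _ (lim_series (geom_series f))).
apply: eqm_eq => k; rewrite mulrC.
apply: eqm_trans (eqm1_geom k f1); apply: eqmM => //; apply: eqm_lim => {}k.
rewrite /geom_series big_ord_recr /= -[X in eqm _ X]addr0.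
apply: eqmD => //; apply: eqm_sym; apply: eqm_expn.
by move/eqm_sub0/eqmN: f1; rewrite oppr0 opprB.
Qed.

Lemma eqm1V f k : eqm 1 f 1 -> eqm k f^-1 (geom_series f k).
Proof.
move=> f1; rewrite -[f^-1]mulr1 -[geom_series f k](mulKr (eqm1_unit f1)).
by apply: eqmM => //; apply: eqm_sym; exact: eqm1_geom.
Qed.

Lemma eqmV k f f' : eqm 1 f 1 -> eqm 1 f' 1 -> eqm k f f' -> eqm k f^-1 f'^-1.
Proof.
move=> f1 f'1 ff'; have uf := eqm1_unit f1; have uf' := eqm1_unit f'1.
rewrite -[f'^-1](mulKr uf).
have {1}-> : f^-1 = f^-1 * (f' / f') by rewrite mulrV ?mulr1.
by apply: eqmM => //; apply: eqmM => //; exact: eqm_sym.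
Qed.

Lemma eqm1_inv f : eqm 1 f 1 -> eqm 1 f^-1 1.
Proof. by move=> f1; rewrite -[X in eqm _ _ X]invr1; exact: eqmV. Qed.

Lemma eqm1_prod (T : eqType) (s : seq T) (F : T -> series K I g) :
  (forall x, x \in s -> eqm 1 (F x) 1) -> eqm 1 (\prod_(x <- s) F x) 1.
Proof.
move=> F1; have {2}<- : \prod_(x <- s) (1 : series K I g) = 1 by rewrite big1.
exact: eqm_prod.
Qed.

Definition covers_deg k (s : seq (expo I g)) f :=
  uniq s /\ forall a, (qdeg a < k)%N -> f a != 0 -> a \in s.

Lemma covers_deg_ex2 f h k : exists s, covers_deg k s f /\ covers_deg k s h.
Proof.
have [s [sf sh _]] := covers_ex2 f h ([ffun=> k], 0).
have le a : (qdeg a < k)%N -> expo_le a ([ffun=> k], 0).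
  move=> ak; apply/forallP => i; rewrite ffunE; apply: leq_trans (ltnW ak).
  by rewrite /qdeg (bigD1 i)//= leq_addr.
by exists s; split; split=> [|a /le]; [case: sf|case: sf => _; apply
                                     |case: sh|case: sh => _; apply].
Qed.

Lemma covers_deg_eqm k s f : covers_deg k s f ->
  eqm k f (\sum_(a <- s) f a *: monomial K a).
Proof.
move=> [us sP]; split=> e ek.
rewrite coef_sum; under eq_bigr => a _ do rewrite coefZ coef_monomial mulrC.
have [es|es] := boolP (e \in s); first by rewrite (sum_eq_in f us es).
rewrite big1_seq => [|a /andP[_ sa]]; last first.
  by case: eqP es => [->|_ _]; rewrite ?sa// mul0r.
by apply: contraNeq es; exact: sP.
Qed.

Lemma monomialD (a b : expo I g) : monomial K (a + b) = monomial K a * monomial K b.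
Proof.
apply: seriesP => e; rewrite coef_monomial.
rewrite -[RHS]/(mul_coef (monomial K a) (monomial K b) e).
have c x : covers [:: x] (monomial K x) e.
  by split=> // y _; rewrite coef_monomial inE; case: (y == x); rewrite ?eqxx.
by rewrite (mul_coefE (c a) (c b)) !big_seq1 !coef_monomial !eqxx !mulr1 eq_sym.
Qed.
Lemma monomial0 : monomial K (0 : expo I g) = 1. Proof. by []. Qed.

Lemma eqm_monomial (a : expo I g) : eqm (qdeg a) (monomial K a) 0.
Proof.
by split=> e ea; rewrite coef_monomial coef0; case: eqP ea => // ->; rewrite ltnn.
Qed.

End SeriesCongruence.

(** * Continuous linear maps between rings of series, and their extension from monomials *)

Section ContinuousLinear.
Variables (K : fieldType) (I : finType).

Definition continuous_linear g g' (F : series K I g -> series K I g') :=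
  (forall c f h, F (c *: f + h) = c *: F f + F h) /\
  (forall k f h, eqm k f h -> eqm k (F f) (F h)).

Section Maps.
Variables g g' : nat.
Implicit Types F G : series K I g -> series K I g'.

Lemma clin0 F : continuous_linear F -> F 0 = 0.
Proof. by case=> F_lin _; have := F_lin (-1) 0 0; rewrite !scaleN1r !addNr. Qed.
Lemma clinD F f h : continuous_linear F -> F (f + h) = F f + F h.
Proof. by case=> F_lin _; rewrite -[f]scale1r F_lin !scale1r. Qed.
Lemma clinZ F c f : continuous_linear F -> F (c *: f) = c *: F f.
Proof.
by move=> cF; case: (cF) => F_lin _; rewrite -[c *: f]addr0 F_lin (clin0 cF) addr0.
Qed.
Lemma clin_sum F (T : Type) (s : seq T) (f : T -> series K I g) :
  continuous_linear F -> F (\sum_(x <- s) f x) = \sum_(x <- s) F (f x).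
Proof.
move=> cF; elim: s => [|x s IHs]; first by rewrite !big_nil clin0.
by rewrite !big_cons clinD// IHs.
Qed.

(** Modulo each power of the Q's a series is a finite combination of monomials, and continuity loses
    no Q-order. This reduces later identities between series to monomials. *)
Lemma clin_eq F G : continuous_linear F -> continuous_linear G ->
  (forall a, F (monomial K a) = G (monomial K a)) -> F =1 G.
Proof.
move=> cF cG FG f; apply: eqm_eq => k.
have [s [sf _]] := covers_deg_ex2 f f k; have ef := covers_deg_eqm sf.
apply: eqm_trans (cF.2 _ _ _ ef) _; apply: eqm_sym.
apply: eqm_trans (cG.2 _ _ _ ef) _; rewrite !clin_sum//.
by under eq_bigr => a _ do rewrite clinZ// -FG -clinZ//.
Qed.

Lemma clin_mul F h : continuous_linear F -> continuous_linear (fun f => h * F f).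
Proof.
move=> [F_lin F_cont]; split=> [c f f'|k f f' ff'].
  by rewrite F_lin mulrDr scalerAr.
by apply: eqmM => //; exact: F_cont.
Qed.

Lemma clin_comp g'' F (G : series K I g' -> series K I g'') :
  continuous_linear F -> continuous_linear G ->
  continuous_linear (fun f => G (F f)).
Proof.
move=> [F_lin F_cont] [G_lin G_cont]; split=> [c f h|k f h fh].
  by rewrite F_lin G_lin.
exact/G_cont/F_cont.
Qed.

End Maps.

Section Extension.
Variables g g' : nat.

Variable phi : expo I g -> series K I g'.

(* The infinite sum of the f a *: phi a, computed modulo each power of the
   ideal of the Q's. *)
Definition ext (f : series K I g) : series K I g' :=
  lim_series (fun k =>
    \sum_(a <- sval (cid (covers_deg_ex2 f f k))) f a *: phi a).

Hypothesis phi_deg : forall a, eqm (qdeg a) (phi a) 0.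

Lemma ext_term0 k a c : (k <= qdeg a)%N -> eqm k (c *: phi a) 0.
Proof.
move=> ka; rewrite -[0](scaler0 _ c); apply: eqmZ.
exact: eqm_leq (phi_deg a).
Qed.

Lemma covers_deg_sum k s s' f : covers_deg k s f -> covers_deg k s' f ->
  eqm k (\sum_(a <- s) f a *: phi a) (\sum_(a <- s') f a *: phi a).
Proof.
pose P a := (qdeg a < k)%N && (f a != 0).
have red r : eqm k (\sum_(a <- r) f a *: phi a) (\sum_(a <- filter P r) f a *: phi a).
  rewrite (bigID P)/= big_filter -[X in eqm _ _ X]addr0.
  apply: eqmD => //; rewrite -big_filter.
  have {2}<- : \sum_(a <- [seq a <- r | ~~ P a]) (0 : series K I g') = 0.
    by rewrite big1.
  apply: eqm_sum => a; rewrite mem_filter /P negb_and -leqNgt => /andP[/orP[] + _].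
    exact: ext_term0.
  by rewrite negbK => /eqP ->; rewrite scale0r.
move=> [us sP] [us' sP']; apply: eqm_trans (red s) _.
apply: eqm_sym; apply: eqm_trans (red s') _.
rewrite (perm_big (filter P s))//; apply: uniq_perm; rewrite ?filter_uniq// => a.
by rewrite !mem_filter /P; apply: andb_id2l => /andP[? ?]; rewrite sP ?sP'.
Qed.

Lemma covers_deg_le k j s (f : series K I g) : (j <= k)%N -> covers_deg k s f -> covers_deg j s f.
Proof.
by move=> jk [us sP]; split=> // a aj; apply: sP; exact: leq_trans jk.
Qed.

Lemma extE k s f : covers_deg k s f -> eqm k (ext f) (\sum_(a <- s) f a *: phi a).
Proof.
pose sk k := sval (cid (covers_deg_ex2 f f k)).
have skP j : covers_deg j (sk j) f by have [] := svalP (cid (covers_deg_ex2 f f j)).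
move=> sf; apply: (@eqm_trans _ _ _ _ _ (\sum_(a <- sk k) f a *: phi a)).
  rewrite -[\sum_(a <- _) _]/((fun k => \sum_(a <- sk k) f a *: phi a) k).
  apply: eqm_lim => {sf}k; apply: covers_deg_sum => //.
  exact: covers_deg_le (skP k.+1).
exact: covers_deg_sum.
Qed.

Lemma clin_ext : continuous_linear ext.
Proof.
have cont k f h : eqm k f h -> eqm k (ext f) (ext h).
  move=> fh; have [s [sf sh]] := covers_deg_ex2 f h k.
  apply: eqm_trans (extE sf) _; apply: eqm_sym; apply: eqm_trans (extE sh) _.
  apply: eqm_sum => a _; have [ak|ka] := ltnP (qdeg a) k.
    by rewrite (eqmE fh).
  by apply: eqm_trans (eqm_sym _); exact: ext_term0.
split=> // c f h; apply: eqm_eq => k.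
have [s [[us sf] [_ sh]]] := covers_deg_ex2 f h k.
apply: (@eqm_trans _ _ _ _ _ (\sum_(a <- s) (c *: f + h) a *: phi a)).
  apply: extE; split=> // a ak; rewrite coefD coefZ.
  case: (eqVneq (f a) 0) => [->|fa _]; last exact: sf.
  by rewrite mulr0 add0r; exact: sh.
under eq_bigr => a _ do rewrite coefD coefZ scalerDl -scalerA.
rewrite big_split -scaler_sumr; apply: eqm_sym.
by apply: eqmD; [apply: eqmZ|]; apply: extE.
Qed.

Lemma ext_monomial a : ext (monomial K a) = phi a.
Proof.
apply: eqm_eq => k; apply: eqm_trans (extE (s := [:: a]) _) _.
  by split=> // b _; rewrite coef_monomial inE; case: (b == a); rewrite ?eqxx.
by rewrite big_seq1 coef_monomial eqxx scale1r.
Qed.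

Hypothesis phi0 : phi 0 = 1.
Hypothesis phiD : forall a b, phi (a + b) = phi a * phi b.

Lemma ext1 : ext 1 = 1. Proof. by rewrite -monomial0 ext_monomial. Qed.

(** [clin_eq] is used once for each factor, which leaves a product of two monomials. *)
Lemma extM f h : ext (f * h) = ext f * ext h.
Proof.
have cl_id (h' : series K I g) : continuous_linear (fun f => h' * f).
  by split=> [c f1 f2|k f1 f2 ?]; [rewrite mulrDr scalerAr|exact: eqmM].
apply: (clin_eq (F := fun h => ext (f * h)) (G := fun h => ext f * ext h)).
- exact: clin_comp (cl_id f) clin_ext.
- exact: clin_mul clin_ext.
move=> b; rewrite mulrC [RHS]mulrC {h}.
apply: (clin_eq (F := fun f => ext (monomial K b * f))
                (G := fun f => ext (monomial K b) * ext f)).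
- exact: clin_comp (cl_id _) clin_ext.
- exact: clin_mul clin_ext.
by move=> a; rewrite -monomialD !ext_monomial phiD.
Qed.

End Extension.

Lemma clin_id g : continuous_linear (@id (series K I g)).
Proof. by split. Qed.

Lemma clin_constant_term g : continuous_linear (@constant_term K I g).
Proof.
split=> [c f h|k f h fh]; first exact: seriesP.
by split=> e ek; exact: eqmE fh _.
Qed.

Lemma constant_term_monomial g (a : expo I g) :
  constant_term (monomial K a) = if a.2 == 0 then monomial K (a.1, 0) else 0.
Proof.
case: a => d th; apply: seriesP => -[d' th'].
have -> : th' = 0 by apply/ffunP => -[].
rewrite -[LHS]/(monomial K (d, th) (d', 0)) coef_monomial xpair_eqE /=.
rewrite [0 == th]eq_sym; case: (eqVneq th 0) => _; last by rewrite andbF.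
by rewrite coef_monomial xpair_eqE eqxx andbT.
Qed.

Lemma constant_term0E (f : series K I 0) : constant_term f = f.
Proof.
apply: seriesP => -[d th] /=; congr (f (_, _)); first by apply/ffunP => -[].
Qed.

Definition subst_expo N g (a : expo I g) : expo I g :=
  ([ffun c => (N * a.1 c)%N], a.2).

Lemma subst_expoD N g : {morph @subst_expo N g : a b / a + b}.
Proof.
move=> a b; congr pair; apply/ffunP => c.
by rewrite !ffunE; exact: mulnDr.
Qed.

Section SubstPow.
Variables (N g : nat).
Hypothesis N_gt0 : (0 < N)%N.

Lemma clin_subst_pow : continuous_linear (@subst_pow K I g N).
Proof.
split=> [c f h|k f h fh].
  apply: seriesP => e; rewrite coefD coefZ /= /subst_pow_coef.
  by case: ifP => // _; rewrite mulr0 addr0.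
split=> e ek; rewrite /= /subst_pow_coef; case: ifP => // _.
apply: eqmE fh _; apply: leq_ltn_trans ek; apply: leq_sum => i _.
by rewrite ffunE leq_div.
Qed.

Lemma subst_pow_monomial a :
  subst_pow N (monomial K a) = monomial K (subst_expo N a) :> series K I g.
Proof.
apply: seriesP => e; rewrite coef_monomial /= /subst_pow_coef.
case: forallP => [dvd|ndvd]; last first.
  case: eqP => // ea; case: ndvd => c; rewrite ea ffunE; exact: dvdn_mulr.
rewrite coef_monomial; congr ((nat_of_bool _)%:R); apply/eqP/eqP => [<-|->].
  case: e dvd => d th /= dvd; congr pair; apply/ffunP => c.
  by rewrite !ffunE /= mulnC divnK.
case: a => d th; congr pair; apply/ffunP => c.
by rewrite !ffunE mulKn.
Qed.

(** The substitution is recognized as the [ext] of a multiplicative map on monomials, so that no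
    convolution of coefficients has to be reindexed. *)
Lemma subst_powM f h :
  subst_pow N (f * h) = subst_pow N f * subst_pow N h :> series K I g.
Proof.
pose phi (a : expo I g) := monomial K (subst_expo N a).
have phi_deg a : eqm (qdeg a) (phi a) 0.
  apply: eqm_leq (eqm_monomial _ _); apply: leq_sum => i _.
  by rewrite ffunE leq_pmull.
have E : subst_pow N =1 ext phi.
  apply: clin_eq => [||a]; [exact: clin_subst_pow|exact: clin_ext|].
  by rewrite subst_pow_monomial ext_monomial.
rewrite !E extM// => a b; first by rewrite /phi subst_expoD monomialD.
Qed.

Lemma subst_pow1 : subst_pow N 1 = 1 :> series K I g.
Proof.
rewrite -monomial0 subst_pow_monomial; congr monomial.
by congr pair; apply/ffunP => c; rewrite !ffunE muln0.
Qed.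

End SubstPow.

Section Embedding.
Variables g g' : nat.
Variable widen : {ffun 'I_g -> int} -> {ffun 'I_g' -> int}.
Hypothesis widenD : {morph widen : a b / a + b}.
Hypothesis widen0 : widen 0 = 0.

(** Kept general in [widen] for two uses: adjoining one Theta when a loop is closed, and viewing
    series without Theta inside those with g of them. *)
Definition embed : series K I g -> series K I g' :=
  ext (fun a => monomial K (a.1, widen a.2)).

Lemma embed_deg (a : expo I g) : eqm (qdeg a) (monomial K (a.1, widen a.2)) 0.
Proof. exact: (eqm_monomial _ (a.1, widen a.2)). Qed.
Lemma clin_embed : continuous_linear embed.
Proof. exact: clin_ext embed_deg. Qed.
Lemma embed_monomial a : embed (monomial K a) = monomial K (a.1, widen a.2).
Proof. exact: ext_monomial embed_deg a. Qed.
Lemma embed1 : embed 1 = 1.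
Proof. by rewrite -monomial0 embed_monomial widen0. Qed.
Lemma embedM f h : embed (f * h) = embed f * embed h.
Proof.
apply: extM embed_deg _ f h => a b /=.
by rewrite widenD -monomialD.
Qed.

End Embedding.

End ContinuousLinear.

(** * Absorbing a weight in the constant term by a change of the Thetas *)

Section ChangeOfVariables.
Variables (K : fieldType) (I : finType) (g : nat).
Hypothesis K_char0 : forall z : int, z != 0 -> z%:~R != 0 :> K.
Notation R := (series K I g).
Notation theta_expo := {ffun 'I_g -> int}.
Implicit Types (f h : R) (e : expo I g) (u : 'I_g -> R) (m th : theta_expo).

Definition theta_monomial m : R := monomial K (0, m).

Lemma coef_theta_monomialM m f d th :
  (theta_monomial m * f) (d, th) = f (d, th - m).
Proof.
have [s sf] := covers_ex f (d, th).
have c : covers [:: (0, m)] (theta_monomial m) (d, th).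
  split=> // y _; rewrite coef_monomial inE; case: (y == _); rewrite ?eqxx//.
rewrite -[LHS]/(mul_coef _ _ _) (mul_coefE c sf) big_seq1 coef_monomial eqxx.
have E b : ((0, m) + b == (d, th)) = ((d, th - m) == b).
  case: b => d' th'; rewrite -[(0, m) + _]/(0 + d', m + th') add0r !xpair_eqE.
  by rewrite [d == _]eq_sym subr_eq [th' + m]addrC [th == _]eq_sym.
under eq_bigr => b _ do rewrite E mul1r.
case: sf => us sP; have [bs|bs] := boolP ((d, th - m) \in s).
  by rewrite (sum_eq_in f us bs).
rewrite big1_seq => [|b /andP[_ sb]]; last first.
  by case: eqP bs => [->|_ _]; rewrite ?sb// mul0r.
by apply: esym; apply: contraNeq bs; apply: sP; apply/forallP => i; exact: leqnn.
Qed.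

Lemma constant_term_monomialM d f :
  constant_term (monomial K (d, 0) * f) = monomial K (d, 0) * constant_term f.
Proof.
apply: (clin_eq (F := fun f => constant_term (monomial K (d, 0) * f))
  (G := fun f => monomial K (d, 0) * constant_term f)).
- apply: clin_comp (clin_constant_term _ _ _).
  exact: clin_mul (clin_id _ _ _).
- exact: clin_mul (clin_constant_term _ _ _).
move=> -[d' th]; rewrite -monomialD !constant_term_monomial /= add0r.
by case: eqP => _; rewrite ?mulr0// -monomialD -[(d, 0) + _]/(_, _) addr0.
Qed.

Lemma coef_constant_term f d (th : {ffun 'I_0 -> int}) :
  constant_term f (d, th) = f (d, 0).
Proof. by []. Qed.

Section IntegerPowers.
Implicit Types x y : R.

Lemma eqm_sum0 k (T : eqType) (s : seq T) (F : T -> R) :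
  (forall i, eqm k (F i) 0) -> eqm k (\sum_(i <- s) F i) 0.
Proof.
move=> F0; have {2}<- : \sum_(i <- s) (0 : R) = 0 by rewrite big1.
by apply: eqm_sum => i _.
Qed.

Lemma eqm_mulrz0 k x (z : int) : eqm k x 0 -> eqm k (x *~ z) 0.
Proof. by move=> xk; rewrite -mulrzr; exact: eqm_mulr0. Qed.

Lemma eqm_expz k x y (z : int) :
  eqm 1 x 1 -> eqm 1 y 1 -> eqm k x y -> eqm k (x ^ z) (y ^ z).
Proof.
move=> x1 y1 xy; case: z => n; first exact: eqmX.
rewrite NegzE -!exprnN; have X1 w : eqm 1 w 1 -> eqm 1 (w ^+ n.+1) 1.
  by move=> w1; rewrite -[X in eqm _ _ X](expr1n _ n.+1); exact: eqmX.
by apply: eqmV; [exact: X1|exact: X1|exact: eqmX].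
Qed.

Lemma eqm1_expz x (z : int) : eqm 1 x 1 -> eqm 1 (x ^ z) 1.
Proof. by move=> x1; rewrite -[X in eqm _ _ X](exp1rz _ z); exact: eqm_expz. Qed.

(** Since k > 0, x^2 has Q-order at least k + 1, so only the linear term of the binomial expansion
    survives. For negative powers, 1 - n x inverts 1 + n x up to n^2 x^2. *)
Lemma eqm_expz_linear k x (z : int) : (0 < k)%N -> eqm k x 0 ->
  eqm k.+1 ((1 + x) ^ z) (1 + x *~ z).
Proof.
move=> k0 xk; have x2 h : eqm k.+1 (x * x * h) 0.
  by apply/eqm_mulr0/(eqm_leq _ (eqm_mul0 xk xk)); rewrite -addn1 leq_add2l.
have pos (n : nat) : eqm k.+1 ((1 + x) ^+ n) (1 + x *+ n).
  elim: n => [|n IHn]; first by rewrite addr0.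
  rewrite exprS; apply: (@eqm_trans _ _ _ _ _ ((1 + x) * (1 + x *+ n))).
    exact: eqmM.
  apply/eqm_sub0; suff -> : (1 + x) * (1 + x *+ n) - (1 + x *+ n.+1)
    = x * x * n%:R by exact: x2.
  by rewrite mulrS -[x *+ n]mulr_natr; ring.
case: z => n; first exact: pos.
have x1 : eqm 1 (1 + x) 1.
  rewrite -[X in eqm _ _ X]addr0; apply: eqmD => //; exact: eqm_leq xk.
have ux : (1 + x) ^+ n.+1 \is a GRing.unit by rewrite unitrX// eqm1_unit.
rewrite NegzE -exprnN -[_^-1]mulr1 -[X in eqm _ _ X](mulKr ux).
apply: eqmM => //; apply: eqm_sym.
apply: (@eqm_trans _ _ _ _ _ ((1 + x *+ n.+1) * (1 - x *+ n.+1))).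
  by apply: eqmM => //; rewrite mulrNz.
apply/eqm_sub0.
suff -> : (1 + x *+ n.+1) * (1 - x *+ n.+1) - 1 = x * x * - (n.+1%:R ^+ 2).
  exact: x2.
by rewrite -[x *+ n.+1]mulr_natr; ring.
Qed.

Lemma eqm_prod_linear k (T : eqType) (s : seq T) (F : T -> R) :
  (0 < k)%N -> (forall i, eqm k (F i) 0) ->
  eqm k.+1 (\prod_(i <- s) (1 + F i)) (1 + \sum_(i <- s) F i).
Proof.
move=> k0 Fk; elim: s => [|x s IHs]; first by rewrite !big_nil addr0.
rewrite !big_cons; apply: (@eqm_trans _ _ _ _ _ ((1 + F x) * (1 + \sum_(i <- s) F i))).
  exact: eqmM.
apply/eqm_sub0.
set S := \sum_(i <- s) F i.
have -> : (1 + F x) * (1 + S) - (1 + (F x + S)) = F x * S by ring.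
apply: (@eqm_leq _ _ _ (k + k)); first by rewrite -addn1 leq_add2l.
apply: eqm_mul0 => //; exact: eqm_sum0.
Qed.

End IntegerPowers.

Definition unit_pow u m : R := \prod_(i <- enum 'I_g) u i ^ m i.

Lemma unit_powD u m m' : (forall i, eqm 1 (u i) 1) ->
  unit_pow u (m + m') = unit_pow u m * unit_pow u m'.
Proof.
move=> u1; rewrite -big_split; apply: eq_bigr => i _ /=.
by rewrite ffunE exprzDr// eqm1_unit.
Qed.

Lemma unit_pow0 u : unit_pow u 0 = 1.
Proof. by rewrite /unit_pow big1// => i _; rewrite ffunE expr0z. Qed.

Lemma eqm1_unit_pow u m : (forall i, eqm 1 (u i) 1) -> eqm 1 (unit_pow u m) 1.
Proof. by move=> u1; apply: eqm1_prod => i _; exact: eqm1_expz. Qed.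

Lemma eqm_unit_pow k u u' m : (forall i, eqm 1 (u i) 1) ->
  (forall i, eqm 1 (u' i) 1) -> (forall i, eqm k (u i) (u' i)) ->
  eqm k (unit_pow u m) (unit_pow u' m).
Proof. by move=> u1 u'1 uu'; apply: eqm_prod => i _; exact: eqm_expz. Qed.

(* A linear bound on the Theta-exponents in terms of the Q-degree: the powers
   of u satisfy it uniformly in the exponent. *)
Definition theta_bounded (M : nat) f :=
  forall e, f e != 0 -> forall i, (`|e.2 i| <= M * qdeg e)%N.

Lemma theta_bounded1 M : theta_bounded M 1.
Proof.
move=> e; rewrite -monomial0 coef_monomial; case: (eqVneq e 0) => [-> _ i|]; last by rewrite eqxx.
by rewrite ffunE.
Qed.
Lemma theta_boundedD M f h :
  theta_bounded M f -> theta_bounded M h -> theta_bounded M (f + h).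
Proof.
move=> fM hM e; rewrite coefD; case: (eqVneq (f e) 0) => [->|/fM fe _ //].
by rewrite add0r => /hM.
Qed.
Lemma theta_boundedB M f h :
  theta_bounded M f -> theta_bounded M h -> theta_bounded M (f - h).
Proof.
by move=> fM hM; apply: theta_boundedD => // e; rewrite coefN oppr_eq0 => /hM.
Qed.
Lemma theta_boundedM M f h :
  theta_bounded M f -> theta_bounded M h -> theta_bounded M (f * h).
Proof.
move=> fM hM e fhe i; apply: contraNT fhe => nle; apply/eqP/mul_coef_eq0 => a b abe.
case: (eqVneq (f a) 0) => [->|/fM/(_ i) fa]; first by rewrite mul0r.
case: (eqVneq (h b) 0) => [->|/hM/(_ i) hb]; first by rewrite mulr0.
case/negP: nle; rewrite -abe qdegD [(a + b).2]/= ffunE.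
rewrite mulnDr; apply: leq_trans (leq_add fa hb).
by move: (a.2 i) (b.2 i) => x y; lia.
Qed.
Lemma theta_boundedX M f n : theta_bounded M f -> theta_bounded M (f ^+ n).
Proof.
move=> fM; elim: n => [|n IHn]; first exact: theta_bounded1.
by rewrite exprS; exact: theta_boundedM.
Qed.
Lemma theta_boundedV M f : eqm 1 f 1 -> theta_bounded M f -> theta_bounded M f^-1.
Proof.
move=> f1 fM e; rewrite (eqmE (eqm1V (qdeg e).+1 f1))//.
move: (qdeg e).+1 => k; move: e.
rewrite -/(theta_bounded M (geom_series f k)) /geom_series; elim: k => [|k IHk].
  by rewrite big_ord0 => e; rewrite eqxx.
rewrite big_ord_recr /=; apply: theta_boundedD => //; apply: theta_boundedX.
by apply: theta_boundedB => //; exact: theta_bounded1.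
Qed.
Lemma theta_bounded_unit_pow M u m : (forall i, eqm 1 (u i) 1) ->
  (forall i, theta_bounded M (u i)) -> theta_bounded M (unit_pow u m).
Proof.
move=> u1 uM; rewrite /unit_pow; elim: (enum _) => [|i s IHs].
  by rewrite big_nil; exact: theta_bounded1.
rewrite big_cons; apply: theta_boundedM => //; case: (m i) => n.
  exact: theta_boundedX.
rewrite NegzE -exprnN; apply: theta_boundedV; last exact: theta_boundedX.
exact: (eqm1_expz n.+1).
Qed.
Lemma theta_bounded_leq M M' f :
  (M <= M')%N -> theta_bounded M f -> theta_bounded M' f.
Proof. by move=> MM' fM e /fM fe i; rewrite (leq_trans (fe i))// leq_mul2r MM' orbT. Qed.

Lemma finite_theta_box M : finite_set [set m : theta_expo | forall i, (`|m i| <= M)%N].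
Proof.
pose q (v : {ffun 'I_g -> 'I_(M + M).+1}) : theta_expo :=
  [ffun i => (v i)%:Z - M%:Z].
apply: (@sub_finite_set _ _ (range q)).
  move=> m mM; exists [ffun i => inord (absz (m i + M%:Z))] => //.
  apply/ffunP => i; have mi : (`|m i| <= M)%N := mM i; rewrite !ffunE.
  by move: (m i) mi => x xM; rewrite inordK; lia.
by apply: finite_image; exact: finite_finset.
Qed.

Variable c : R.
Hypothesis c1 : eqm 1 c 1.
Hypothesis ct_c : constant_term c = 1.

(** Under Theta_i := Theta_i u_i the monomial Theta^m becomes Theta^m u^m; the last clause says
    that, up to Q-order k, this substitution turns plain constant terms of monomials into
    [c]-weighted ones. One bound [M] for all i controls all the powers u^m together. *)
Definition moments_upto k u := [/\ forall i, eqm 1 (u i) 1,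
  exists M, forall i, theta_bounded M (u i) &
  forall m, eqm k (constant_term (theta_monomial m * unit_pow u m))
                  (constant_term (theta_monomial m * c))].

(** Multiplying u_i by 1 + h_i, with h_i homogeneous of Q-degree k, leaves the moments unchanged
    below degree k. In degree k it adds to the m-th moment the sum over i of m_i times the
    coefficient of h_i at Theta^(-m). Different m involve different coefficients, so the linear
    equations decouple. *)
Lemma moments_step k u : (0 < k)%N -> moments_upto k u ->
  exists2 u', moments_upto k.+1 u' & forall i, eqm k (u i) (u' i).
Proof.
move=> k0 [u1 [M uM] mom].
(* At Theta-exponent -m the defect of the m-th moment is charged to a single index i with m_i
   nonzero and divided by m_i = - e.2 i; the other corrections vanish there. *)
pose h_coef i e := if (qdeg e == k) && ([pick i | e.2 i != 0] == Some i)
  then (c e - unit_pow u (- e.2) e) / (- e.2 i)%:~R else 0.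
have h_supp i e : h_coef i e != 0 -> qdeg e = k /\
    (c e != 0 \/ forall i, (`|e.2 i| <= M * k)%N).
  rewrite /h_coef; case: ifP => [/andP[/eqP ek _]|]; last by rewrite eqxx.
  move=> he; split=> //; case: (eqVneq (c e) 0) => [ce|]; last by left.
  right; rewrite -ek; apply: (theta_bounded_unit_pow (m := - e.2) u1 uM).
  by apply: contra_neq he => ->; rewrite ce subr0 mul0r.
(* The power of [u] that enters varies with [th], so finiteness comes from the bound [M], uniform in
   the power, and not from [coefP] for one series. *)
have h_fin i (d : {ffun I -> nat}) : finite_set [set th | h_coef i (d, th) != 0].
  apply: (@sub_finite_set _ _ ([set th | c (d, th) != 0]
      `|` [set m : theta_expo | forall i, (`|m i| <= M * k)%N])%classic).
    by move=> th /= /h_supp[_ []]; [left|right].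
  by rewrite finite_setU; split; [exact: coefP|exact: finite_theta_box].
pose h i := Series (h_fin i); have hk i : eqm k (h i) 0.
  split=> e ek; apply: contraTeq ek; rewrite coef0 => /h_supp[-> _].
  by rewrite ltnn.
have [s [[_ sc] _]] := covers_deg_ex2 c c k.+1.
(* The new bound must also cover the Theta-exponents of [c] in Q-degree k, all listed in [s]. As k >
   0, their maximum is at most k times itself. *)
pose M' := (M + \max_(e <- s) \max_i `|e.2 i|)%N.
have hM i : theta_bounded M' (h i).
  move=> e /h_supp[ek [ce|eM]] j; rewrite ek mulnDl.
    apply: (leq_trans _ (leq_addl _ _)).
    have se : e \in s by apply: sc; rewrite ?ek.
    apply: leq_trans (leq_pmulr _ k0).
    apply: leq_trans (leq_bigmax (F := fun j => `|e.2 j|%N) j) _.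
    exact: (@leq_bigmax_seq _ s xpredT (fun e => \max_j `|e.2 j|%N) e se isT).
  exact: leq_trans (eM j) (leq_addr _ _).
have h1 i : eqm 1 (1 + h i) 1.
  by rewrite -[X in eqm _ _ X]addr0; apply: eqmD => //; exact: eqm_leq (hk i).
pose u' i := u i * (1 + h i).
have u'1 i : eqm 1 (u' i) 1 by rewrite -[X in eqm _ _ X]mulr1; exact: eqmM.
exists u'; last first.
  by move=> i; rewrite -[u i]mulr1 /u'; apply: eqmM => //;
     rewrite -[X in eqm _ X]addr0; apply: eqmD => //; exact: eqm_sym.
have MM' : (M <= M')%N by exact: leq_addr.
have u'M i : theta_bounded M' (u' i).
  apply: (@theta_boundedM M' (u i) (1 + h i)).
    exact: (@theta_bounded_leq M M' (u i) MM' (uM i)).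
  exact: (@theta_boundedD M' 1 (h i) (@theta_bounded1 M') (hM i)).
split; [exact: u'1|by exists M'|].
move=> m; have upm : eqm k.+1 (unit_pow u' m)
    (unit_pow u m + \sum_(i <- enum 'I_g) h i *~ m i).
  have -> : unit_pow u' m = unit_pow u m * \prod_(i <- enum 'I_g) (1 + h i) ^ m i.
    rewrite -big_split; apply: eq_bigr => i _ /=; rewrite exprMz_comm//.
    - exact: eqm1_unit.
    - exact: eqm1_unit.
    - exact: mulrC.
  set S := \sum_(i <- _) _.
  have Sk : eqm k S 0.
    by apply: eqm_sum0 => i; exact: eqm_mulrz0 (hk i).
  apply: (@eqm_trans _ _ _ _ _ (unit_pow u m * (1 + S))).
    apply: eqmM => //.
    apply: (@eqm_trans _ _ _ _ _ (\prod_(i <- enum 'I_g) (1 + h i *~ m i))).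
      by apply: eqm_prod => i _; exact: eqm_expz_linear.
    apply: eqm_prod_linear => // i; exact: eqm_mulrz0 (hk i).
  rewrite mulrDr mulr1; apply: eqmD => //; apply/eqm_sub0.
  rewrite -{2}[S]mul1r -mulrBl -add1n; apply: eqm_mul0 => //.
  by have /eqm_sub0 := eqm1_unit_pow m u1.
split=> -[d th0]; have {th0}-> : th0 = 0 by apply/ffunP => -[].
rewrite ltnS leq_eqVlt => /orP[/eqP dk|dk]; last first.
  have := eqmE (mom m) dk => <-; rewrite !coef_constant_term !coef_theta_monomialM.
  apply: eqmE; last exact: dk.
  apply: eqm_trans (eqm_leq (leqnSn k) upm) _; rewrite -[X in eqm _ _ X]addr0.
  by apply: eqmD => //; apply: eqm_sum0 => i; exact: eqm_mulrz0 (hk i).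
rewrite !coef_constant_term !coef_theta_monomialM sub0r (eqmE upm); last by rewrite -dk.
have dk' : qdeg (d, - m) = k by rewrite -dk.
rewrite coefD coef_sum; case: (pickP (fun i => m i != 0)) => [i mi|m0].
  have [i0 pick_i0 mi0] : exists2 i0, [pick i | (- m) i != 0] = Some i0 & m i0 != 0.
    case: pickP => [i0|/(_ i)]; first by rewrite ffunE oppr_eq0; exists i0.
    by rewrite ffunE oppr_eq0 mi.
  rewrite (bigD1_seq i0) ?mem_enum ?enum_uniq//= big1 => [|j ji0]; last first.
    rewrite -scaler_int coefZ /= /h_coef /= pick_i0.
    have -> : (Some i0 == Some j) = false.
      by apply/eqP => -[E]; rewrite E eqxx in ji0.
    by rewrite andbF mulr0.
  rewrite addr0 -scaler_int coefZ /= /h_coef dk' pick_i0 !eqxx /= opprK ffunE opprK.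
  by rewrite mulrC divfK ?subrKC// K_char0.
(* For m = 0 the corrections do not act; the equation is the normalization [ct_c]. *)
have {m0}-> : m = 0 by apply/ffunP => i; rewrite ffunE; apply/eqP; have := m0 i; case: eqP.
rewrite unit_pow0 big1 => [|i _]; last by rewrite ffunE mulr0z.
rewrite addr0 oppr0 -[LHS]/(constant_term (1 : R) (d, 0)).
rewrite -[RHS]/(constant_term c (d, 0)) ct_c -monomial0 constant_term_monomial eqxx.
by [].
Qed.

(** The bounds on the Theta-exponents may grow with the stage. The limit needs none, each of its
    Q-degrees being read off a single stage. *)
Lemma moments_all : exists2 u, forall i, eqm 1 (u i) 1 &
  forall m, constant_term (theta_monomial m * unit_pow u m)
          = constant_term (theta_monomial m * c).
Proof.
have start : moments_upto 1 (fun=> 1).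
  split=> [i //||m]; first by exists 0%N => i; exact: theta_bounded1.
  apply: (clin_constant_term _ _ _).2; apply: eqmM => //.
  by apply: eqm_sym; apply: eqm_trans c1 _; apply: eqm_sym; exact: eqm1_unit_pow.
have step k (x : {u | moments_upto k.+1 u}) : {y : {u | moments_upto k.+2 u} |
    forall i, eqm k.+1 (sval x i) (sval y i)}.
  case: x => u /= /moments_step-/(_ isT)/cid2[u' mu' uu'].
  by exists (exist _ u' mu').
pose us : forall k, {u | moments_upto k.+1 u} :=
  nat_rect _ (exist _ _ start) (fun k x => sval (step k x)).
have us_step k i : eqm k.+1 (sval (us k) i) (sval (us k.+1) i).
  exact: (svalP (step k (us k))).
pose u i := lim_series (fun k => sval (us k) i).
have u_us k i : eqm k (u i) (sval (us k) i).
  apply: eqm_lim => {}k; exact: eqm_leq (leqnSn k) (us_step k i).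
have us1 k i : eqm 1 (sval (us k) i) 1 by have [] := svalP (us k).
have u1 i : eqm 1 (u i) 1 by exact: eqm_trans (u_us 1 i) (us1 1 i).
exists u => // m; apply: eqm_eq => k; have [_ _ mom] := svalP (us k).
apply: eqm_trans (eqm_leq (leqnSn k) (mom m)).
apply: (clin_constant_term _ _ _).2; apply: eqmM => //.
exact: eqm_unit_pow.
Qed.

(* Theta_i := Theta_i u_i(Theta), with u solved degree by degree so that the
   new constant terms are the c-weighted ones. *)
Lemma change_of_variables : exists sigma : R -> R,
  [/\ sigma 1 = 1, {morph sigma : f h / f + h}, {morph sigma : f h / f * h} &
      forall f, constant_term (sigma f) = constant_term (c * f)].
Proof.
have [u u1 mom] := moments_all.
pose phi (a : expo I g) := monomial K a * unit_pow u a.2.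
have phi_deg a : eqm (qdeg a) (phi a) 0 by apply: eqm_mulr0; exact: eqm_monomial.
have cl_phi := clin_ext phi_deg.
have phiD a b : phi (a + b) = phi a * phi b.
  by rewrite /phi monomialD [(a + b).2]/= unit_powD// mulrACA.
have phi0 : phi 0 = 1 by rewrite /phi unit_pow0 mulr1.
exists (ext phi); split=> [|f h|f h|].
- exact: ext1.
- exact: clinD.
- exact: extM.
apply: clin_eq.
- exact: clin_comp cl_phi (clin_constant_term _ _ _).
- apply: clin_comp (clin_constant_term _ _ _); exact: clin_mul (clin_id _ _ _).
move=> [d m]; rewrite ext_monomial// /phi.
have -> : monomial K (d, m) = monomial K (d, 0) * theta_monomial m.
  by rewrite -monomialD -[(d, 0) + _]/(_, _) addr0 add0r.
rewrite -mulrA constant_term_monomialM mom -constant_term_monomialM.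
by rewrite [c * _]mulrC mulrA.
Qed.

End ChangeOfVariables.

(** * Minors indexed by lists of (row label, column label) *)

Section DeterminantOfPairs.
Variables (T : eqType) (R : comNzRingType).
Implicit Types (A : T -> T -> R) (s : seq (T * T)).

Definition det_tuple A n (t : n.-tuple (T * T)) : R :=
  \det (\matrix_(i, j) A (tnth t i).1 (tnth t j).2).
Definition det_pairs A s : R := det_tuple A (in_tuple s).

Lemma det_tuple_val A n (t : n.-tuple (T * T)) : det_tuple A t = det_pairs A t.
Proof.
case: t => s sn /=; case: _ / {sn}(eqP sn) (sn) => sn.
by congr det_tuple; apply: val_inj.
Qed.

Lemma det_pairs_nil A : det_pairs A [::] = 1.
Proof. by rewrite /det_pairs /det_tuple det_mx00. Qed.

(** Permuting the pairs permutes rows and columns alike, and the two signs cancel. Hence the order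
    in which modes are listed never matters below. *)
Lemma det_pairs_perm A s s' : perm_eq s s' -> det_pairs A s = det_pairs A s'.
Proof.
move=> ss'; have sz := perm_size ss'.
have sz' : size s == size s' by rewrite sz.
rewrite -[s]/(val (Tuple sz')) -det_tuple_val /det_pairs.
have /tuple_permP[p ps] : perm_eq (Tuple sz') (in_tuple s') by [].
have -> : Tuple sz' = [tuple tnth (in_tuple s') (p i) | i < size s'].
  exact: val_inj.
rewrite /det_tuple; set M := \matrix_(i, j) A _ _; set M' := \matrix_(i, j) A _ _.
have -> : M = row_perm p (col_perm p M').
  by apply/matrixP => i j; rewrite !mxE !tnth_mktuple.
rewrite row_permE det_mulmx col_permE det_mulmx !det_perm odd_permV.
by rewrite mulrCA -signr_addb addbb mulr1.
Qed.

Lemma det_pairs_eq A A' s :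
  (forall p q, p \in s -> q \in s -> A p.1 q.2 = A' p.1 q.2) ->
  det_pairs A s = det_pairs A' s.
Proof.
move=> AA'; rewrite /det_pairs /det_tuple; congr (\det _).
by apply/matrixP => i j; rewrite !mxE AA'//; exact: mem_tnth.
Qed.

Lemma det_pairs_scale A (r c : T -> R) s :
  det_pairs (fun x y => r x * A x y * c y) s
  = (\prod_(p <- s) (r p.1 * c p.2)) * det_pairs A s.
Proof.
pose t := in_tuple s.
have -> : \prod_(p <- s) (r p.1 * c p.2)
    = (\prod_i r (tnth t i).1) * (\prod_i c (tnth t i).2).
  by rewrite -[s]/(val t) big_tuple big_split.
rewrite /det_pairs /det_tuple.
set M := \matrix_(i, j) A _ _.
have -> : \matrix_(i, j) (r (tnth t i).1 * A (tnth t i).1 (tnth t j).2 * c (tnth t j).2)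
   = diag_mx (\row_i r (tnth t i).1) *m M *m diag_mx (\row_i c (tnth t i).2).
  by apply/matrixP => i j; rewrite mul_diag_mx mul_mx_diag !mxE.
rewrite !det_mulmx !det_diag mulrAC; congr (_ * _ * _).
  by apply: eq_bigr => i _; rewrite mxE.
by apply: eq_bigr => i _; rewrite mxE.
Qed.

Lemma det_pairs_morph (S : comNzRingType) (sigma : R -> S) A s :
  sigma 1 = 1 -> {morph sigma : x y / x + y} -> {morph sigma : x y / x * y} ->
  sigma (det_pairs A s)
  = \det (\matrix_(i, j) sigma (A (tnth (in_tuple s) i).1 (tnth (in_tuple s) j).2)).
Proof.
move=> sigma1 sigmaD sigmaM.
have sigma0 : sigma 0 = 0 by apply: (@addrI _ (sigma 0)); rewrite -sigmaD !addr0.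
have sigmaN1 : sigma (-1) = -1.
  by apply: (@addrI _ (sigma 1)); rewrite -sigmaD subrr sigma0 sigma1 subrr.
rewrite (big_morph sigma sigmaD sigma0); apply: eq_bigr => p _.
rewrite sigmaM (big_morph sigma sigmaM sigma1); congr (_ * _).
  by case: (odd_perm p); rewrite ?expr0 ?expr1.
by apply: eq_bigr => i _; rewrite !mxE.
Qed.

Lemma det_tuple_cat A n m (t : n.-tuple (T * T)) (t' : m.-tuple (T * T)) :
  det_pairs A (t ++ t') = \det (block_mx
    (\matrix_(i, j) A (tnth t i).1 (tnth t j).2)
    (\matrix_(i, j) A (tnth t i).1 (tnth t' j).2)
    (\matrix_(i, j) A (tnth t' i).1 (tnth t j).2)
    (\matrix_(i, j) A (tnth t' i).1 (tnth t' j).2)).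
Proof.
rewrite -[t ++ t']/(val (cat_tuple t t')) -det_tuple_val; congr (\det _).
apply/matrixP => i j; rewrite mxE.
by case: (split_ordP i) => i' ->; case: (split_ordP j) => j' ->;
   rewrite ?tnth_lshift ?tnth_rshift ?block_mxEul ?block_mxEur ?block_mxEdl
           ?block_mxEdr mxE.
Qed.

Lemma det_pairs_cat A s s' :
  (forall p q, p \in s -> q \in s' -> A p.1 q.2 = 0) ->
  det_pairs A (s ++ s') = det_pairs A s * det_pairs A s'.
Proof.
move=> A0; rewrite (det_tuple_cat A (in_tuple s) (in_tuple s')).
set M := (X in block_mx _ X _ _); have -> : M = 0.
  by apply/matrixP => i j; rewrite !mxE A0//; exact: mem_tnth.
by rewrite det_lblock.
Qed.

(** An exchange of the first two columns: re-pairing the same rows with the same columns costs a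
    sign. *)
Lemma det_pairs_cross A x y x' y' s :
  det_pairs A [:: (x, y), (x', y') & s] = - det_pairs A [:: (x, y'), (x', y) & s].
Proof.
rewrite /det_pairs /det_tuple /=.
set M := \matrix_(i, j) _; set M' := \matrix_(i, j) _.
have -> : M = xcol 0 1 M'.
  apply/matrixP => i j; rewrite !mxE !(tnth_nth (x, y)) /=.
  have -> : (nth (x, y) [:: (x, y), (x', y') & s] i).1
          = (nth (x, y) [:: (x, y'), (x', y) & s] i).1.
    by case: i => [[|[|i]] ?].
  congr (A _ _); case: tpermP => [->|->|] //=.
  by case: j => [[|[|j]] lj] //= j0 j1; [case: j0; apply: val_inj|case: j1; apply: val_inj].
by rewrite xcolE det_mulmx /tperm_mx det_perm odd_tperm /= expr1 mulrN1.
Qed.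

(** By linearity in the last row, the left side is the determinant of the matrix of [rcons s e] with
    last row replaced by (0, 1) + w (z, d). Its corner is the pivot u, with inverse [v], and a block
    triangular factorization leaves u times the determinant of the Schur complement. *)
Lemma det_pairs_rank1 A (w v : R) s e : (1 + w * A e.1 e.2) * v = 1 ->
  det_pairs A s + w * det_pairs A (rcons s e) = (1 + w * A e.1 e.2) *
    det_pairs (fun x y => A x y - w * v * (A x e.2 * A e.1 y)) s.
Proof.
set u := 1 + _ => uv; rewrite -cats1 (det_tuple_cat A (in_tuple s) [tuple e]).
set X := (X in block_mx X _ _ _); set y := (X in block_mx _ X _ _).
set z := (X in block_mx _ _ X _); set d := (X in block_mx _ _ _ X).
have dE : d = (A e.1 e.2)%:M.
  by apply/matrixP => i j; rewrite !mxE !ord1 !tnth0 eqxx mulr1n.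
have multilin : \det (block_mx X y (w *: z) (1 + w *: d))
    = 1 * \det (block_mx X y 0 1) + w * \det (block_mx X y z d).
  apply: (@determinant_multilinear _ _ _ _ _ (rshift _ ord0)).
  - rewrite scale1r /block_mx !rowKd; apply/rowP => j; rewrite !mxE.
    by case: splitP => j' _; rewrite !mxE ?add0r.
  - apply/matrixP => i j; rewrite !mxE.
    case: splitP => // i' /=; rewrite ord1 /bump; have := ltn_ord i.
    by move: (nat_of_ord i) => k; lia.
  - apply/matrixP => i j; rewrite !mxE.
    case: splitP => // i' /=; rewrite ord1 /bump; have := ltn_ord i.
    by move: (nat_of_ord i) => k; lia.
rewrite det_ublock det1 mulr1 mul1r in multilin.
rewrite -[det_pairs A s]/(\det X) -multilin.
set X' := \matrix_(i, j) (X i j - w * v * (y i 0 * z 0 j)).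
have -> : block_mx X y (w *: z) (1 + w *: d)
    = block_mx 1 (v *: y) 0 1 *m block_mx X' 0 (w *: z) (u%:M).
  rewrite mulmx_block !mul1mx !mul0mx !add0r; congr block_mx.
  - apply/matrixP => i j; rewrite !mxE big_ord1 !mxE; ring.
  - by rewrite mul_mx_scalar scalerA uv scale1r.
  - by rewrite dE; apply/matrixP => i j; rewrite !mxE !ord1 eqxx !mulr1n.
rewrite det_mulmx det_ublock det_lblock !det1 !mul1r det_scalar1 mulrC.
congr (_ * \det _); apply/matrixP => i j.
by rewrite !mxE !tnth0.
Qed.

(** When diag(r) commutes with A, scaling the rows of a minor by r gives the same matrix as scaling
    its columns by r. *)
Lemma det_pairs_unbalanced A (r : T -> R) s :
  (forall x y, r x * A x y = A x y * r y) ->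
  (\prod_(p <- s) r p.1 - \prod_(p <- s) r p.2) * det_pairs A s = 0.
Proof.
move=> rA; rewrite mulrBl; apply/eqP; rewrite subr_eq0; apply/eqP.
have := det_pairs_scale A r (fun=> 1) s; have := det_pairs_scale A (fun=> 1) r s.
rewrite [\prod_(p <- s) (1 * _)](eq_bigr (fun p => r p.2)) => [|p _]; last exact: mul1r.
rewrite [\prod_(p <- s) (_ * 1)](eq_bigr (fun p => r p.1)) => [|p _]; last exact: mulr1.
move=> <- <-; apply: det_pairs_eq => p q _ _.
by rewrite mulr1 mul1r.
Qed.

End DeterminantOfPairs.

(** * Summing minors over all finite sets of modes *)

Section Elimination.
Variables (T : eqType) (K : fieldType) (I : finType) (g : nat).
Notation R := (series K I g).
Implicit Types (A : T -> T -> R) (s : seq (T * T)).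

Lemma eqm_det_pairs k A A' s : (forall x y, eqm k (A x y) (A' x y)) ->
  eqm k (det_pairs A s) (det_pairs A' s).
Proof.
move=> AA'; apply: eqm_sum => p _; apply: eqmM => //; apply: eqm_prod => i _.
by rewrite !mxE.
Qed.

Variables (rho : nat -> T * T) (w : nat -> R).
(** [w1] makes every pivot a unit, including the one at index 0, where [wk] says nothing. [wk] makes
    the k-th elimination invisible modulo Q^k, so that the matrices and the products of pivots
    converge. *)
Hypothesis w1 : forall k, eqm 1 (w k) 0.
Hypothesis wk : forall k, eqm k (w k) 0.

(* The sum over the subsets S of {0, ..., k-1} of the determinants on s ++ rho S
   weighted by the product of the w's over S. *)
Fixpoint subset_sum A s k : R :=
  if k is k'.+1 then
    subset_sum A s k' + w k' * subset_sum A (rcons s (rho k')) k'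
  else det_pairs A s.

Definition pivot A (k : nat) : R := 1 + w k * A (rho k).1 (rho k).2.
Definition eliminate A k : T -> T -> R := fun x y =>
  A x y - w k * (pivot A k)^-1 * (A x (rho k).2 * A (rho k).1 y).

Fixpoint eliminated A k : T -> T -> R :=
  if k is k'.+1 then eliminate (eliminated A k') k' else A.
Definition pivots A k : R := \prod_(j < k) pivot (eliminated A j) j.

Lemma eqm1_pivot A k : eqm 1 (pivot A k) 1.
Proof.
rewrite -[X in eqm _ _ X]addr0 /pivot; apply: eqmD => //; exact: eqm_mulr0.
Qed.

(** The induction is uniform in [s]: the sums without and with mode k acquire the same pivots and
    the same eliminated matrix, to which [det_pairs_rank1] then applies. *)
Lemma subset_sumE A s k :
  subset_sum A s k = pivots A k * det_pairs (eliminated A k) s.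
Proof.
elim: k s => [|k IHk] s; first by rewrite /pivots big_ord0 mul1r.
rewrite /= !IHk /pivots big_ord_recr /= -!/(pivots A k).
rewrite [w k * _]mulrCA -mulrDr -mulrA; congr (_ * _).
by apply: det_pairs_rank1; rewrite mulrV// eqm1_unit//; exact: eqm1_pivot.
Qed.

Lemma eliminationP A : exists u A', eqm 1 u 1 /\
  forall s k, eqm k (subset_sum A s k) (u * det_pairs A' s).
Proof.
have A_lim k x y : eqm k (lim_series (fun k => eliminated A k x y))
                         (eliminated A k x y).
  apply: (@eqm_lim _ _ _ (fun k => eliminated A k x y)) => {}k /=.
  rewrite -{1}[eliminated A k x y]subr0; apply: eqmB => //; apply: eqm_sym.
  by apply/eqm_mulr0/eqm_mulr0.
have u_lim k : eqm k (lim_series (pivots A)) (pivots A k).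
  apply: eqm_lim => {}k; rewrite /pivots big_ord_recr /= -{1}[\prod_(_ < _) _]mulr1.
  apply: eqmM => //; rewrite -{1}[1]addr0; apply: eqmD => //.
  by apply: eqm_sym; apply: eqm_mulr0.
exists (lim_series (pivots A)), (fun x y => lim_series (fun k => eliminated A k x y)).
split; last first.
  move=> s k; rewrite subset_sumE; apply: eqmM; apply: eqm_sym => //.
  exact: eqm_det_pairs.
apply: eqm_trans (u_lim 1) _; rewrite /pivots big_ord1; exact: eqm1_pivot.
Qed.

End Elimination.

(** * Frobenius coordinates of partitions *)

Section FrobeniusCoordinates.
Local Open Scope nat_scope.
Implicit Types (s nu : seq nat) (l : seq (nat * nat)) (mu : part).

(* The partition whose first row and column have arm m and leg n, and whose
   remaining boxes form nu. *)
Definition hook m n nu : seq nat :=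
  m.+1 :: map succn (nu ++ nseq (n - size nu) 0).

Definition frobenius l := sorted gtn (unzip1 l) && sorted gtn (unzip2 l).

Fixpoint of_frobenius l : seq nat :=
  if l is (m, n) :: l' then hook m n (of_frobenius l') else [::].

Lemma size_hook m n nu : size nu <= n -> size (hook m n nu) = n.+1.
Proof. by move=> sn; rewrite /= size_map size_cat size_nseq subnKC. Qed.

Lemma is_part_hook m n nu : is_part nu -> head 0 nu <= m -> is_part (hook m n nu).
Proof.
move=> /andP[snu nu0] hm; apply/andP; split; last first.
  by rewrite inE /=; apply/mapP => -[].
have geq_trans : transitive geq by move=> y x z /=; lia.
rewrite /= path_map path_sortedE; last by move=> y x z /=; lia.
have nu_m : all (fun x => x <= m) nu.
  case: nu hm snu {nu0} => //= x nu xm; rewrite xm path_sortedE// => /andP[+ _].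
  by apply: sub_all => y yx; exact: leq_trans yx xm.
rewrite (eq_all (a2 := fun x => x <= m))// all_cat nu_m all_nseq leq0n orbT /=.
elim: nu snu {nu0 hm nu_m} (n - size nu) => [_ k|x nu IH /= xnu k].
  by elim: k => // -[|k].
rewrite path_sortedE in xnu; last exact: geq_trans.
case/andP: xnu => ax snu; rewrite path_sortedE; last by move=> y z t /=; lia.
rewrite IH// andbT all_cat all_nseq orbT andbT; apply: sub_all ax => y.
by [].
Qed.

Lemma frobenius_cons m n l : frobenius ((m, n) :: l) =
  [&& frobenius l, all (fun p => p.1 < m) l & all (fun p => p.2 < n) l].
Proof.
have gtn_tr : transitive gtn by move=> y x z /=; lia.
rewrite /frobenius /= !path_sortedE// !all_map.
by rewrite andbACA [RHS]andbC.
Qed.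

Lemma of_frobenius_bounds m n l : frobenius ((m, n) :: l) ->
  head 0 (of_frobenius l) <= m /\ size (of_frobenius l) <= n.
Proof.
elim: l m n => [|[m' n'] l IH] m n //.
rewrite frobenius_cons => /and3P[fl /= /andP[mm _] /andP[nn _]].
by have [_ sz] := IH _ _ fl; rewrite size_map size_cat size_nseq subnKC.
Qed.

Lemma of_frobenius_part l : frobenius l -> is_part (of_frobenius l).
Proof.
elim: l => [|[m n] l IH] // fml; have [hm _] := of_frobenius_bounds fml.
by apply: is_part_hook => //; apply: IH; move: fml; rewrite frobenius_cons => /andP[].
Qed.

Lemma size_of_frobenius m n l : frobenius ((m, n) :: l) ->
  size (of_frobenius ((m, n) :: l)) = n.+1.
Proof. by case/of_frobenius_bounds => _; exact: size_hook. Qed.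

(** Removes the first column. Rows of length 1 disappear from [nu], and the zero padding restores
    them; this is the tail of [hook] run backwards. *)
Lemma part_pred s : is_part s -> let nu := [seq x.-1 | x <- s & 1 < x] in
  is_part nu /\ s = map succn (nu ++ nseq (size s - size nu) 0).
Proof.
elim: s => [|x s IH] //= /andP[xs]; rewrite inE negb_or => /andP[x0 s0].
have geq_trans : transitive geq by move=> y z t /=; lia.
move: xs; rewrite [sorted _ _]/= path_sortedE// => /andP[ax ss].
have /IH /= [pnu sE] : is_part s by apply/andP.
case: ltnP => x1 /=.
  split; last by rewrite subSS -sE; case: x x1 {ax x0}.
  case/andP: pnu => snu nu0; apply/andP; split; last first.
    by rewrite inE negb_or nu0; case: x x1 {ax x0} => [|[]].
  rewrite [sorted _ _]/= path_sortedE// snu andbT; apply/allP => y /mapP[z].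
  by rewrite mem_filter => /andP[_ /(allP ax)] /= zx ->; lia.
have nil : [seq y <- s | 1 < y] = [::].
  by apply/eqP; rewrite -[_ == _]negbK -has_filter -all_predC; apply/allP => y /(allP ax) /=; lia.
move: sE; rewrite nil /= subn0 => <-; split=> //.
by congr (_ :: _); move: x0 x1; case: x {ax} => [|[]].
Qed.

Lemma of_frobenius_onto s : is_part s -> exists2 l, frobenius l & of_frobenius l = s.
Proof.
have [k] := ubnP (size s); elim: k s => // k IH [|[|m] s]; first by exists [::].
  by rewrite /is_part inE andbF.
rewrite ltnS /= => sk ps; have ps' : is_part s.
  case/andP: ps => /= /path_sorted ss; rewrite inE /= => s0.
  by apply/andP.
have geq_trans : transitive geq by move=> y z t /=; lia.
have hs : all (fun x => x <= m.+1) s.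
  by case/andP: ps => /=; rewrite path_sortedE// => /andP[].
have [pnu sE] := part_pred ps'; set nu := [seq _ | _ <- _ & _] in pnu sE.
have szn : size nu <= size s by rewrite size_map size_filter count_size.
have [l fl lE] : exists2 l, frobenius l & of_frobenius l = nu.
  by apply: IH => //; exact: leq_ltn_trans szn sk.
exists ((m, size s) :: l); last by rewrite /= lE /hook -sE.
rewrite frobenius_cons fl /=.
case: l fl lE => [|[m' n'] l] // fl lE.
have mm : m' < m.
  have : m'.+1 \in nu by rewrite -lE mem_head.
  by case/mapP => x; rewrite mem_filter => /andP[_ /(allP hs)] /=; lia.
have nn : n' < size s by rewrite -[n'.+1](size_of_frobenius fl) lE.
move: fl; rewrite frobenius_cons => /and3P[_ am an] /=.
rewrite mm nn; apply/andP; split.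
  by apply: sub_all am => p /=; lia.
by apply: sub_all an => p /=; lia.
Qed.

Lemma filter_pad s k : 0 \notin s -> filter (predC1 0) (s ++ nseq k 0) = s.
Proof.
move=> s0; rewrite filter_cat filter_nseq cats0; apply/all_filterP/allP => x xs /=.
by apply: contraNneq s0 => <-.
Qed.

Lemma of_frobenius_inj l l' : frobenius l -> frobenius l' ->
  of_frobenius l = of_frobenius l' -> l = l'.
Proof.
elim: l l' => [|[m n] l IH] [|[m' n'] l'] // fl fl' E.
have fl1 : frobenius l by move: fl; rewrite frobenius_cons => /andP[].
have fl1' : frobenius l' by move: fl'; rewrite frobenius_cons => /andP[].
have [nn] : n.+1 = n'.+1 by rewrite -(size_of_frobenius fl) -(size_of_frobenius fl') E.
case: E => -> /(inj_map succn_inj) /(congr1 (filter (predC1 0))).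
have notin0 r : frobenius r -> 0 \notin of_frobenius r.
  by move=> /of_frobenius_part/andP[].
by rewrite !filter_pad ?notin0// => /IH -> //; rewrite nn.
Qed.

Definition swap_pairs l := [seq (p.2, p.1) | p <- l].

Lemma frobenius_swap l : frobenius (swap_pairs l) = frobenius l.
Proof.
by rewrite /frobenius /unzip1 /unzip2 -!map_comp andbC.
Qed.

Lemma nth_conj_seq nu j : is_part nu -> nth 0 (conj_seq nu) j = count (ltn j) nu.
Proof.
move=> /andP[snu _]; have [jh|hj] := ltnP j (head 0 nu).
  by rewrite nth_mkseq.
rewrite nth_default ?size_mkseq//; apply/esym/eqP; rewrite -leqn0 leqNgt -has_count.
rewrite -all_predC; case: nu snu hj => //= x nu; rewrite path_sortedE.
  move=> /andP[ax _] xj; rewrite -leqNgt xj; apply: sub_all ax => y /=.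
  by rewrite -leqNgt => /leq_trans; apply.
by move=> y z t /=; lia.
Qed.

Lemma conj_seq_hook m n nu : is_part nu -> head 0 nu <= m -> size nu <= n ->
  conj_seq (hook m n nu) = hook n m (conj_seq nu).
Proof.
move=> pnu hm sn.
have sz : size (conj_seq nu) <= m by rewrite size_mkseq.
apply: (@eq_from_nth _ 0); rewrite ?size_hook// size_mkseq //= => -[|j] jm.
  rewrite nth_mkseq//= count_map (eq_count (a2 := predT))// count_predT.
  by rewrite size_cat size_nseq subnKC.
rewrite nth_mkseq// [RHS]/=; rewrite (nth_map 0); last first.
  by rewrite size_cat size_nseq subnKC.
rewrite nth_cat nth_nseq if_same.
have -> : (if j < size (conj_seq nu) then nth 0 (conj_seq nu) j else 0)
          = count (ltn j) nu.
  rewrite -nth_conj_seq//; case: ltnP => // /(nth_default 0) -> //.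
rewrite /= jm count_map add1n; congr _.+1.
rewrite count_cat count_nseq mul0n addn0.
exact: eq_count.
Qed.

Lemma conj_of_frobenius l : frobenius l ->
  conj_seq (of_frobenius l) = of_frobenius (swap_pairs l).
Proof.
elim: l => [|[m n] l IH] // fml; have [hm sn] := of_frobenius_bounds fml.
have fl : frobenius l by move: fml; rewrite frobenius_cons => /andP[].
by rewrite [of_frobenius _]/= conj_seq_hook ?of_frobenius_part// IH.
Qed.

Lemma sumn_of_frobenius l : frobenius l ->
  sumn (of_frobenius l) = \sum_(p <- l) (p.1 + p.2).+1.
Proof.
elim: l => [|[m n] l IH] fml; first by rewrite big_nil.
have [hm sn] := of_frobenius_bounds fml.
have fl : frobenius l by move: fml; rewrite frobenius_cons => /andP[].
have sumnS r : sumn (map succn r) = sumn r + size r.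
  by elim: r => //= x r ->; lia.
rewrite big_cons /= sumnS sumn_cat sumn_nseq mul0n size_cat size_nseq -IH//.
by move: sn => /=; lia.
Qed.

Definition kappa_seq s : int := (\sum_(i < size s)
  (nth 0%N s i)%:Z * ((nth 0%N s i)%:Z - 2 * i.+1%:Z + 1))%R.

(** kappa is twice the sum of the contents. In a hook the arm contributes m(m+1) and the leg
    -n(n+1), while the inner partition moves along the diagonal, which keeps contents. *)
Lemma kappa_of_frobenius l : frobenius l -> kappa_seq (of_frobenius l) =
  (\sum_(p <- l) (p.1%:Z * (p.1%:Z + 1) - p.2%:Z * (p.2%:Z + 1)))%R.
Proof.
elim: l => [|[m n] l IH] fml; first by rewrite /kappa_seq big_ord0 big_nil.
have [hm sn] := of_frobenius_bounds fml.
have fl : frobenius l by move: fml; rewrite frobenius_cons => /andP[].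
rewrite big_cons -IH// /kappa_seq size_of_frobenius// big_ord_recl /=.
set nu := of_frobenius l in hm sn *.
have -> : (\sum_(i < size nu) (nth 0%N nu i)%:Z * ((nth 0%N nu i)%:Z - 2 * i.+1%:Z + 1)
  = \sum_(i < n) (nth 0%N nu i)%:Z * ((nth 0%N nu i)%:Z - 2 * i.+1%:Z + 1))%R.
  rewrite (big_ord_widen n (fun i => (nth 0%N nu i)%:Z * ((nth 0%N nu i)%:Z - 2 * i.+1%:Z + 1))%R)//.
  rewrite big_mkcond /=; apply: eq_bigr => i _; case: ltnP => // /(nth_default 0) ->.
  by rewrite mul0r.
have -> : (n%:Z * (n%:Z + 1) = \sum_(i < n) 2 * i.+1%:Z)%R.
  elim: (n) => [|k IHk]; first by rewrite big_ord0 mul0r.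
  by rewrite big_ord_recr /= -IHk !intS; ring.
have nthE (i : 'I_n) : nth 0 (map succn (nu ++ nseq (n - size nu) 0)) i = (nth 0 nu i).+1.
  rewrite (nth_map 0) ?size_cat ?size_nseq ?subnKC//; congr _.+1.
  rewrite nth_cat nth_nseq if_same; case: ltnP => // /(nth_default 0) -> //.
rewrite -[RHS]addrA; congr (_ + _)%R; first by rewrite !intS; ring.
rewrite [RHS]addrC -sumrB; apply: eq_bigr => i _; rewrite nthE /bump /= add1n.
by rewrite !intS; ring.
Qed.

End FrobeniusCoordinates.

(** * Frobenius coordinates as particles and holes of the Maya diagram *)

Section FrobeniusOfPartition.
Implicit Types (l : seq (nat * nat)) (mu : part).

Definition frob mu : seq (nat * nat) := sval (cid2 (of_frobenius_onto (valP mu))).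
Definition part_of l : part := insubd part0 (of_frobenius l).

Lemma frobenius_frob mu : frobenius (frob mu).
Proof. by rewrite /frob; case: cid2. Qed.
Lemma of_frobenius_frob mu : of_frobenius (frob mu) = mu.
Proof. by rewrite /frob; case: cid2. Qed.
Lemma frob_unique mu l : frobenius l -> of_frobenius l = mu -> frob mu = l.
Proof.
move=> fl lE; apply: of_frobenius_inj => //; first exact: frobenius_frob.
by rewrite of_frobenius_frob.
Qed.
Lemma frob_part_of l : frobenius l -> frob (part_of l) = l.
Proof.
move=> fl; apply: frob_unique => //; apply/esym; rewrite val_insubd.
by rewrite of_frobenius_part.
Qed.
Lemma part_of_frob mu : part_of (frob mu) = mu.
Proof. by apply: val_inj; rewrite val_insubd of_frobenius_frob (valP mu). Qed.
Lemma frob_part0 : frob part0 = [::]. Proof. exact: frob_unique. Qed.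
Lemma frob_conj mu : frob (conj_part mu) = swap_pairs (frob mu).
Proof.
apply: frob_unique; first by rewrite frobenius_swap frobenius_frob.
by rewrite -conj_of_frobenius ?frobenius_frob// of_frobenius_frob.
Qed.
Lemma sumn_frob mu : sumn mu = (\sum_(p <- frob mu) (p.1 + p.2).+1)%N.
Proof. by rewrite -sumn_of_frobenius ?frobenius_frob// of_frobenius_frob. Qed.
Lemma kappa_frob mu : kappa mu =
  \sum_(p <- frob mu) (p.1%:Z * (p.1%:Z + 1) - p.2%:Z * (p.2%:Z + 1)).
Proof. by rewrite -kappa_of_frobenius ?frobenius_frob// of_frobenius_frob. Qed.

Let occupied (s : seq nat) (r : int) := exists i, (nth 0%N s i)%:Z - i%:Z - 1 = r.

(** A row of [nu] gains one box and moves down one row, so its position is unchanged; the new first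
    row sits at m. From row n on the rows are empty and only move down, which vacates - n - 1. *)
Lemma occupied_hook m n nu r : (size nu <= n)%N ->
  occupied (hook m n nu) r <-> r = m%:Z \/ (occupied nu r /\ r <> - n%:Z - 1).
Proof.
move=> sn; have nthS k : (k < n)%N -> nth 0%N (hook m n nu) k.+1 = (nth 0%N nu k).+1.
  move=> kn /=; rewrite (nth_map 0%N) ?size_cat ?size_nseq ?subnKC//.
  by rewrite nth_cat nth_nseq if_same; case: ltnP => // /(nth_default 0%N) ->.
have nth0 k : (n <= k)%N -> nth 0%N (hook m n nu) k.+1 = 0%N.
  by move=> nk; rewrite nth_default// size_hook.
have nu0 k : (n <= k)%N -> nth 0%N nu k = 0%N.
  by move=> nk; rewrite nth_default// (leq_trans sn).
split=> [[[|k] <-]|[->|[[k <-] rn]]].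
- by left => /=; lia.
- right; have [kn|nk] := ltnP k n.
    rewrite nthS//; split; last by lia.
    by exists k; lia.
  rewrite nth0//; split; last by lia.
  by exists k.+1; rewrite nu0; lia.
- by exists 0%N => /=; lia.
have [kn|nk] := ltnP k n; first by exists k.+1; rewrite nthS//; lia.
rewrite nu0// in rn *; exists k; case: k nk rn => [|k] nk rn; first by lia.
by rewrite nth0; lia.
Qed.

Lemma occupied_of_frobenius l : frobenius l ->
  (forall m : nat, occupied (of_frobenius l) m%:Z <-> m \in unzip1 l) /\
  (forall n : nat, ~ occupied (of_frobenius l) (- n%:Z - 1) <-> n \in unzip2 l).
Proof.
elim: l => [|[m n] l IH] fml.
  split=> r; rewrite in_nil; split=> //.
    by case=> i; rewrite nth_nil; lia.
  by case; exists r; rewrite nth_nil; lia.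
have [_ sn] := of_frobenius_bounds fml.
have fl : frobenius l by move: fml; rewrite frobenius_cons => /andP[].
have [IH1 IH2] := IH fl; split=> r; rewrite /= (occupied_hook _ _ sn) inE.
  rewrite IH1; split=> [[[->]|[-> _]]|/orP[/eqP->|rl]]; rewrite ?eqxx ?orbT//.
    by left.
  by right; split=> //; lia.
rewrite -[r \in _]/(r \in unzip2 l); split=> [nr|/orP[/eqP->|/IH2 nr]].
- case: eqVneq => //= rn; apply/IH2 => oc; apply: nr; right; split=> //.
  by move: rn => /eqP; lia.
- by case=> [|[]]; lia.
by case=> [|[]]; [lia|].
Qed.

Lemma part_set_arm mu (m : nat) : part_set mu m%:Z <-> m \in unzip1 (frob mu).
Proof.
have [+ _] := occupied_of_frobenius (frobenius_frob mu).
rewrite of_frobenius_frob => <-; split=> [[i _ E]|[i E]]; first by exists i.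
by exists i.
Qed.

Lemma part_set_leg mu (n : nat) :
  ~ part_set mu (- n%:Z - 1) <-> n \in unzip2 (frob mu).
Proof.
have [_] := occupied_of_frobenius (frobenius_frob mu).
rewrite of_frobenius_frob => <-.
by split=> np [i]; [move=> E|move=> _ E]; apply: np; exists i.
Qed.

End FrobeniusOfPartition.

(** * Sets of modes, coded by decreasing lists of integers *)

Section DecreasingLists.
Local Open Scope nat_scope.
Implicit Types (S : seq nat) (l : seq (nat * nat)).

Fixpoint subsets k : seq (seq nat) :=
  if k is k'.+1 then subsets k' ++ map (cons k') (subsets k') else [:: [::]].

Let gtn_trans : transitive gtn. Proof. by move=> y x z /=; lia. Qed.

Lemma mem_subsets k S : (S \in subsets k) = sorted gtn S && all (fun j => j < k) S.
Proof.
elim: k S => [|k IHk] S.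
  by rewrite inE; case: S => [|j S]//=; rewrite andbF.
rewrite mem_cat IHk; apply/orP/andP => [[/andP[sS aS]|/mapP[S' + ->]]|[sS aS]].
- by rewrite sS; split=> //; apply: sub_all aS => j; exact: ltnW.
- rewrite IHk => /andP[sS' aS'] /=; rewrite path_sortedE// aS' sS' ltnSn.
  by split=> //; apply: sub_all aS' => j; exact: ltnW.
case: S sS aS => [|j S] /=; first by left.
rewrite path_sortedE// => /andP[aS sS] /andP[jk _].
have aSk : all (fun i => i < k) S.
  by apply: sub_all aS => i /= ij; exact: leq_trans ij _.
have [jltk|kj] := ltnP j k; first by left; rewrite aS sS aSk.
right; apply/mapP; exists S; rewrite ?IHk ?sS//; congr cons; lia.
Qed.

Lemma subsets_uniq k : uniq (subsets k).
Proof.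
elim: k => //= k IHk; rewrite cat_uniq IHk map_inj_uniq ?IHk ?andbT => [|? ? []//].
apply/hasPn => _ /mapP[S _ ->]; rewrite mem_subsets /= ltnn !andbF.
by [].
Qed.

(* The elements 2m and 2n+1 of S stand for the arm m and the leg n. *)
Definition arms S := [seq j./2 | j <- S & ~~ odd j].
Definition legs S := [seq j./2 | j <- S & odd j].
Definition balanced S := size (arms S) == size (legs S).
Definition decode S := zip (arms S) (legs S).

Lemma perm_arms_legs S :
  perm_eq S ([seq m.*2 | m <- arms S] ++ [seq n.*2.+1 | n <- legs S]).
Proof.
rewrite perm_sym; apply: perm_trans (permEl (perm_filterC odd S)).
apply: perm_trans (permEl (perm_catC _ _)) _; apply: perm_cat.
  rewrite -map_comp (eq_in_map _ id _).1 ?map_id// => j.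
  by rewrite mem_filter /= => /andP[oj _]; lia.
rewrite -map_comp (eq_in_map _ id _).1 ?map_id// => j.
by rewrite mem_filter /= => /andP[oj _]; lia.
Qed.

Lemma sorted_arms S : sorted gtn S -> sorted gtn (arms S).
Proof.
move=> sS; rewrite sorted_map.
have: sorted gtn [seq j <- S | ~~ odd j] by apply: sorted_filter.
apply: sub_in_sorted (allss _) => i j; rewrite !mem_filter /=; lia.
Qed.
Lemma sorted_legs S : sorted gtn S -> sorted gtn (legs S).
Proof.
move=> sS; rewrite sorted_map.
have: sorted gtn [seq j <- S | odd j] by apply: sorted_filter.
apply: sub_in_sorted (allss _) => i j; rewrite !mem_filter /=; lia.
Qed.

Lemma unzip1_decode S : balanced S -> unzip1 (decode S) = arms S.
Proof. by move=> /eqP bS; rewrite unzip1_zip// bS. Qed.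
Lemma unzip2_decode S : balanced S -> unzip2 (decode S) = legs S.
Proof. by move=> /eqP bS; rewrite unzip2_zip// bS. Qed.

Lemma frobenius_decode S : sorted gtn S -> balanced S -> frobenius (decode S).
Proof.
move=> sS bS; rewrite /frobenius unzip1_decode// unzip2_decode//.
by rewrite sorted_arms// sorted_legs.
Qed.

Lemma decode_inj S S' : sorted gtn S -> balanced S -> sorted gtn S' ->
  balanced S' -> decode S = decode S' -> S = S'.
Proof.
move=> sS bS sS' bS' E; apply: (sorted_eq gtn_trans) => //.
  by move=> x y /=; lia.
apply: perm_trans (perm_arms_legs S) _; rewrite perm_sym.
apply: perm_trans (perm_arms_legs S') _.
by rewrite -unzip1_decode// -(unzip1_decode bS)// -unzip2_decode// -(unzip2_decode bS) E.
Qed.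

Definition in_box k l := all (fun p => (p.1 < k) && (p.2 < k)) l.

Lemma decode_onto k l : frobenius l -> in_box k l ->
  exists S, [/\ S \in subsets k.*2, balanced S & decode S = l].
Proof.
move=> /andP[s1 s2] /allP bl.
pose S0 := [seq m.*2 | m <- unzip1 l] ++ [seq n.*2.+1 | n <- unzip2 l].
pose S := sort geq S0; have gtn_uniq r : sorted gtn r -> uniq r.
  by apply: sorted_uniq => // x /=; rewrite ltnn.
have uS0 : uniq S0.
  have inj0 : injective double by move=> x y; lia.
  have inj1 : injective (fun n => n.*2.+1) by move=> x y; lia.
  rewrite cat_uniq (map_inj_uniq inj0) (map_inj_uniq inj1) !gtn_uniq// andbT /=.
  by apply/hasPn => _ /mapP[n _ ->]; apply/mapP => -[m _]; lia.
have sS : sorted gtn S.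
  have geq_total : total geq by move=> x y /=; lia.
  have := sort_sorted geq_total S0; rewrite -/S.
  have: uniq S by rewrite sort_uniq.
  elim: S => //= x [|y r] IH //= /andP[xr ur] /andP[yx ry]; rewrite [path _ _ _](IH _ ry) ?ur// andbT.
  by rewrite ltn_neqAle yx andbT; apply: contraNneq xr => ->; rewrite mem_head.
have pS : perm_eq S S0 by rewrite /S perm_sort.
have eqs r r' : sorted gtn r -> sorted gtn r' -> perm_eq r r' -> r = r'.
  by apply: sorted_eq => // x y /=; lia.
have aS : arms S = unzip1 l.
  apply: eqs; [exact: sorted_arms|by []|].
  rewrite /arms; apply: perm_trans (perm_map _ (perm_filter _ pS)) _.
  rewrite filter_cat !filter_map (eq_filter (a2 := predT)) => [|m /=]; last by lia.
  rewrite filter_predT (eq_filter (a2 := pred0)) => [|m /=]; last by lia.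
  rewrite filter_pred0 cats0 -map_comp (eq_map (g := id)) ?map_id// => m /=; lia.
have lS : legs S = unzip2 l.
  apply: eqs; [exact: sorted_legs|by []|].
  rewrite /legs; apply: perm_trans (perm_map _ (perm_filter _ pS)) _.
  rewrite filter_cat !filter_map (eq_filter (a2 := pred0)) => [|m /=]; last by lia.
  rewrite filter_pred0 (eq_filter (a2 := predT)) => [|m /=]; last by lia.
  rewrite filter_predT [map double [::]]/= cat0s.
  rewrite -[map half _]map_comp (eq_map (g := id)) ?map_id// => m /=; lia.
exists S; split.
- rewrite mem_subsets sS /=; apply/allP => j; rewrite (perm_mem pS) mem_cat.
  case/orP=> /mapP[x /mapP[p /bl /andP[p1 p2] ->] ->]; lia.
- by rewrite /balanced aS lS !size_map.
by rewrite /decode aS lS zip_unzip.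
Qed.

End DecreasingLists.

(** A partition is a set of arms and a set of legs of equal size, paired in decreasing order. The
    hypothesis confines the sum to coordinates below k, that is to 2k modes. *)
Lemma part_sum_subsets (V : nmodType) (F : part -> V) k :
  (forall nu, ~~ in_box k (frob nu) -> F nu = 0) ->
  \sum_(nu \in [set: part]) F nu =
  \sum_(A <- subsets k.*2 | balanced A) F (part_of (decode A)).
Proof.
move=> F0; pose r := [seq part_of (decode x) | x <- subsets k.*2 & balanced x].
have inP A : A \in [seq x <- subsets k.*2 | balanced x] ->
    sorted gtn A /\ balanced A.
  by rewrite mem_filter mem_subsets => /and3P[].
have ur : uniq r.
  rewrite map_inj_in_uniq ?filter_uniq ?subsets_uniq// => A A' /inP[sA bA] /inP[sA' bA'].
  move=> /(congr1 frob); rewrite !frob_part_of ?frobenius_decode//.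
  exact: decode_inj.
rewrite (fsbigTE [fset nu in r]%fset) => [|nu]; last first.
  rewrite inE /= => nin; apply: F0; apply: contra nin => box.
  have [A [Ak bA AE]] := decode_onto (frobenius_frob nu) box.
  apply/mapP; exists A; first by rewrite mem_filter bA.
  by rewrite AE part_of_frob.
rewrite (perm_big r); last by apply: uniq_perm; rewrite ?fset_uniq// => x; rewrite inE.
by rewrite big_map big_filter.
Qed.

(** * Signs of reorderings of particles and holes *)

Section Excitations.
Variables (n : nat) (R : comNzRingType).
Notation mode := ('I_n * nat)%type.

(* (false, (i, m)) is the particle m + 1/2 and (true, (i, m)) the hole - m - 1/2
   of the i-th factor; they are ordered as in the wedge, particles by decreasing
   and holes by increasing m. *)
Definition excitation : Type := (bool * mode)%type.
Implicit Types (e : excitation) (z : seq excitation) (s : seq (mode * mode)).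

Definition precedes e e' : bool :=
  (e.2.1 < e'.2.1)%N || ((e.2.1 == e'.2.1) &&
    (if e.1 then e'.1 && (e.2.2 < e'.2.2)%N else e'.1 || (e'.2.2 < e.2.2)%N)).

Lemma precedes_total e e' : e != e' -> precedes e e' = ~~ precedes e' e.
Proof.
case: e e' => [b [i m]] [b' [i' m']]; rewrite /precedes !xpair_eqE /= -!val_eqE /=.
by case: b; case: b' => /=; case: (ltngtP i i') => //= _; case: (ltngtP m m').
Qed.
Lemma precedes_irr e : precedes e e = false.
Proof. by case: e => [[] [i m]]; rewrite /precedes /= !ltnn andbF. Qed.

Fixpoint inversions z : nat :=
  if z is e :: z' then (count (precedes^~ e) z' + inversions z')%N else 0%N.
Definition sgn z : R := (-1) ^+ inversions z.

(** Moving [e] to the front crosses the entries of [z1]; once there it has one inversion with each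
    entry that precedes it in the wedge order. *)
Lemma odd_inversions z1 e z2 : e \notin z1 -> odd (inversions (z1 ++ e :: z2)) =
  odd (size z1 + count (precedes^~ e) (z1 ++ z2) + inversions (z1 ++ z2)).
Proof.
elim: z1 => [|e' z1 IH] //=; rewrite inE negb_or => /andP[ee' /IH {}IH].
rewrite !count_cat /= !oddD IH !count_cat !oddD (precedes_total ee') /=.
move: (odd (count _ z1)) (odd (count _ z2)) (odd (size _)) (odd (inversions _)).
move: (odd (count _ z1)) (odd (count _ z2)).
by case: (precedes e' e) => -[] [] [] [] [] [].
Qed.

Lemma sgn_cat_cons z1 e z2 : e \notin z1 -> sgn (z1 ++ e :: z2) =
  (-1) ^+ size z1 * (-1) ^+ count (precedes^~ e) (z1 ++ z2) * sgn (z1 ++ z2).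
Proof.
by move=> ez; rewrite /sgn -!exprD -signr_odd odd_inversions// signr_odd.
Qed.

Definition excitations (xs ys : seq mode) : seq excitation :=
  map (pair false) xs ++ map (pair true) ys.

(** The binomial exponent is the number of exchanges that turn x1 y1 x2 y2 ... into x1 x2 ... y1 y2
    ...; [sgn] then sorts the result. *)
Definition wick_sign (xs ys : seq mode) : R :=
  (-1) ^+ 'C(size xs, 2) * sgn (excitations xs ys).

Lemma particle_sign xs1 x xs2 ys : x \notin xs1 ->
  sgn (excitations (xs1 ++ x :: xs2) ys) = (-1) ^+ size xs1
    * (-1) ^+ count (precedes^~ (false, x)) (excitations (xs1 ++ xs2) ys)
    * sgn (excitations (xs1 ++ xs2) ys).
Proof.
move=> xx; rewrite /excitations !map_cat /= -!catA sgn_cat_cons ?size_map//.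
by rewrite mem_map// => ? ? [].
Qed.

Lemma hole_sign xs ys1 y ys2 : y \notin ys1 ->
  sgn (excitations xs (ys1 ++ y :: ys2)) = (-1) ^+ (size xs + size ys1)
    * (-1) ^+ count (precedes^~ (true, y)) (excitations xs (ys1 ++ ys2))
    * sgn (excitations xs (ys1 ++ ys2)).
Proof.
move=> yy; rewrite /excitations !map_cat /= !catA sgn_cat_cons.
  by rewrite size_cat !size_map.
rewrite mem_cat negb_or; apply/andP; split; first by apply/mapP => -[].
by rewrite mem_map// => ? ? [].
Qed.

(** The two counts are those met by psi_x and then psi^*_y: the particle has already been removed
    when the hole is read. Moving the hole past the r remaining particles costs (-1)^r, which the
    change of binomial coefficient cancels. *)
Lemma wick_sign_remove xs1 x xs2 ys1 y ys2 : x \notin xs1 -> y \notin ys1 ->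
  wick_sign (xs1 ++ x :: xs2) (ys1 ++ y :: ys2) =
  (-1) ^+ (size xs1 + size ys1)
  * (-1) ^+ count (precedes^~ (false, x)) (excitations (xs1 ++ x :: xs2) (ys1 ++ y :: ys2))
  * (-1) ^+ count (precedes^~ (true, y)) (excitations (xs1 ++ xs2) (ys1 ++ y :: ys2))
  * wick_sign (xs1 ++ xs2) (ys1 ++ ys2).
Proof.
move=> xx yy; rewrite /wick_sign particle_sign// hole_sign//.
have -> : count (precedes^~ (false, x)) (excitations (xs1 ++ x :: xs2) (ys1 ++ y :: ys2))
  = count (precedes^~ (false, x)) (excitations (xs1 ++ xs2) (ys1 ++ y :: ys2)).
  by rewrite /excitations !map_cat !count_cat /= precedes_irr add0n.
have -> : count (precedes^~ (true, y)) (excitations (xs1 ++ xs2) (ys1 ++ y :: ys2))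
  = count (precedes^~ (true, y)) (excitations (xs1 ++ xs2) (ys1 ++ ys2)).
  by rewrite /excitations !map_cat !count_cat /= precedes_irr add0n.
have -> : size (xs1 ++ x :: xs2) = (size (xs1 ++ xs2)).+1.
  by rewrite !size_cat addnS.
rewrite binS bin1 !exprD.
have : (-1) ^+ size (xs1 ++ xs2) * (-1) ^+ size (xs1 ++ xs2) = 1 :> R.
  by rewrite -exprD addnn -muln2 exprM sqrr_sign.
move=> E; rewrite -[RHS]mul1r -[X in _ = X * _]E; ring.
Qed.

Definition nested (p p' : mode * mode) : bool :=
  (p.1.1 < p'.1.1)%N || [&& p.1.1 == p'.1.1, (p'.1.2 < p.1.2)%N & (p'.2.2 < p.2.2)%N].

(** Take off the outermost hook of the first factor. No remaining excitation precedes its arm, and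
    as many remaining arms as legs precede its leg, so the removal sign is 1. *)
Lemma wick_sign1 s : all (fun p => p.1.1 == p.2.1) s -> pairwise nested s ->
  wick_sign (unzip1 s) (unzip2 s) = 1.
Proof.
elim: s => [|[x y] s IH] /=; first by rewrite /wick_sign bin0n expr0 mul1r.
move=> /andP[/eqP xy legs_s] /andP[nest pw].
rewrite (@wick_sign_remove [::] x _ [::] y)// IH// mulr1 expr0 mul1r.
rewrite /excitations /= precedes_irr !count_cat /=.
have -> : precedes (true, y) (false, x) = false.
  by rewrite /precedes /= xy ltnn eqxx.
rewrite precedes_irr !add0n.
have c1 : count (precedes^~ (false, x)) (map (pair false) (unzip1 s)) = 0%N.
  rewrite !count_map; apply/eqP; rewrite -leqn0 leqNgt -has_count -all_predC.
  apply/allP => p /(allP nest); rewrite /nested /precedes /= -!val_eqE /=.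
  by case: ltngtP => //= _; case: ltngtP.
have c2 : count (precedes^~ (false, x)) (map (pair true) (unzip2 s)) = 0%N.
  rewrite !count_map; apply/eqP; rewrite -leqn0 leqNgt -has_count -all_predC.
  apply/allP => p ps; have := allP nest _ ps; have /eqP := allP legs_s _ ps.
  rewrite /nested /precedes /= -!val_eqE /= => <-.
  by case: ltngtP.
have c3 : count (precedes^~ (true, y)) (map (pair true) (unzip2 s))
        = count (precedes^~ (true, y)) (map (pair false) (unzip1 s)).
  rewrite !count_map; apply: eq_in_count => p ps /=.
  have := allP nest _ ps; have /eqP := allP legs_s _ ps.
  rewrite /nested /precedes /= -!val_eqE /= -xy => <-.
  by case: ltngtP => //= _; case: ltngtP.
by rewrite c1 c2 c3 expr0 mul1r addnn -muln2 exprM sqrr_sign.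
Qed.

End Excitations.

Arguments precedes {n} e e'.

Lemma card_fset_set_seq (T : choiceType) (P : set T) (r : seq T) :
  uniq r -> (forall z, P z <-> z \in r) -> #|` fset_set P| = size r.
Proof.
move=> ur Pr; have fP : finite_set P.
  by apply: (@sub_finite_set _ _ [set` r]); [move=> z /Pr|exact: finite_seq].
apply: perm_size; apply: uniq_perm; rewrite ?fset_uniq// => z.
by rewrite in_fset_set//; apply/idP/idP; rewrite in_setE => /Pr.
Qed.

Lemma maya_eq (A B : maya) : (forall r, mset A r <-> mset B r) -> A = B.
Proof.
case: A => A PA; case: B => B PB /= AB.
have {}AB : A = B by apply/seteqP; split=> r /AB.
by case: _ / AB PB => PB; congr Maya; exact: Prop_irrelevance.
Qed.

(** * Koszul and wedge signs of a basis vector in terms of its particles and holes *)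

Section ExcitedStates.
Variables (K : fieldType) (R : comAlgType K) (n : nat).
Notation mode := ('I_n * nat)%type.
Implicit Types (B : 'I_n -> maya) (xs ys : seq mode) (v : fock R n).

Definition excited B xs ys := [/\ uniq xs, uniq ys,
  forall i (m : nat), mset (B i) m%:Z <-> (i, m) \in xs &
  forall i (m : nat), ~ mset (B i) (- m%:Z - 1) <-> (i, m) \in ys].

Lemma particle_in B xs ys i (m : nat) : excited B xs ys ->
  (m%:Z \in mset (B i)) = ((i, m) \in xs).
Proof. by case=> _ _ Bx _; apply/idP/idP; rewrite in_setE => /Bx. Qed.

Lemma hole_in B xs ys i (m : nat) : excited B xs ys ->
  (- m%:Z - 1 \in mset (B i)) = ((i, m) \notin ys).
Proof.
case=> _ _ _ By; apply/idP/idP; rewrite in_setE; first by move=> Bm; apply/negP => /By.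
by move=> nm; apply: contrapT => /By; exact/negP.
Qed.

Lemma neg_int (r : int) : neg_half r -> exists m : nat, r = - m%:Z - 1.
Proof.
rewrite /neg_half /= => r0; exists (absz r).-1; lia.
Qed.
Lemma nneg_int (r : int) : ~ neg_half r -> exists m : nat, r = m%:Z.
Proof.
rewrite /neg_half /= => /negP r0; exists (absz r); lia.
Qed.

Lemma uniq_filter_map (T : eqType) (xs : seq mode) (P : pred mode) (f : nat -> T) i :
  uniq xs -> injective f -> uniq [seq f x.2 | x <- xs & (x.1 == i) && P x].
Proof.
move=> uxs f_inj; rewrite map_inj_in_uniq ?filter_uniq// => -[i1 m1] [i2 m2].
rewrite !mem_filter /= => /andP[/andP[/eqP-> _] _] /andP[/andP[/eqP-> _] _].
by move/f_inj ->.
Qed.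

Lemma degree_excited B xs ys i : excited B xs ys ->
  degree (B i) = (count (fun x => x.1 == i) xs + count (fun y => y.1 == i) ys)%N.
Proof.
move=> eB; have [ux uy Bx By] := eB; rewrite /degree; congr (_ + _)%N.
  rewrite (@card_fset_set_seq _ _ [seq x.2%:Z | x <- xs & (x.1 == i) && true]).
  - by rewrite size_map size_filter; apply: eq_count => x; rewrite andbT.
  - by apply: (@uniq_filter_map _ xs xpredT (fun m => m%:Z)) => // a b [].
  move=> z; split=> [[Bz /nneg_int[m zm]]|/mapP[[j m]]].
    apply/mapP; exists (i, m) => //; rewrite mem_filter /= eqxx /=.
    by apply/Bx; rewrite -zm.
  rewrite mem_filter /= andbT => /andP[/eqP-> /Bx Bm] ->; split=> //.
rewrite (@card_fset_set_seq _ _ [seq - y.2%:Z - 1 | y <- ys & (y.1 == i) && true]).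
- by rewrite size_map size_filter; apply: eq_count => x; rewrite andbT.
- by apply: (@uniq_filter_map _ ys xpredT (fun m => - m%:Z - 1)) => // a b; lia.
move=> z; split=> [[/neg_int[m zm] Bz]|/mapP[[j m]]].
  apply/mapP; exists (i, m) => //; rewrite mem_filter /= eqxx /=.
  by apply/By; rewrite -zm.
rewrite mem_filter /= andbT => /andP[/eqP-> /By Bm] ->; split=> //.
by rewrite /neg_half /=; lia.
Qed.

Lemma before_particle B xs ys i (m : nat) : excited B xs ys ->
  before (B i) m%:Z = count (fun x => (x.1 == i) && (m < x.2)%N) xs.
Proof.
move=> eB; have [ux uy Bx By] := eB.
rewrite /before (@card_fset_set_seq _ _ [seq x.2%:Z | x <- xs & (x.1 == i) && (m < x.2)%N]).
- by rewrite size_map size_filter.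
- by apply: (@uniq_filter_map _ xs (fun x => m < x.2)%N (fun m => m%:Z)) => // a b [].
move=> z; split=> [[Bz mz]|/mapP[[j k]]].
  have [k zk] : exists k : nat, z = k%:Z by apply: nneg_int; rewrite /neg_half /=; lia.
  apply/mapP; exists (i, k) => //; rewrite mem_filter /= eqxx /=.
  by apply/andP; split; [lia|apply/Bx; rewrite -zk].
rewrite mem_filter /= => /andP[/andP[/eqP-> mk] /Bx Bm] ->; split=> //.
Qed.

(** To the left of - m - 1/2 stand the particles of the factor and those of the m intermediate
    positions that are not holes; the holes are added on the left to avoid a subtraction. *)
Lemma before_hole B xs ys i (m : nat) : excited B xs ys ->
  (before (B i) (- m%:Z - 1) + count (fun y => (y.1 == i) && (y.2 < m)%N) ys
   = m + count (fun x => x.1 == i) xs)%N.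
Proof.
move=> eB; have [ux uy Bx By] := eB.
pose r1 := [seq x.2%:Z | x <- xs & (x.1 == i) && true].
pose r2 := [seq - k%:Z - 1 : int | k <- iota 0 m & (i, k) \notin ys].
have -> : before (B i) (- m%:Z - 1) = (size r1 + size r2)%N.
  rewrite -size_cat; apply: card_fset_set_seq.
    rewrite cat_uniq; apply/and3P; split.
    - by apply: (@uniq_filter_map _ xs xpredT (fun m => m%:Z)) => // a b [].
    - apply/hasPn => _ /mapP[k _ ->]; apply/negP => /mapP[x _]; lia.
    - rewrite map_inj_uniq ?filter_uniq ?iota_uniq// => a b; lia.
  move=> z; rewrite mem_cat; split=> [[Bz mz]|/orP[] /mapP[]].
  - have [/neg_int[k zk]|/nneg_int[k zk]] := pselect (neg_half z).
      apply/orP; right; apply/mapP; exists k => //.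
      rewrite mem_filter mem_iota add0n; apply/andP; split; last by lia.
      by rewrite -(hole_in i k eB) -zk in_setE.
    apply/orP; left; apply/mapP; exists (i, k) => //.
    by rewrite mem_filter /= eqxx; apply/Bx; rewrite -zk.
  - move=> [j k]; rewrite mem_filter /= andbT => /andP[/eqP-> /Bx Bk] ->.
    by split=> //=; lia.
  move=> k; rewrite mem_filter mem_iota add0n -(hole_in i k eB).
  by move=> /andP[+ km] ->; rewrite in_setE; split=> //=; lia.
rewrite !size_map !size_filter (eq_count (a2 := fun x => x.1 == i)) => [|x]; last first.
  by rewrite andbT.
have -> : count (fun y => (y.1 == i) && (y.2 < m)%N) ys
        = count (fun k => (i, k) \in ys) (iota 0 m).
  rewrite -!size_filter -[RHS](size_map (pair i)); apply: perm_size; apply: uniq_perm.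
  - exact: filter_uniq.
  - by rewrite map_inj_uniq ?filter_uniq ?iota_uniq// => a b [].
  move=> [j k]; rewrite mem_filter /=; apply/andP/mapP => [[/andP[/eqP -> km] ky]|].
    by exists k => //; rewrite mem_filter ky mem_iota.
  by case=> k'; rewrite mem_filter mem_iota add0n => /andP[ky km] [-> ->]; rewrite eqxx.
have := count_predC (fun k => (i, k) \in ys) (iota 0 m); rewrite size_iota /predC /=.
rewrite [X in (_ + X)%N = m](eq_count (a2 := fun k => (i, k) \notin ys)) => [E|k] //.
by rewrite -addnA [(count _ (iota 0 m) + count _ (iota 0 m))%N]addnC E addnC.
Qed.

Lemma koszulE B xs ys i : excited B xs ys -> koszul R i B =
  (-1) ^+ (count (fun x : mode => (x.1 < i)%N) xs + count (fun y : mode => (y.1 < i)%N) ys).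
Proof.
move=> eB; rewrite /koszul (eq_bigr _ (fun j _ => degree_excited j eB)) big_split /=.
have H (zs : seq mode) : (\sum_(j < n | (j < i)%N) count (fun x => x.1 == j) zs)%N
    = count (fun x : mode => (x.1 < i)%N) zs.
  elim: zs => [|z zs IH] /=; first by rewrite big1.
  rewrite big_split /= IH; congr (_ + _)%N.
  case: (ltnP z.1 i) => zi; last first.
    by rewrite big1// => j ji; case: eqP => // zj; move: zi; rewrite zj leqNgt ji.
  rewrite (bigD1 z.1)//= eqxx big1 ?addn0// => j /andP[_].
  by rewrite eq_sym => /negPf ->.
by rewrite !H.
Qed.

Lemma particle_signE B xs ys i (m : nat) : excited B xs ys ->
  koszul R i B * (-1) ^+ before (B i) m%:Z =
  (-1) ^+ count (precedes^~ (false, (i, m))) (excitations xs ys).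
Proof.
move=> eB; rewrite (koszulE i eB) (before_particle i m eB) -exprD.
rewrite /excitations count_cat !count_map addnAC; congr (_ ^+ (_ + _)%N); last first.
  by apply: eq_count => -[j k]; rewrite /precedes /= andbF orbF.
rewrite -count_predUI [count (predI _ _) _](eq_count (a2 := pred0)) ?count_pred0 ?addn0.
  by apply: eq_count => -[j k].
move=> [j k] /=; rewrite -val_eqE /=; case: ltngtP => //.
Qed.

(** Compared with counting excitations only, psi^* also crosses the filled levels of the vacuum
    above - m - 1/2. This is the (-1)^m that [contraction] puts into the matrix. *)
Lemma hole_signE B xs ys i (m : nat) : excited B xs ys ->
  koszul R i B * (-1) ^+ before (B i) (- m%:Z - 1) =
  (-1) ^+ m * (-1) ^+ count (precedes^~ (true, (i, m))) (excitations xs ys).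
Proof.
move=> eB; rewrite (koszulE i eB) -!exprD -[LHS]signr_odd -[RHS]signr_odd.
have := before_hole i m eB => /(congr1 odd); rewrite !oddD => Eb.
congr (_ ^+ nat_of_bool _); rewrite /excitations count_cat !count_map !oddD.
have U (zs : seq mode) (P Q S : pred mode) : (forall z, S z = P z || Q z) ->
    (forall z, P z -> Q z -> False) -> odd (count S zs) = odd (count P zs) (+) odd (count Q zs).
  move=> SPQ PQ; rewrite -oddD -count_predUI.
  rewrite [count (predI _ _) _](eq_count (a2 := pred0)) ?count_pred0 ?addn0.
    by congr odd; apply: eq_count => z; rewrite SPQ.
  by move=> z /=; apply/negP => /andP[/PQ].
rewrite (U xs (fun x : mode => (x.1 < i)%N) (fun x => x.1 == i)
  (preim (pair false) (precedes^~ (true, (i, m))))); first last.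
- by move=> [j k] /= ji /eqP ij; rewrite ij ltnn in ji.
- by move=> [j k] /=; rewrite /precedes /= andbT.
rewrite (U ys (fun x : mode => (x.1 < i)%N) (fun y => (y.1 == i) && (y.2 < m)%N)
  (preim (pair true) (precedes^~ (true, (i, m))))); first last.
- by move=> [j k] /= ji /andP[/eqP ij]; rewrite ij ltnn in ji.
- by move=> [j k] /=.
move: Eb; do 2!move: (odd (count _ _)); move: (odd (before _ _)) (odd m).
by move: (odd (count _ _)) (odd (count _ _)) => [] [] [] [] [] [].
Qed.

End ExcitedStates.

(** * Powers of the bilinear operator on the vacuum *)

Section WickExpansion.
Variables (K : fieldType) (R : comAlgType K) (n : nat).
Notation mode := ('I_n * nat)%type.
Implicit Types (B : 'I_n -> maya) (xs ys : seq mode) (v : fock R n).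

Lemma excited_del B xs1 x xs2 ys : excited B (xs1 ++ x :: xs2) ys ->
  excited [eta B with x.1 |-> maya_del (B x.1) x.2%:Z] (xs1 ++ xs2) ys.
Proof.
move=> [ux uy Bx By]; have [ux' nx] : uniq (xs1 ++ xs2) /\ x \notin xs1 ++ xs2.
  move: ux; rewrite -cat_rcons -cats1 -!catA uniq_catCA /= => /andP[nx ux].
  by split.
split=> // i m; rewrite /=; case: eqP => [->|ix] /=.
- rewrite Bx mem_cat inE orbCA -mem_cat; split.
    case=> /predU1P[E|//] ne; case: ne; by rewrite -E.
  move=> ix; split; first by rewrite ix orbT.
  by case=> E; move: nx; rewrite [x]surjective_pairing -E ix.
- rewrite Bx mem_cat inE orbCA -mem_cat; case: eqP => //= E.
  by case: ix; rewrite -E.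
- rewrite -By; split=> [nB Bm|nB [Bm _]]; last exact: nB.
  by apply: nB; split=> //= E; have := E; lia.
exact: By.
Qed.

Lemma excited_add B xs ys1 y ys2 : excited B xs (ys1 ++ y :: ys2) ->
  excited [eta B with y.1 |-> maya_add (B y.1) (- y.2%:Z - 1)] xs (ys1 ++ ys2).
Proof.
move=> [ux uy Bx By]; have [uy' ny] : uniq (ys1 ++ ys2) /\ y \notin ys1 ++ ys2.
  by move: uy; rewrite -cat_rcons -cats1 -!catA uniq_catCA /= => /andP[].
split=> // i m; rewrite /=; case: eqP => [->|iy] /=.
- rewrite -Bx; split=> [[//|/= E]|Bm]; last by left.
  by have := E; lia.
- exact: Bx.
- have -> : ((y.1, m) \in ys1 ++ ys2) = ((y.1, m) \in ys1 ++ y :: ys2) && (m != y.2).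
    rewrite [in RHS]mem_cat inE orbCA -mem_cat; case: eqVneq => [E|nE] /=.
      have -> : m = y.2 by rewrite -E.
      by rewrite eqxx -surjective_pairing; apply/negbTE.
    case: eqP => [E|]; rewrite ?andbT// andbF; case/eqP: nE.
    by rewrite E -surjective_pairing.
  split=> [nB|/andP[/By nB /eqP my]].
    apply/andP; split; first by apply/By => Bm; apply: nB; left.
    by apply/eqP => E; apply: nB; right; rewrite E.
  by case=> // /= E; apply: my; have := E; lia.
rewrite By mem_cat inE orbCA -mem_cat; case: eqP => //= E.
by case: iy; rewrite -E.
Qed.

Variable A : 'I_n -> 'I_n -> nat -> nat -> R.
Definition pair_term v B (x y : mode) : R := A x.1 y.1 x.2 y.2
  * psi x.1 x.2%:Z (psi_star y.1 (- y.2%:Z - 1) v) B.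

Lemma bilinear_excited v B xs ys : excited B xs ys ->
  bilinear A v B = \sum_(x <- xs) \sum_(y <- ys) pair_term v B x y.
Proof.
move=> eB; have [ux uy _ _] := eB.
have xs0 x y : x \notin xs -> pair_term v B x y = 0.
  by move=> xx; rewrite /pair_term /psi (particle_in _ _ eB) -surjective_pairing
     (negPf xx) mulr0.
have ys0 x y : y \notin ys -> pair_term v B x y = 0.
  move=> yy; have [xx|/xs0 ->//] := boolP (x \in xs).
  rewrite /pair_term /psi; case/splitPr: xx eB => xs1 xs2 /excited_del eB.
  rewrite /psi_star (hole_in _ _ eB) -surjective_pairing yy.
  by case: ifP => _; rewrite ?mulr0.
rewrite /bilinear.
transitivity (\sum_i \sum_j \sum_(x <- xs | x.1 == i) \sum_(y <- ys | y.1 == j)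
    pair_term v B x y).
  apply: eq_bigr => i _; apply: eq_bigr => j _.
  pose r := [seq (x.2, y.2) | x <- [seq x <- xs | x.1 == i], y <- [seq y <- ys | y.1 == j]].
  have fst_in zs k (z : mode) : z \in [seq x <- zs | x.1 == k] -> z = (k, z.2).
    by rewrite mem_filter => /andP[/eqP <- _]; exact: surjective_pairing.
  have ur : uniq r.
    apply: allpairs_uniq; rewrite ?filter_uniq// => -[x y] [x' y'].
    move=> /allpairsP[[a b] [/fst_in /= aE /fst_in bE [-> ->]]].
    move=> /allpairsP[[a' b'] [/fst_in /= aE' /fst_in bE' [-> ->]]] [E1 E2].
    by rewrite aE bE aE' bE' E1 E2.
  rewrite (fsbigTE [fset p in r]%fset) => [|[m k]]; last first.
    rewrite inE /= => nin; rewrite -[LHS]/(pair_term v B (i, m) (j, k)).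
    have [xx|/xs0 ->//] := boolP ((i, m) \in xs).
    apply: ys0; apply: contra nin => yy; apply/allpairsP.
    by exists ((i, m), (j, k)); rewrite !mem_filter !eqxx.
  rewrite (perm_big r); last by apply: uniq_perm; rewrite ?fset_uniq// => p; rewrite inE.
  rewrite big_allpairs_dep /= big_filter; apply: eq_bigr => x /eqP <-.
  by rewrite big_filter; apply: eq_bigr => y /eqP <-.
have part (zs : seq mode) (F : mode -> R) :
    \sum_(j < n) \sum_(y <- zs | y.1 == j) F y = \sum_(y <- zs) F y.
  by rewrite [RHS](partition_big (fun y : mode => y.1) xpredT).
by under eq_bigr => i _ do rewrite exchange_big /=; rewrite part;
   apply: eq_bigr => x _; exact: part.
Qed.

Definition contraction (x y : mode) : R := A x.1 y.1 x.2 y.2 * (-1) ^+ y.2.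

Lemma pair_termE v B xs1 x xs2 ys1 y ys2 :
  excited B (xs1 ++ x :: xs2) (ys1 ++ y :: ys2) ->
  exists2 B', excited B' (xs1 ++ xs2) (ys1 ++ ys2) &
  pair_term v B x y = contraction x y
    * (-1) ^+ count (precedes^~ (false, x)) (excitations (xs1 ++ x :: xs2) (ys1 ++ y :: ys2))
    * (-1) ^+ count (precedes^~ (true, y)) (excitations (xs1 ++ xs2) (ys1 ++ y :: ys2))
    * v B'.
Proof.
move=> eB; have eB' := excited_del eB; have eB'' := excited_add eB'.
eexists; first exact: eB''.
rewrite /pair_term /psi (particle_in _ _ eB) -surjective_pairing mem_cat mem_head orbT.
rewrite /psi_star (hole_in _ _ eB') -surjective_pairing mem_cat mem_head orbT /=.
rewrite (particle_signE R x.1 x.2 eB) (hole_signE R y.1 y.2 eB') -!surjective_pairing.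
rewrite /contraction; ring.
Qed.

Lemma part_set0 (r : int) : part_set part0 r <-> neg_half r.
Proof.
split=> [[i _ <-]|]; first by rewrite nth_nil /neg_half /=; lia.
by move/neg_int => [m ->]; exists m => //; rewrite nth_nil; lia.
Qed.

Lemma vacuum_excited B xs ys : excited B xs ys -> size xs = size ys ->
  vacuum R B = (xs == [::])%:R.
Proof.
move=> [_ _ Bx By] sxy; rewrite /vacuum; case: asboolP => [E|nE].
  case: xs Bx {sxy} => // x xs /(_ x.1 x.2) [_].
  rewrite -surjective_pairing mem_head => /(_ isT); rewrite E => /part_set0.
  by rewrite /neg_half /=; lia.
case: xs sxy Bx => // sxy Bx; case: nE; apply/funext => i; apply: maya_eq => r.
case: ys sxy By => // _ By.
rewrite /= part_set0; have [[m rm]|[m rm]] : (exists m : nat, r = m%:Z) \/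
    (exists m : nat, r = - m%:Z - 1).
- by have [/neg_int|/nneg_int] := pselect (neg_half r); [right|left].
- by rewrite rm Bx in_nil /neg_half /=; split=> //; lia.
rewrite rm; have := By i m; rewrite in_nil => -[nn _]; split=> _.
  by rewrite /neg_half /=; lia.
by apply: contrapT => /nn.
Qed.

Variable x0 : mode.
Definition wick_det r xs ys : R :=
  \det (\matrix_(a < r, b < r) contraction (nth x0 xs a) (nth x0 ys b)).

Lemma nth_remove (xs : seq mode) r (a : 'I_r.+1) (i : 'I_r) : size xs = r.+1 ->
  nth x0 (take a xs ++ drop a.+1 xs) i = nth x0 xs (lift a i).
Proof.
move=> sx; rewrite nth_cat size_take sx ltn_ord /= /bump.
case: ltnP => ia; first by rewrite nth_take.
by rewrite nth_drop addSn subnKC.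
Qed.

Lemma split_nth (xs : seq mode) r (a : 'I_r.+1) : size xs = r.+1 ->
  xs = take a xs ++ nth x0 xs a :: drop a.+1 xs.
Proof.
by move=> sx; rewrite -drop_nth ?cat_take_drop// sx.
Qed.

(** One application removes a particle a and a hole b. For fixed a the sum over b is the Laplace
    expansion along row a, so each of the l + 1 values of a gives the same determinant and l!
    becomes (l + 1)!. *)
Lemma iter_bilinear l r B xs ys : size xs = r -> size ys = r ->
  excited B xs ys -> iter l (bilinear A) (@vacuum K R n) B =
    if l == r then l`!%:R * (wick_sign R xs ys * wick_det r xs ys) else 0.
Proof.
elim: l r B xs ys => [|l IH] r B xs ys sx sy eB.
  rewrite /= (vacuum_excited eB) ?sx//; case: r sx sy => [|r].
    move/size0nil => -> /size0nil ->; rewrite /wick_sign /wick_det det_mx00.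
    by rewrite bin0n expr0 !mul1r.
  by case: xs {eB}.
rewrite iterS (bilinear_excited _ eB); case: r sx sy => [|r] sx sy.
  by rewrite (size0nil sx) big_nil.
rewrite eqSS (big_nth x0) sx big_mkord.
set M := \matrix_(a < r.+1, b < r.+1) contraction (nth x0 xs a) (nth x0 ys b).
transitivity (\sum_(a < r.+1) if l == r then
    l`!%:R * (wick_sign R xs ys * \det M) else 0); last first.
  rewrite sumr_const card_ord; case: eqVneq => [->|_]; last by rewrite mul0rn.
  by rewrite factS natrM -mulrA [RHS]mulr_natl.
apply: eq_bigr => a _; rewrite (big_nth x0) sy big_mkord.
transitivity (\sum_(b < r.+1) if l == r then
    l`!%:R * (wick_sign R xs ys * (M a b * cofactor M a b)) else 0); last first.
  case: eqVneq => _; last by rewrite big1.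
  by rewrite -!mulr_sumr -expand_det_row.
apply: eq_bigr => b _.
have eB' : excited B (take a xs ++ nth x0 xs a :: drop a.+1 xs)
                     (take b ys ++ nth x0 ys b :: drop b.+1 ys).
  by rewrite -(split_nth a sx) -(split_nth b sy).
have [ux' uy' _ _] := eB'.
have [B' eB'' ->] := pair_termE (iter l (bilinear A) (@vacuum K R n)) eB'.
have sx' : size (take a xs ++ drop a.+1 xs) = r.
  by rewrite size_cat size_take size_drop sx ltn_ord; have := ltn_ord a; lia.
have sy' : size (take b ys ++ drop b.+1 ys) = r.
  by rewrite size_cat size_take size_drop sy ltn_ord; have := ltn_ord b; lia.
rewrite (IH r B' _ _ sx' sy' eB''); case: eqVneq => _; last by rewrite mulr0.
have nx : nth x0 xs a \notin take a xs.
  by move: ux'; rewrite uniq_catC /= mem_cat negb_or => /andP[/andP[]].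
have ny : nth x0 ys b \notin take b ys.
  by move: uy'; rewrite uniq_catC /= mem_cat negb_or => /andP[/andP[]].
have := @wick_sign_remove n R _ _ (drop a.+1 xs) _ _ (drop b.+1 ys) nx ny.
rewrite -(split_nth a sx) -(split_nth b sy) size_take sx ltn_ord size_take sy ltn_ord => ->.
rewrite /cofactor [M a b]mxE.
have -> : row' a (col' b M) = \matrix_(i < r, j < r)
    contraction (nth x0 (take a xs ++ drop a.+1 xs) i) (nth x0 (take b ys ++ drop b.+1 ys) j).
  by apply/matrixP => i j; rewrite !mxE !nth_remove.
rewrite -/(wick_det r _ _).
(* The positions of the removed arm and leg give (-1)^(a + b) in the Wick sign, which is the sign of
   the cofactor. *)
have sq : (-1) ^+ (a + b) * (-1) ^+ (a + b) = 1 :> R.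
  by rewrite -exprD addnn -muln2 exprM sqrr_sign.
set e := (-1) ^+ (a + b) in sq *.
set s1 := _ ^+ count _ _; set s2 := _ ^+ count _ _.
set w := wick_sign _ _ _; set D := wick_det _ _ _.
set c := contraction _ _.
transitivity (e * e * (c * s1 * s2 * (l`!%:R * (w * D)))); first by rewrite sq mul1r.
ring.
Qed.

End WickExpansion.

(** * Wick's theorem for the pairing with partitions *)

Definition mode_pairs (T : Type) (h : T) (nu : part) : seq ((T * nat) * (T * nat)) :=
  [seq ((h, p.1), (h, p.2)) | p <- frob nu].
Definition modes_pairs (T : Type) (s : seq T) (mu : T -> part) :=
  flatten [seq mode_pairs h (mu h) | h <- s].

Section WickTheorem.
Variables (K : fieldType) (R : comAlgType K) (n : nat).
Hypothesis K_char0 : forall z : int, z != 0 -> z%:~R != 0 :> K.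
Variables (A : 'I_n -> 'I_n -> nat -> nat -> R) (mu : 'I_n -> part).

Lemma uniq_frobenius l : frobenius l -> uniq (unzip1 l) /\ uniq (unzip2 l).
Proof.
have gtn_tr : transitive gtn by move=> y x z /=; lia.
by move=> /andP[s1 s2]; split; apply: (sorted_uniq gtn_tr) => // x /=; rewrite ltnn.
Qed.

Let s := modes_pairs (enum 'I_n) mu.

Lemma unzip1_modes_pairs : unzip1 s = [seq (i, m) | i <- enum 'I_n, m <- unzip1 (frob (mu i))].
Proof.
rewrite /s /modes_pairs /unzip1 map_flatten -map_comp; congr flatten.
by apply: eq_map => i /=; rewrite /mode_pairs -!map_comp.
Qed.
Lemma unzip2_modes_pairs : unzip2 s = [seq (i, m) | i <- enum 'I_n, m <- unzip2 (frob (mu i))].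
Proof.
rewrite /s /modes_pairs /unzip2 map_flatten -map_comp; congr flatten.
by apply: eq_map => i /=; rewrite /mode_pairs -!map_comp.
Qed.

Lemma mem_labelled (f : 'I_n -> seq nat) i m :
  ((i, m) \in [seq (i, m) | i <- enum 'I_n, m <- f i]) = (m \in f i).
Proof.
apply/allpairsPdep/idP => [[j [k [_ kf [-> ->]]]]//|mf].
by exists i, m; rewrite mem_enum.
Qed.

Lemma uniq_labelled (f : 'I_n -> seq nat) : (forall i, uniq (f i)) ->
  uniq [seq (i, m) | i <- enum 'I_n, m <- f i].
Proof.
move=> uf; apply: allpairs_uniq_dep; rewrite ?enum_uniq//.
by move=> [i m] [j k] _ _ /= [ij mk]; subst j; rewrite mk.
Qed.

Lemma excited_maya_part : excited (fun i => maya_part (mu i)) (unzip1 s) (unzip2 s).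
Proof.
split=> [||i m|i m].
- rewrite unzip1_modes_pairs; apply: uniq_labelled => i.
  by have [] := uniq_frobenius (frobenius_frob (mu i)).
- rewrite unzip2_modes_pairs; apply: uniq_labelled => i.
  by have [] := uniq_frobenius (frobenius_frob (mu i)).
- by rewrite unzip1_modes_pairs mem_labelled; exact: part_set_arm.
by rewrite unzip2_modes_pairs mem_labelled; exact: part_set_leg.
Qed.

Lemma wick_sign_maya_part : wick_sign R (unzip1 s) (unzip2 s) = 1.
Proof.
apply: wick_sign1.
  apply/allP => p /flattenP[_ /mapP[i _ ->]] /mapP[? _ ->] //=.
rewrite /s /modes_pairs.
have: pairwise (fun i j : 'I_n => i < j)%N (enum 'I_n).
  by rewrite -(pairwise_map val (fun i j => i < j)%N) val_enum_ord -sorted_pairwise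
    ?iota_ltn_sorted//; exact: ltn_trans.
elim: (enum 'I_n) => //= i r IH /andP[ir pr].
rewrite pairwise_cat IH// andbT; apply/andP; split.
  apply/allrelP => _ _ /mapP[p _ ->] /flattenP[_ /mapP[j jr ->]] /mapP[p' _ ->].
  by rewrite /nested /= (allP ir j jr).
rewrite /mode_pairs; have := frobenius_frob (mu i).
elim: (frob _) => //= -[k l] fr IHf; rewrite frobenius_cons => /and3P[/IHf -> ak al].
rewrite andbT; apply/allP => _ /mapP[p pf ->]; rewrite /nested /= eqxx.
by rewrite (allP ak p pf) (allP al p pf) orbT.
Qed.

Theorem bra_exp_vacuum :
  bra mu (exp_vacuum A) = det_pairs (contraction A) s.
Proof.
have eB := excited_maya_part.
have iterE l : iter l (bilinear A) (@vacuum K R n) (fun i => maya_part (mu i)) =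
    if l == size s then l`!%:R * det_pairs (contraction A) s else 0.
  have su1 : size (unzip1 s) = size s by rewrite size_map.
  have su2 : size (unzip2 s) = size s by rewrite size_map.
  (* The empty list is treated apart: a nonempty one supplies the default label for [iter_bilinear],
     and there is no label at all when n = 0. *)
  case sE: s => [|p0 s'].
    case: l => [|l].
      by rewrite /= (vacuum_excited R eB) ?su1 ?su2// sE det_pairs_nil mulr1.
    by rewrite iterS (bilinear_excited A _ eB) sE big_nil.
  rewrite (iter_bilinear A p0.1 l su1 su2 eB) -sE wick_sign_maya_part mul1r.
  congr (if _ then _ * _ else _); rewrite /wick_det /det_pairs /det_tuple.
  congr (\det _); apply/matrixP => a b; rewrite !mxE !(tnth_nth p0).
  by rewrite (nth_map p0)// (set_nth_default p0.1 p0.1) ?size_map//; congr contraction;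
     rewrite (nth_map p0).
rewrite /bra /exp_vacuum (fsbigTE [fset size s]%fset) => [|l]; last first.
  by rewrite inE iterE => /negPf ->; rewrite scaler0.
rewrite big_seq_fset1 iterE eqxx mulr_natl -scaler_nat scalerA mulVf ?scale1r//.
rewrite -[_%:R]/((Posz _)%:~R) K_char0//.
by rewrite eqz_nat -lt0n fact_gt0.
Qed.

End WickTheorem.

(** * Summing over the partition carried by a glued edge *)

Section SubsetExpansion.
Variables (T : eqType) (K : fieldType) (I : finType) (g : nat).
Notation R := (series K I g).
Variables (rho : nat -> T * T) (w : nat -> R).

Lemma subset_sum_subsets (A : T -> T -> R) s k : subset_sum rho w A s k =
  \sum_(S <- subsets k) (\prod_(j <- S) w j) * det_pairs A (s ++ map rho S).
Proof.
elim: k s => [|k IHk] s; first by rewrite big_seq1 big_nil mul1r cats0.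
rewrite /= big_cat big_map !IHk mulr_sumr; congr (_ + _).
by apply: eq_bigr => S _; rewrite big_cons cat_rcons mulrA.
Qed.

End SubsetExpansion.

Section Gluing.
Variables (K : fieldType) (I : finType) (H : eqType) (g : nat).
Notation R := (series K I g).
Notation mode := (H * nat)%type.
Variables (ha hb : H) (alpha beta : nat -> K) (i0 : I) (t t' : R).
(** [t] weights arms and [t'] legs: Theta and its inverse when a loop is closed, 1 and 1 when a
    vertex is added. Balanced sets get no net weight. *)
Hypothesis tt' : t * t' = 1.
Implicit Types (A : mode -> mode -> R) (s : seq (mode * mode)) (S : seq nat).

(** Arm m of nu is a row at [ha] and, as leg m of the conjugate, a column at [hb]; leg n is a column
    at [ha] and a row at [hb]. Pairing rows with columns mode by mode, not hook by hook, lets each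
    mode be removed alone. *)
Definition glued_pair (j : nat) : mode * mode :=
  if odd j then ((hb, j./2), (ha, j./2)) else ((ha, j./2), (hb, j./2)).

Definition root_monomial (d : nat) : series K I g :=
  monomial K ([ffun c => if c == i0 then d else 0%N], 0).

Lemma root_monomialD d d' :
  root_monomial (d + d') = root_monomial d * root_monomial d'.
Proof.
rewrite -monomialD; congr monomial; congr pair; last by rewrite addr0.
by apply/ffunP => c; rewrite !ffunE; case: ifP.
Qed.
Lemma root_monomial0 : root_monomial 0 = 1.
Proof.
by congr monomial; congr pair; apply/ffunP => c; rewrite !ffunE if_same.
Qed.
Lemma eqm_root_monomial d : eqm d (root_monomial d) 0.
Proof.
apply: eqm_leq (eqm_monomial _ _); rewrite /qdeg (bigD1 i0)//= ffunE eqxx.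
exact: leq_addr.
Qed.

(** In square roots of Q, an arm m and a leg n together give exponent (2m + 1) + (2n + 1), twice the
    size m + n + 1 of their hook. *)
Definition glue_weight (j : nat) : R :=
  (if odd j then beta j./2 else alpha j./2) *:
    (root_monomial j./2.*2.+1 * (if odd j then t' else t)).

Lemma prod_glue_weight S : \prod_(j <- S) glue_weight j =
  ((\prod_(m <- arms S) alpha m) * (\prod_(n <- legs S) beta n)) *:
  (root_monomial (\sum_(m <- arms S) m.*2.+1 + \sum_(n <- legs S) n.*2.+1)
   * (t ^+ size (arms S) * t' ^+ size (legs S))).
Proof.
elim: S => [|j S IH].
  by rewrite /arms /legs !big_nil root_monomial0 !mulr1 scale1r.
rewrite big_cons IH /arms /legs /glue_weight /=.
case: (odd j) => /=; rewrite !big_cons !exprS -scalerAl -scalerAr scalerA.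
  congr (_ *: _); first by ring.
  by rewrite addnCA (root_monomialD j./2.*2.+1); ring.
congr (_ *: _); first by ring.
by rewrite -addnA (root_monomialD j./2.*2.+1); ring.
Qed.

(** Passing from pairing by hooks to pairing by modes takes one column exchange for each hook. *)
Lemma det_pairs_glue A s (l : seq (nat * nat)) :
  det_pairs A (s ++ [seq ((ha, p.1), (ha, p.2)) | p <- l]
                 ++ [seq ((hb, p.2), (hb, p.1)) | p <- l])
  = (-1) ^+ size l *
    det_pairs A (s ++ [seq ((ha, p.1), (hb, p.1)) | p <- l]
                   ++ [seq ((hb, p.2), (ha, p.2)) | p <- l]).
Proof.
have mv (p q : mode * mode) (s1 s2 s3 : seq (mode * mode)) :
  perm_eq (s1 ++ (p :: s2) ++ (q :: s3)) ([:: p, q & s1] ++ s2 ++ s3).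
  apply/seq.permP => P; rewrite /= !count_cat /= !count_cat /=.
  lia.
elim: l s => [|[m n] l IH] s; first by rewrite /= expr0 mul1r.
rewrite /= (det_pairs_perm A (mv _ _ _ _ _)) [_ ++ _ in LHS]/= det_pairs_cross.
rewrite (IH [:: _, _ & s]) exprS !mulNr mul1r; congr (- (_ * _)).
exact/esym/det_pairs_perm/mv.
Qed.

Lemma perm_glued_pair S : balanced S -> perm_eq (map glued_pair S)
  ([seq ((ha, p.1), (hb, p.1)) | p <- decode S]
     ++ [seq ((hb, p.2), (ha, p.2)) | p <- decode S]).
Proof.
move=> bS; apply: perm_trans (perm_map _ (perm_arms_legs S)) _.
rewrite map_cat -(unzip1_decode bS) -(unzip2_decode bS) /unzip1 /unzip2 -!map_comp.
set r := (X in perm_eq X _); set r' := (X in perm_eq _ X).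
suff -> : r = r' by []; congr (_ ++ _); apply: eq_map => p /=.
  by rewrite /glued_pair odd_double doubleK.
by rewrite /glued_pair /= odd_double uphalf_double.
Qed.

Variables (c : R) (A : mode -> mode -> R).
Hypothesis c1 : eqm 1 c 1.

(** The minus sign attached to each hook compensates the re-pairing sign of [det_pairs_glue]. *)
Definition glued_term s (nu : part) : R :=
  c * (\prod_(p <- frob nu) - (alpha p.1 * beta p.2) *:
    (root_monomial (sumn nu).*2 *
       det_pairs A (s ++ mode_pairs ha nu ++ mode_pairs hb (conj_part nu)))).

Lemma sign_scale n (x : K) (y : R) :
  ((-1) ^+ n * x) *: ((-1) ^+ n * y) = x *: y.
Proof.
rewrite -(signr_odd K n) -(signr_odd R n).
by case: (odd n); rewrite ?expr0 ?expr1 ?mul1r ?mulN1r ?scaleNr ?scalerN ?opprK.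
Qed.

Lemma glued_termE s S : sorted gtn S -> balanced S ->
  glued_term s (part_of (decode S)) =
  c * ((\prod_(j <- S) glue_weight j) * det_pairs A (s ++ map glued_pair S)).
Proof.
move=> sS bS; have fS := frobenius_decode sS bS.
rewrite /glued_term /mode_pairs frob_conj frob_part_of// -map_comp det_pairs_glue.
rewrite prod_glue_weight -(unzip1_decode bS) -(unzip2_decode bS) !size_map.
rewrite -exprMn tt' expr1n mulr1.
rewrite -(det_pairs_perm A (s := s ++ map glued_pair S)); last first.
  by rewrite perm_cat2l; exact: perm_glued_pair.
rewrite sumn_frob frob_part_of// -scalerAl !big_map.
have -> : (\sum_(p <- decode S) p.1.*2.+1 + \sum_(p <- decode S) p.2.*2.+1
           = (\sum_(p <- decode S) (p.1 + p.2).+1).*2)%N.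
  rewrite -big_split -mul2n big_distrr; apply: eq_bigr => p _ /=; lia.
have -> : \prod_(p <- decode S) - (alpha p.1 * beta p.2) = (-1) ^+ size (decode S) *
    ((\prod_(p <- decode S) alpha p.1) * (\prod_(p <- decode S) beta p.2)) :> K.
  elim: (decode S) => [|p l IH]; first by rewrite !big_nil !mulr1.
  rewrite !big_cons IH exprS; ring.
congr (c * _); rewrite [root_monomial _ * ((-1) ^+ _ * _)]mulrCA.
exact: sign_scale.
Qed.

Variable P : pred (seq (mode * mode)).
Hypothesis unbalanced0 : forall s S, P s -> size (arms S) != size (legs S) ->
  constant_term (c * ((\prod_(j <- S) glue_weight j) *
    det_pairs A (s ++ map glued_pair S))) = 0.

(** A partition with a Frobenius coordinate at least k has size above k, so modulo the k-th power of
    the roots both sides involve only the first 2k modes. The balanced sets give the partition sum,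
    and [unbalanced0] disposes of the others. *)
Lemma gluing_step : exists c' A', eqm 1 c' 1 /\
  forall s (F : part -> series K I 0) (Z : series K I 0), P s ->
  (forall e, Z e = \sum_(nu \in [set: part]) F nu e) ->
  (forall nu, subst_pow 2 (F nu) = constant_term (glued_term s nu)) ->
  subst_pow 2 Z = constant_term (c' * det_pairs A' s).
Proof.
have w_deg j : eqm j./2.*2.+1 (glue_weight j) 0.
  rewrite /glue_weight -[X in eqm _ _ X](scaler0 _ (if odd j then beta j./2 else alpha j./2)).
  by apply/eqmZ/eqm_mulr0/eqm_root_monomial.
have w1 j : eqm 1 (glue_weight j) 0 by apply: eqm_leq (w_deg j).
have wj j : eqm j (glue_weight j) 0 by apply: eqm_leq (w_deg j); lia.
have [u [A' [u1 uA']]] := eliminationP glued_pair w1 wj A.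
exists (c * u), A'; split; first by rewrite -[X in eqm _ _ X]mulr1; exact: eqmM.
move=> s F Z Ps ZF FE; apply: eqm_eq => k.
apply: (@eqm_trans _ _ _ _ _ (constant_term (c * subset_sum glued_pair glue_weight A s k.*2))).
  split=> e ek.
  have -> : subst_pow 2 Z e = \sum_(nu \in [set: part]) subst_pow 2 (F nu) e.
    rewrite /= /subst_pow_coef; case: ifP => _; first by rewrite ZF.
    by rewrite fsbig1.
  rewrite (@part_sum_subsets _ _ k) => [|nu box].
    rewrite subset_sum_subsets mulr_sumr (clin_sum _ _ (clin_constant_term _ _ _)).
    rewrite [in RHS](bigID balanced)/=.
    set Y := (X in _ = _ + coef X e); have -> : Y = 0.
      by rewrite /Y big1// => S nbS; exact: unbalanced0.
    rewrite coef0 addr0 coef_sum.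
    rewrite big_seq_cond [RHS]big_seq_cond; apply: eq_bigr => S.
    rewrite mem_subsets => /andP[/andP[sS _] bS].
    by rewrite -[LHS]/(subst_pow 2 (F (part_of (decode S))) e) FE glued_termE.
  rewrite FE /glued_term.
  suff E : eqm k (constant_term (glued_term s nu)) 0 by rewrite (eqmE E).
  rewrite -(clin0 (clin_constant_term K I g)).
  apply: (clin_constant_term _ _ _).2; apply: eqm_mull0.
  rewrite -[X in eqm _ _ X](scaler0 _ (\prod_(p <- frob nu) - (alpha p.1 * beta p.2))).
  apply/eqmZ/eqm_mulr0/(eqm_leq _ (eqm_root_monomial _)).
  move: box; rewrite /in_box -has_predC => /hasP[p pnu /= bp].
  rewrite sumn_frob; case/splitPr: pnu => l1 l2; rewrite big_cat big_cons /=.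
  by move: bp; move: (\sum_(_ <- l1) _)%N (\sum_(_ <- l2) _)%N => n1 n2; lia.
rewrite -mulrA; apply: (clin_constant_term _ _ _).2; apply: eqmM => //.
by apply: eqm_leq (uA' _ _); lia.
Qed.

End Gluing.

(** * Closing a loop: one new Theta *)

Section LoopStep.
Variables (K : fieldType) (I : finType) (H : eqType) (g : nat).
Notation mode := (H * nat)%type.
Implicit Types (s : seq (mode * mode)).

Definition widen_theta (th : {ffun 'I_g -> int}) : {ffun 'I_g.+1 -> int} :=
  [ffun i => oapp th 0 (unlift ord_max i)].
Definition last_theta (z : int) : {ffun 'I_g.+1 -> int} :=
  [ffun i => if i == ord_max then z else 0].

Lemma widen_thetaD : {morph widen_theta : a b / a + b}.
Proof.
move=> a b; apply/ffunP => i; rewrite !ffunE; case: unlift => [j|] /=.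
  by rewrite ffunE.
by rewrite addr0.
Qed.
Lemma widen_theta0 : widen_theta 0 = 0.
Proof. by apply/ffunP => i; rewrite !ffunE; case: unlift => //= j; rewrite ffunE. Qed.
Lemma widen_theta_last th z : widen_theta th + last_theta z == 0 -> th = 0 /\ z = 0.
Proof.
move=> /eqP/ffunP E; split.
  apply/ffunP => i; have := E (lift ord_max i).
  by rewrite !ffunE liftK /= eq_sym (negPf (neq_lift _ _)) addr0.
by have := E ord_max; rewrite !ffunE unlift_none eqxx add0r.
Qed.

Let emb := embed (K := K) (I := I) widen_theta.
Let theta (z : int) : series K I g.+1 := monomial K (0, last_theta z).

Lemma thetaD z z' : theta (z + z') = theta z * theta z'.
Proof.
rewrite -monomialD; congr monomial; rewrite -[(0, _) + _]/(0 + 0, _ + _) addr0.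
by congr pair; apply/ffunP => i; rewrite !ffunE; case: ifP; rewrite ?addr0.
Qed.
Lemma theta0 : theta 0 = 1.
Proof. by congr monomial; congr pair; apply/ffunP => i; rewrite !ffunE if_same. Qed.
Lemma thetaX z n : theta z ^+ n = theta (z *+ n).
Proof.
elim: n => [|n IHn]; first by rewrite theta0.
by rewrite exprS IHn -thetaD mulrS.
Qed.

Lemma constant_term_embed_theta f z :
  constant_term (emb f * theta z) = if z == 0 then constant_term f else 0.
Proof.
have cl : continuous_linear (fun f => constant_term (emb f * theta z)).
  apply: (clin_comp (F := fun f => emb f * theta z)) (clin_constant_term _ _ _).
  have := clin_mul (theta z) (clin_embed K I widen_theta).
  by case=> L C; split=> [c f1 f2|k f1 f2 /C]; rewrite ![_ * theta z]mulrC.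
have mono a : constant_term (emb (monomial K a) * theta z) =
    if z == 0 then constant_term (monomial K a) else 0.
  rewrite /emb embed_monomial -monomialD !constant_term_monomial.
  rewrite -[(_, _) + _]/(a.1 + 0, widen_theta a.2 + last_theta z) /= addr0.
  case: (eqVneq z 0) => [->|z0].
    case: (eqVneq a.2 0) => [->|a0].
      rewrite widen_theta0 add0r ifT//; apply/eqP/ffunP => i.
      by rewrite !ffunE if_same.
    by case: ifP => // /widen_theta_last[a0' _]; rewrite a0' eqxx in a0.
  by case: ifP => // /widen_theta_last[_ z0']; rewrite z0' eqxx in z0.
case: (eqVneq z 0) => z0 in mono *.
  by apply: (clin_eq cl (clin_constant_term _ _ _)) => a; exact: mono.
apply: (clin_eq (G := fun=> 0) cl) => //.
by split=> [c f1 f2|k f1 f2 _]; rewrite ?scaler0 ?addr0.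
Qed.

Lemma det_pairs_embed (A : mode -> mode -> series K I g) s :
  det_pairs (fun x y => emb (A x y)) s = emb (det_pairs A s).
Proof.
rewrite (det_pairs_morph (sigma := emb)) //.
- exact: embed1 widen_theta0.
- by move=> f h; apply: clinD; exact: clin_embed.
by move=> f h; exact: embedM widen_thetaD f h.
Qed.

(** [c] and [A] are embedded so as to be free of the new Theta. Its only power in the term of S is
    then the number of arms minus the number of legs. *)
Lemma loop_step (ha hb : H) (alpha beta : nat -> K) (i0 : I) (c : series K I g)
    (A : mode -> mode -> series K I g) : eqm 1 c 1 ->
  exists c' A', eqm 1 (c' : series K I g.+1) 1 /\
  forall s (F : part -> series K I 0) (Z : series K I 0),
  (forall e, Z e = \sum_(nu \in [set: part]) F nu e) ->
  (forall nu, subst_pow 2 (F nu) =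
     constant_term (glued_term ha hb alpha beta i0 c A s nu)) ->
  subst_pow 2 Z = constant_term (c' * det_pairs A' s).
Proof.
move=> c1; have clE := clin_embed K I widen_theta.
have embM f h : emb (f * h) = emb f * emb h by exact: embedM widen_thetaD f h.
have emb_root d : emb (root_monomial K g i0 d) = root_monomial K g.+1 i0 d.
  by rewrite /emb embed_monomial widen_theta0.
have c1' : eqm 1 (emb c) 1.
  by rewrite -[X in eqm _ _ X](embed1 K I widen_theta0); exact: clE.2.
have tt' : theta 1 * theta (-1) = 1 by rewrite -thetaD subrr theta0.
have unbal s S : xpredT s -> size (arms S) != size (legs S) ->
    constant_term (emb c * ((\prod_(j <- S) glue_weight alpha beta i0 (theta 1) (theta (-1)) j)
      * det_pairs (fun x y => emb (A x y)) (s ++ map (glued_pair ha hb) S))) = 0.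
  move=> _ nb; rewrite prod_glue_weight det_pairs_embed -emb_root !thetaX -thetaD.
  rewrite -scalerAl -scalerAr (clinZ _ _ (clin_constant_term _ _ _)).
  set x := emb (root_monomial _ _ _ _); set D := emb (det_pairs _ _); set th := theta _.
  have -> : emb c * (x * th * D) = emb c * x * D * th by ring.
  rewrite -!embM constant_term_embed_theta ifF ?scaler0//.
  by apply/negbTE; move: nb; apply: contra => /eqP; rewrite mulNrn => E; apply/eqP; lia.
have [c' [A' [c'1 AP]]] := gluing_step tt' c1' unbal.
exists c', A'; split=> // s F Z ZF FE; apply: AP => // nu.
rewrite FE -[RHS](_ : constant_term (emb (glued_term ha hb alpha beta i0 c A s nu)) = _).
  by rewrite -[emb _]mulr1 -theta0 constant_term_embed_theta eqxx.
rewrite /glued_term embM; congr (constant_term (_ * _)).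
by rewrite /emb clinZ// -/emb embM emb_root det_pairs_embed.
Qed.

End LoopStep.

(** * Adding a vertex: block diagonal matrices *)

Section VertexStep.
Variables (K : fieldType) (I : finType) (H : eqType) (g : nat).
Hypothesis K_char0 : forall z : int, z != 0 -> z%:~R != 0 :> K.
Notation mode := (H * nat)%type.
Notation R := (series K I g).
Implicit Types (s : seq (mode * mode)).
Variables (b : pred H) (A : mode -> mode -> R) (B : mode -> mode -> K).

Definition block_sum (x y : mode) : R :=
  if b x.1 then (if b y.1 then A x y else 0)
  else (if b y.1 then 0 else (B x y)%:A).

Lemma series_char0 (z : int) (f : R) : z != 0 -> z%:~R * f = 0 -> f = 0.
Proof.
move=> z0; rewrite mulrzl -scaler_int => /(congr1 ( *:%R (z%:~R : K)^-1)).
by rewrite scaler0 scalerA mulVf ?scale1r// K_char0.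
Qed.

Lemma det_block_sum s1 s2 :
  all (fun p => b p.1.1 && b p.2.1) s1 ->
  all (fun p => ~~ b p.1.1 && ~~ b p.2.1) s2 ->
  det_pairs block_sum (s1 ++ s2) = det_pairs A s1 * (det_pairs B s2)%:A.
Proof.
move=> /allP b1 /allP b2; rewrite det_pairs_cat => [|p q /b1/andP[p1 _] /b2/andP[_ q2]].
  have -> : det_pairs block_sum s1 = det_pairs A s1.
    by apply: det_pairs_eq => p q /b1/andP[p1 _] /b1/andP[_ q2]; rewrite /block_sum p1 q2.
  have -> : (det_pairs B s2)%:A = det_pairs (fun x y => (B x y)%:A : R) s2.
    rewrite -[LHS]/(in_alg R (det_pairs B s2)) (det_pairs_morph (sigma := in_alg R)) //.
    - exact: rmorph1.
    - exact: rmorphD.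
    - exact: rmorphM.
  have -> // : det_pairs block_sum s2 = det_pairs (fun x y => (B x y)%:A) s2.
  apply: det_pairs_eq => p q /b2/andP[/negPf p1 _] /b2/andP[_ /negPf q2].
  by rewrite /block_sum p1 q2.
by rewrite /block_sum p1 (negPf q2).
Qed.

(** [det_pairs_unbalanced] is applied with r = 2 on the old block and 1 on the new one. Each pair of
    [s] stays within one block, so the determinant is annihilated by 2^n (2^arms - 2^legs), which is
    invertible in characteristic 0 unless S is balanced. *)
Lemma vertex_step (ha hb : H) (alpha beta : nat -> K) (i0 : I) (c : R) :
  b ha -> ~~ b hb -> eqm 1 c 1 ->
  exists c' A', eqm 1 (c' : R) 1 /\
  forall s (F : part -> series K I 0) (Z : series K I 0),
  all (fun p => b p.1.1 == b p.2.1) s ->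
  (forall e, Z e = \sum_(nu \in [set: part]) F nu e) ->
  (forall nu, subst_pow 2 (F nu) =
     constant_term (glued_term ha hb alpha beta i0 c block_sum s nu)) ->
  subst_pow 2 Z = constant_term (c' * det_pairs A' s).
Proof.
move=> bha bhb c1; pose P s := all (fun p : mode * mode => b p.1.1 == b p.2.1) s.
apply: (@gluing_step _ _ _ _ ha hb alpha beta i0 1 1 (mulr1 _) c block_sum c1 P).
move=> s S /allP Ps nb; suff -> : det_pairs block_sum (s ++ map (glued_pair ha hb) S) = 0.
  by rewrite !mulr0 (clin0 (clin_constant_term _ _ _)).
pose r (x : mode) : R := if b x.1 then 2 else 1.
have := @det_pairs_unbalanced _ R block_sum r (s ++ map (glued_pair ha hb) S).
have -> : \prod_(p <- s ++ map (glued_pair ha hb) S) r p.1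
    = \prod_(p <- s) r p.1 * 2 ^+ size (arms S).
  rewrite big_cat big_map; congr (_ * _); elim: S {nb} => [|j S IH]; rewrite ?big_nil//.
  rewrite big_cons IH /glued_pair /arms /=; case: (odd j) => /=.
    by rewrite /r (negPf bhb) mul1r.
  by rewrite /r bha exprS.
have -> : \prod_(p <- s ++ map (glued_pair ha hb) S) r p.2
    = \prod_(p <- s) r p.1 * 2 ^+ size (legs S).
  rewrite big_cat big_map; congr (_ * _).
    by apply: eq_big_seq => p /Ps; rewrite /r => /eqP ->.
  elim: S {nb} => [|j S IH]; rewrite ?big_nil//.
  rewrite big_cons IH /glued_pair /legs /=; case: (odd j) => /=.
    by rewrite /r bha exprS.
  by rewrite /r (negPf bhb) mul1r.
have [n ->] : exists n, \prod_(p <- s) r p.1 = 2 ^+ n.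
  elim: s {Ps} => [|p s [n IH]]; first by exists 0%N; rewrite big_nil.
  rewrite big_cons IH /r; case: ifP => _; last by exists n; rewrite mul1r.
  by exists n.+1; rewrite exprS.
have rA x y : r x * block_sum x y = block_sum x y * r y.
  by rewrite /r /block_sum; case: (b x.1); case: (b y.1); rewrite ?mulr0 ?mul0r// mulrC.
move=> /(_ rA).
have -> : 2 ^+ n * 2 ^+ size (arms S) - 2 ^+ n * 2 ^+ size (legs S) =
    ((2 ^ n)%:Z * ((2 ^ size (arms S))%:Z - (2 ^ size (legs S))%:Z))%:~R :> R.
  by rewrite rmorphM rmorphB /= -!pmulrn !natrX mulrBr.
apply: series_char0; rewrite mulf_neq0//; first by rewrite eqz_nat -lt0n expn_gt0.
by rewrite subr_eq0 eqz_nat eqn_exp2l.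
Qed.

End VertexStep.

(** * Edge factors and vertices of a toric diagram in terms of hooks *)

Lemma qfield_char0 (k : fieldType) : [pchar k] =i pred0 ->
  forall z : int, z != 0 -> z%:~R != 0 :> qfield k.
Proof.
move=> k0; have nat0 (m : nat) : (0 < m)%N -> m%:R != 0 :> qfield k.
  move=> m0; have -> : m%:R = tofrac (m%:R%:P : {poly k}) by rewrite polyC_natr rmorph_nat.
  by rewrite tofrac_eq0 polyC_eq0 ((pcharf0P k).1 k0) -lt0n.
case=> m m0; first by rewrite -pmulrn nat0// lt0n.
by rewrite NegzE mulrNz oppr_eq0 -pmulrn nat0.
Qed.

Section ModesPairs.
Variable T : eqType.
Implicit Types (s : seq T) (mu : T -> part) (b : pred T).

Lemma modes_pairs_cat s s' mu :
  modes_pairs (s ++ s') mu = modes_pairs s mu ++ modes_pairs s' mu.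
Proof. by rewrite /modes_pairs map_cat flatten_cat. Qed.
Lemma modes_pairs1 h mu : modes_pairs [:: h] mu = mode_pairs h (mu h).
Proof. by rewrite /modes_pairs /= cats0. Qed.
Lemma modes_pairs_perm s s' mu :
  perm_eq s s' -> perm_eq (modes_pairs s mu) (modes_pairs s' mu).
Proof. by move=> ss'; apply/perm_flatten/perm_map. Qed.
Lemma modes_pairs_eq s mu mu' :
  {in s, mu =1 mu'} -> modes_pairs s mu = modes_pairs s mu'.
Proof. by move=> E; congr flatten; apply/eq_in_map => h /E ->. Qed.
Lemma all_modes_pairs s mu b :
  all b s -> all (fun p => b p.1.1 && b p.2.1) (modes_pairs s mu).
Proof.
move=> /allP bs; apply/allP => p /flattenP[_ /mapP[h /bs bh ->]] /mapP[q _ ->] /=.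
by rewrite bh.
Qed.
Lemma modes_pairs_part0 s : modes_pairs s (fun=> part0) = [::].
Proof.
elim: s => //= h s IH.
by rewrite -cat1s modes_pairs_cat IH modes_pairs1 /mode_pairs frob_part0.
Qed.

Lemma modes_pairs_map (T' : eqType) (f : T' -> T) (r : seq T') mu :
  modes_pairs (map f r) mu = [seq ((f p.1.1, p.1.2), (f p.2.1, p.2.2)) |
                                p <- modes_pairs r (mu \o f)].
Proof.
rewrite /modes_pairs map_flatten -!map_comp; congr flatten; apply: eq_map => h /=.
by rewrite /mode_pairs -map_comp.
Qed.

End ModesPairs.

Lemma det_pairs_map (T T' : eqType) (R : comNzRingType) (f : T' -> T)
    (A : T -> T -> R) (s : seq (T' * T')) :
  det_pairs A [seq (f p.1, f p.2) | p <- s] = det_pairs (fun x y => A (f x) (f y)) s.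
Proof.
pose t := map_tuple (fun p => (f p.1, f p.2)) (in_tuple s).
rewrite -[map _ s]/(val t) -det_tuple_val /det_pairs /det_tuple; congr (\det _).
by apply/matrixP => i j; rewrite !mxE !tnth_map.
Qed.

(** Size and kappa are additive over hooks. The corner box of a hook is attributed to its arm, and
    the two minus signs bring the product to the shape of [glued_term]. *)
Lemma multiplicative_frob (F : fieldType) (S : nat -> F) (E : int -> F) (nu : part) :
  S 0%N = 1 -> E 0 = 1 -> (forall m n, S (m + n)%N = S m * S n) ->
  (forall x y, E (x + y) = E x * E y) ->
  S (sumn nu) * E (kappa nu) = \prod_(p <- frob nu)
    - (- (S p.1.+1 * E (p.1%:Z * (p.1%:Z + 1)))
       * (S p.2 * E (- (p.2%:Z * (p.2%:Z + 1))))).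
Proof.
move=> S0 E0 SD ED; rewrite sumn_frob kappa_frob.
elim: (frob nu) => [|p l IH]; first by rewrite !big_nil S0 E0 mulr1.
by rewrite !big_cons -IH SD ED -[(p.1 + p.2).+1]addSn SD ED; ring.
Qed.

Section EdgeFactor.
Variables (k : fieldType) (X : toric_cy3).
Notation K := (qfield k).
Notation H := (half_edge X).

(** ['X] is q^(1/6), hence q^(- f kappa / 2) is ['X] to the power - 3 f kappa. The leading minus
    cancels the one of [glued_term]. *)
Definition edge_alpha (f : int) (m : nat) : K :=
  - ((-1) ^ ((f + 1) * m.+1%:Z) * tofrac 'X ^ (- (3 * (f * (m%:Z * (m%:Z + 1)))))).
Definition edge_beta (f : int) (n : nat) : K :=
  (-1) ^ ((f + 1) * n%:Z) * tofrac 'X ^ (3 * (f * (n%:Z * (n%:Z + 1)))).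

Lemma qpow_half (z : int) : qpow k (- z%:~R / 2) = tofrac 'X ^ (- (3 * z)).
Proof.
rewrite /qpow; congr (_ ^ _).
have -> : 6 * (- z%:~R / 2) = (- (3 * z))%:~R :> rat.
  by rewrite rmorphN rmorphM /=; field.
exact: intrKfloor.
Qed.

Lemma edge_scalar (f : int) (nu : part) :
  (-1) ^ ((f + 1) * (sumn nu)%:Z) * qpow k (- (f * kappa nu)%:~R / 2)
  = \prod_(p <- frob nu) - (edge_alpha f p.1 * edge_beta f p.2) :> K.
Proof.
pose S (m : nat) : K := (-1) ^ ((f + 1) * m%:Z).
pose E (z : int) : K := tofrac 'X ^ (- (3 * (f * z))).
have X0 : (tofrac 'X : K) != 0 by rewrite tofrac_eq0 polyX_eq0.
have N0 : (-1 : K) != 0 by rewrite oppr_eq0 oner_eq0.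
have SD m m' : S (m + m')%N = S m * S m' by rewrite /S PoszD mulrDr; exact: expfzDr.
have ED z z' : E (z + z') = E z * E z' by rewrite /E !mulrDr opprD; exact: expfzDr.
have S0 : S 0%N = 1 by rewrite /S mulr0.
have E0 : E 0 = 1 by rewrite /E !mulr0 oppr0.
rewrite qpow_half; transitivity (S (sumn nu) * E (kappa nu)); first by [].
rewrite (multiplicative_frob nu S0 E0 SD ED); apply: eq_bigr => p _.
by rewrite /edge_alpha /edge_beta /S /E !mulrN opprK.
Qed.

Lemma edge_class (h : H) : compact_edge h -> exists i0 : curve_class X, forall d,
  subst_pow 2 (Qpow k h d) = root_monomial K 0 i0 d.*2.
Proof.
move=> ch; have hin : curve_class_of h \in
    [seq curve_class_of h | h in [pred h : H | compact_edge h]].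
  by apply/fintype.imageP; exists h.
exists (SeqSub hin) => d; rewrite /Qpow subst_pow_monomial//; congr monomial.
congr pair; apply/ffunP => c; rewrite !ffunE -(inj_eq val_inj) /=.
by case: ifP => _; rewrite ?muln0// mul2n.
Qed.

Lemma edge_factorE (h : H) (f : int) : compact_edge h ->
  exists i0 : curve_class X, forall nu, subst_pow 2 (edge_factor k h f nu) =
    (\prod_(p <- frob nu) - (edge_alpha f p.1 * edge_beta f p.2)) *:
      root_monomial K 0 i0 (sumn nu).*2.
Proof.
move=> ch; have [i0 E] := edge_class ch; exists i0 => nu.
by rewrite /edge_factor (clinZ _ _ (clin_subst_pow _ _ _ _))// E edge_scalar.
Qed.

End EdgeFactor.

Lemma constant_term_glued (K : fieldType) (I : finType) (H : eqType) (g : nat)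
  (ha hb : H) (alpha beta : nat -> K) (i0 : I) (c : series K I g) A s nu :
  constant_term (glued_term ha hb alpha beta i0 c A s nu) =
  constant_term (c * det_pairs A (s ++ mode_pairs ha nu ++ mode_pairs hb (conj_part nu)))
  * ((\prod_(p <- frob nu) - (alpha p.1 * beta p.2)) *: root_monomial K 0 i0 (sumn nu).*2).
Proof.
rewrite /glued_term -scalerAr (clinZ _ _ (clin_constant_term _ _ _)) -scalerAr.
by rewrite mulrCA constant_term_monomialM mulrC.
Qed.

Section VertexDeterminant.
Variables (k : fieldType) (X : toric_cy3).
Hypothesis hk : [pchar k] =i pred0.
Hypothesis hADKMV : framed_ADKMV k.
Notation H := (half_edge X).

Definition legs_of (T : {set 'I_(ncones X)}) (G : {set H}) : seq H :=
  [seq h <- enum {: H} | (h.1 \in T) && (h \notin G)].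

Lemma mem_legs_of T G h : (h \in legs_of T G) = (h.1 \in T) && (h \notin G).
Proof. by rewrite mem_filter mem_enum andbT. Qed.
Lemma legs_of_uniq T G : uniq (legs_of T G).
Proof. by rewrite filter_uniq ?enum_uniq. Qed.

Lemma vertex_det (a : H -> int) (h : H) : exists B : H * nat -> H * nat -> qfield k,
  forall mu, vertex_term k a mu h =
    det_pairs B (modes_pairs (legs_of [set h.1]%SET finset.set0) mu).
Proof.
pose f (i : 'I_3) : H := (h.1, h.2 + i).
pose A := adkmv_coef k (fun i => a (f i)).
(* The conjecture numbers the edges from [h] on, so half-edges are relabelled by their offset from
   [h]. *)
exists (fun x y => contraction (R := (qfield k)^o) A (x.1.2 - h.2, x.2) (y.1.2 - h.2, y.2)).
move=> mu; rewrite /vertex_term (hADKMV _ (fun i => mu (f i))).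
rewrite (bra_exp_vacuum (qfield_char0 hk)).
have pl : perm_eq (legs_of [set h.1]%SET finset.set0) (map f (enum 'I_3)).
  apply: uniq_perm; first exact: legs_of_uniq.
    by rewrite map_inj_uniq ?enum_uniq// => i j /(congr1 snd); exact: addrI.
  move=> h'; rewrite mem_legs_of finset.in_set1 finset.in_set0 andbT.
  apply/eqP/mapP => [E|[i _ ->]//]; exists (h'.2 - h.2); first by rewrite mem_enum.
  by rewrite /f addrC subrK -E -surjective_pairing.
rewrite (det_pairs_perm _ (modes_pairs_perm mu pl)) (modes_pairs_map f (enum 'I_3)).
apply: etrans (esym (det_pairs_map (fun x : 'I_3 * nat => (f x.1, x.2)) _ _)).
apply: det_pairs_eq => -[[i m] ?] [? [j m']] _ _ /=.
by rewrite /f /= ![h.2 + _]addrC !addrK.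
Qed.

End VertexDeterminant.

(** * Determinantal form of the generating functions, by induction on gluings *)

Section GluingInvariant.
Variables (k : fieldType) (X : toric_cy3).
Hypothesis hk : [pchar k] =i pred0.
Hypothesis hADKMV : framed_ADKMV k.
Notation H := (half_edge X).
Notation K := (qfield k).
Implicit Types (T : {set 'I_(ncones X)}) (G : {set H}).

Lemma side_src_neq (h : H) : side_src h != side_tgt h.
Proof.
case: h => t i; have := vert_unimodular t; rewrite /side_src /side_tgt /det2 /=.
apply: contra_eq_neq.
have [->|[->|->]] : i = 0 \/ i = 1 \/ i = 1 + 1.
- case: i => [[|[|[|i]]] li] //; [left|right; left|right; right]; exact: val_inj.
- by rewrite add0r => ->; rewrite !subrr !mul0r subrr eq_sym oppr_eq0 oner_eq0.
- by move=> ->; rewrite [X in X - _]mulrC subrr eq_sym oppr_eq0 oner_eq0.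
have -> : 1 + 1 + 1 = 0 :> 'I_3 by exact: val_inj.
by move=> ->; rewrite !subrr !mulr0 subrr eq_sym oppr_eq0 oner_eq0.
Qed.

Lemma facing_neq (ha hb : H) : facing ha hb -> ha != hb.
Proof.
move=> /andP[/eqP E _]; apply/eqP => ab; have := side_src_neq ha.
by rewrite E -ab eqxx.
Qed.
Lemma facing_compact (ha hb : H) : facing ha hb -> compact_edge ha.
Proof. by move=> f; apply/existsP; exists hb. Qed.

(** Square roots are taken once for all: every gluing works with the already substituted series, so
    the exponent stays 2 however many edges are glued. *)
Definition determinantal T G (Z : (H -> part) -> coef_ring k X 0) (g : nat) :=
  exists (c : coef_ring k X g) (A : H * nat -> H * nat -> coef_ring k X g),
    eqm 1 c 1 /\ forall mu, subst_pow 2 (Z mu) =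
      constant_term (c * det_pairs A (modes_pairs (legs_of T G) mu)).

(** Every gluing consumes two half-edges, but only a new vertex enlarges T. The cardinalities thus
    make g the number of loops closed so far, to be compared with [nloops] at the end. *)
Definition gluing_invariant T G Z := [/\ (0 < #|T|)%N, forall h, h \in G -> h.1 \in T &
  exists2 g, #|G| = (#|T|.-1 + g).*2 & determinantal T G Z g].

Lemma gluing_vertex_invariant h a Z :
  (forall mu, Z mu = (vertex_term k a mu h)%:A) ->
  gluing_invariant [set h.1]%SET finset.set0 Z.
Proof.
move=> ZE; split=> [|h'|]; [by rewrite cards1|by rewrite finset.in_set0|].
exists 0%N; first by rewrite cards0 cards1.
have [B BE] := vertex_det hk hADKMV a h.
exists 1, (fun x y => (B x y)%:A); split=> // mu.
rewrite ZE BE (clinZ _ _ (clin_subst_pow _ _ _ _))// subst_pow1// mul1r constant_term0E.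
rewrite -[LHS]/(in_alg (coef_ring k X 0) _) (det_pairs_morph (sigma := in_alg _)) //.
- exact: rmorph1.
- exact: rmorphD.
- exact: rmorphM.
Qed.

Lemma legs_of_add_vertex T G (ha hb : H) : (forall h, h \in G -> h.1 \in T) ->
  hb.1 \notin T -> ha.1 \in T ->
  perm_eq (legs_of (hb.1 |: T)%SET (ha |: (hb |: G))%SET)
    (legs_of T (ha |: G)%SET ++ legs_of [set hb.1]%SET [set hb]%SET).
Proof.
move=> GT hbT haT; apply: uniq_perm; first exact: legs_of_uniq.
  rewrite cat_uniq !legs_of_uniq andbT; apply/hasPn => h.
  rewrite /= !mem_legs_of finset.in_set1 => /andP[/eqP -> _].
  by rewrite (negPf hbT).
move=> h; rewrite mem_cat !mem_legs_of !finset.in_setU1 !finset.in_set1 !negb_or.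
case: (eqVneq h.1 hb.1) => [E|nE] /=.
  rewrite E (negPf hbT) /=; have -> : h != ha by apply: contraNneq hbT => hha; rewrite -E hha.
  have -> : h \notin G by apply: contra hbT => /GT; rewrite E.
  by rewrite andbT.
have -> : h != hb by apply: contra_neq nE => ->.
by rewrite orbF.
Qed.

Lemma legs_of_remove T G (h : H) : h.1 \in T -> h \notin G ->
  perm_eq (legs_of T G) (legs_of T (h |: G)%SET ++ [:: h]).
Proof.
move=> hT hG; apply: uniq_perm; first exact: legs_of_uniq.
  rewrite cat_uniq legs_of_uniq /= andbT orbF mem_legs_of.
  by rewrite finset.in_setU1 eqxx andbF.
move=> h'; rewrite mem_cat !mem_legs_of finset.in_setU1 negb_or inE.
by case: eqVneq => [->|_] /=; rewrite ?hT ?hG ?orbF.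
Qed.

Lemma gluing_add_edge_invariant T G (ha hb : H) (f : int)
    (Z'' Z : (H -> part) -> coef_ring k X 0) :
  ha.1 \in T -> ha \notin G -> hb.1 \in T -> hb \notin G -> facing ha hb ->
  (forall mu, is_part_sum (fun nu =>
     Z'' [eta mu with ha |-> nu, hb |-> conj_part nu] * edge_factor k ha f nu) (Z mu)) ->
  gluing_invariant T G Z'' -> gluing_invariant T (ha |: (hb |: G))%SET Z.
Proof.
move=> haT haG hbT hbG fab ZS [T0 GT [g Gg [c [A [c1 ZA]]]]].
have nab := facing_neq fab; have [i0 EF] := edge_factorE k f (facing_compact fab).
split=> // [h|].
  by rewrite !finset.in_setU1 => /or3P[/eqP->|/eqP->|/GT].
exists g.+1.
  rewrite !cardsU1 finset.in_setU1 negb_or nab haG hbG Gg /=; lia.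
have [c' [A' [c'1 AP]]] :=
  loop_step ha hb (edge_alpha k f) (edge_beta k f) i0 A c1.
exists c', A'; split=> // mu; apply: AP (ZS mu) _ => nu.
have pl : perm_eq (legs_of T G)
    (legs_of T (ha |: (hb |: G))%SET ++ [:: ha; hb]).
  apply: perm_trans (legs_of_remove hbT hbG) _; rewrite -[[:: ha; hb]]cat1s catA perm_cat2r.
  by apply: legs_of_remove => //; rewrite finset.in_setU1 negb_or nab.
set mu' := [eta mu with ha |-> nu, hb |-> conj_part nu].
have D : det_pairs A (modes_pairs (legs_of T G) mu') =
    det_pairs A (modes_pairs (legs_of T (ha |: (hb |: G))%SET) mu
                 ++ mode_pairs ha nu ++ mode_pairs hb (conj_part nu)).
  rewrite (det_pairs_perm _ (modes_pairs_perm _ pl)) -[[:: ha; hb]]cat1s.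
  rewrite !modes_pairs_cat !modes_pairs1 /=.
  rewrite eqxx [hb == ha]eq_sym (negPf nab) eqxx.
  rewrite (modes_pairs_eq (mu' := mu)) => [//|h]; rewrite mem_legs_of !finset.in_setU1 !negb_or /=.
  by case/and4P => _ /negPf -> /negPf ->.
rewrite (subst_powM (isT : 0 < 2)%N) EF ZA D.
exact/esym/constant_term_glued.
Qed.

Lemma gluing_add_vertex_invariant T G (a : H -> int) (ha hb : H) (f : int)
    (Z' Z : (H -> part) -> coef_ring k X 0) :
  ha.1 \in T -> ha \notin G -> hb.1 \notin T -> facing ha hb ->
  (forall mu, is_part_sum (fun nu =>
     vertex_term k a [eta mu with hb |-> conj_part nu] hb
       *: (Z' [eta mu with ha |-> nu] * edge_factor k ha f nu)) (Z mu)) ->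
  gluing_invariant T G Z' ->
  gluing_invariant (hb.1 |: T)%SET (ha |: (hb |: G))%SET Z.
Proof.
move=> haT haG hbT fab ZS [T0 GT [g Gg [c [A [c1 ZA]]]]].
have nab := facing_neq fab; have [i0 EF] := edge_factorE k f (facing_compact fab).
have hbG : hb \notin G by apply: contra hbT => /GT.
split=> [|h|].
- by rewrite cardsU1 hbT.
- rewrite !finset.in_setU1 => /or3P[/eqP->|/eqP->|/GT ->]; rewrite ?haT ?eqxx ?orbT//.
exists g.
  by rewrite !cardsU1 finset.in_setU1 negb_or nab haG hbG hbT Gg; move: T0; lia.
have [B BE] := vertex_det hk hADKMV a hb.
pose b (h : H) := h.1 \in T.
have [c' [A' [c'1 AP]]] := vertex_step (qfield_char0 hk) A B
  (edge_alpha k f) (edge_beta k f) i0 (haT : b ha) hbT c1.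
exists c', A'; split=> // mu.
have pl := legs_of_add_vertex GT hbT haT.
rewrite (det_pairs_perm _ (modes_pairs_perm mu pl)) modes_pairs_cat.
set s1 := modes_pairs _ mu; set s2 := modes_pairs _ mu.
have b1 : all b (legs_of T (ha |: G)%SET).
  by apply/allP => h; rewrite mem_legs_of => /andP[].
have b2 : all (predC b) (legs_of [set hb.1]%SET [set hb]%SET).
  by apply/allP => h; rewrite mem_legs_of finset.in_set1 => /andP[/eqP hE _]; rewrite /b /= hE.
have bs1 := all_modes_pairs mu b1; have bs2 := all_modes_pairs mu b2.
apply: AP (ZS mu) _.
  rewrite all_cat; apply/andP; split.
    by apply: sub_all bs1 => p /andP[-> ->].
  by apply: sub_all bs2 => p /= /andP[/negPf-> /negPf->].
move=> nu; set muv := [eta mu with hb |-> conj_part nu]; set mu' := [eta mu with ha |-> nu].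
have ph := legs_of_remove haT haG.
have ph' : perm_eq (legs_of [set hb.1]%SET finset.set0)
    (legs_of [set hb.1]%SET [set hb]%SET ++ [:: hb]).
  have := @legs_of_remove [set hb.1]%SET finset.set0 hb.
  by rewrite finset.in_set1 finset.in_set0 eqxx finset.setU0; apply.
have DA : det_pairs A (modes_pairs (legs_of T G) mu') = det_pairs A (s1 ++ mode_pairs ha nu).
  rewrite (det_pairs_perm _ (modes_pairs_perm _ ph)) modes_pairs_cat modes_pairs1 /= eqxx.
  rewrite (modes_pairs_eq (mu' := mu)) => [//|h].
  by rewrite mem_legs_of finset.in_setU1 negb_or /= => /and3P[_ /negPf -> _].
have DB : det_pairs B (modes_pairs (legs_of [set hb.1]%SET finset.set0) muv)
    = det_pairs B (s2 ++ mode_pairs hb (conj_part nu)).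
  rewrite (det_pairs_perm _ (modes_pairs_perm _ ph')) modes_pairs_cat modes_pairs1 /= eqxx.
  rewrite (modes_pairs_eq (mu' := mu)) => [//|h].
  by rewrite mem_legs_of !finset.in_set1 /= => /andP[_ /negPf ->].
(* Once the hooks at old and at new half-edges are grouped, the block diagonal determinant factors,
   and the new block is the vertex amplitude. *)
have D : det_pairs (block_sum b A B)
      ((s1 ++ s2) ++ mode_pairs ha nu ++ mode_pairs hb (conj_part nu))
    = det_pairs B (s2 ++ mode_pairs hb (conj_part nu)) *: det_pairs A (s1 ++ mode_pairs ha nu).
  have pm : perm_eq ((s1 ++ s2) ++ mode_pairs ha nu ++ mode_pairs hb (conj_part nu))
      ((s1 ++ mode_pairs ha nu) ++ (s2 ++ mode_pairs hb (conj_part nu))).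
    by rewrite -!catA perm_cat2l perm_catCA.
  rewrite (det_pairs_perm _ pm) det_block_sum; first by rewrite mulr_algr.
    by rewrite all_cat bs1; apply/allP => p /mapP[q _ ->] /=; rewrite /b haT.
  by rewrite all_cat bs2; apply/allP => p /mapP[q _ ->] /=; rewrite /b hbT.
rewrite (clinZ _ _ (clin_subst_pow _ _ 2 0)) (subst_powM (isT : 0 < 2)%N).
rewrite EF ZA BE constant_term_glued D DA DB; set x := det_pairs A _; set y := det_pairs B _.
have -> : constant_term (c * (y *: x)) = y *: constant_term (c * x).
  by rewrite -scalerAr (clinZ _ _ (clin_constant_term _ _ _)).
by rewrite -[RHS]scalerAl.
Qed.

Lemma gluing_invariantP T G a (Z : (H -> part) -> coef_ring k X 0) :
  gluing T G a Z -> gluing_invariant T G Z.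
Proof.
elim=> {T G a Z}.
- by move=> h a Z; exact: gluing_vertex_invariant.
- move=> T G a ha hb f Z' Z haT haG hbT fab _ _ IH ZS.
  exact: gluing_add_vertex_invariant haT haG hbT fab ZS IH.
move=> T G a ha hb f Z'' Z haT haG hbT hbG fab _ _ IH ZS.
exact: gluing_add_edge_invariant haT haG hbT hbG fab ZS IH.
Qed.

End GluingInvariant.

(** * Division by the closed invariants, and the theorem *)

Section Normalization.
Variables (K : fieldType) (I : finType) (g : nat).
Hypothesis K_char0 : forall z : int, z != 0 -> z%:~R != 0 :> K.
Notation R := (series K I g).

Let widen0 (th : {ffun 'I_0 -> int}) : {ffun 'I_g -> int} := 0.

Lemma constant_term_embed_mul (h : series K I 0) (f : R) :
  constant_term (embed widen0 h * f) = h * constant_term f.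
Proof.
have wD : {morph widen0 : a b / a + b} by move=> a b; rewrite addr0.
apply: (clin_eq (F := fun h => constant_term (embed widen0 h * f))
                (G := fun h => h * constant_term f)).
- apply: (clin_comp (F := fun h => embed widen0 h * f)) (clin_constant_term _ _ _).
  have := clin_mul f (clin_embed K I widen0).
  by case=> L C; split=> [a x y|k x y /C]; rewrite ![_ * f]mulrC.
- have := clin_mul (constant_term f) (clin_id K I 0).
  by case=> L C; split=> [a x y|k x y /C]; rewrite ![_ * constant_term f]mulrC.
move=> [d th]; rewrite embed_monomial constant_term_monomialM.
by have -> : th = 0 by apply/ffunP => -[].
Qed.

(* The normalization by the closed invariants is absorbed in A by a change of
   the variables Theta. *)
Lemma normalized_determinant (T : eqType) (c : R) (A : T -> T -> R) :
  eqm 1 c 1 -> exists A' : T -> T -> R, forall (s : seq (T * T)) (z : series K I 0),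
    z * constant_term c = constant_term (c * det_pairs A s) ->
    z = constant_term (det_pairs A' s).
Proof.
move=> c1; set c0 := constant_term c.
have c01 : eqm 1 c0 1.
  have := (clin_constant_term K I g).2 _ _ _ c1.
  by rewrite -[1 in X in eqm 1 _ X]monomial0 constant_term_monomial eqxx.
have u0 := eqm1_unit c01; pose c' := embed widen0 c0^-1 * c.
have cc' f : constant_term (c' * f) = c0^-1 * constant_term (c * f).
  by rewrite -mulrA constant_term_embed_mul.
have c'1 : eqm 1 c' 1.
  rewrite -[X in eqm _ _ X]mulr1; apply: eqmM => //.
  rewrite -[X in eqm _ _ X](embed1 K I (widen := widen0)) //.
  exact: (clin_embed _ _ _).2 (eqm1_inv c01).
have ct_c' : constant_term c' = 1 by rewrite -[c']mulr1 cc' mulr1 mulVr.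
have [sigma [sigma1 sigmaD sigmaM sigmaE]] := change_of_variables K_char0 c'1 ct_c'.
exists (fun x y => sigma (A x y)) => s z zE.
rewrite -[det_pairs _ s](det_pairs_morph A s sigma1 sigmaD sigmaM) sigmaE cc' -zE.
by rewrite mulrC mulrK.
Qed.

End Normalization.

Lemma legs_of_outer_branes (X : toric_cy3) (n : nat) (L : 'I_n -> half_edge X) :
  outer_branes L -> perm_eq
    (legs_of finset.setT (finset (fun h : half_edge X => compact_edge h)))
    (map L (enum 'I_n)).
Proof.
move=> [L_inj LP]; apply: uniq_perm; first exact: legs_of_uniq.
  by rewrite map_inj_uniq ?enum_uniq.
move=> h; rewrite mem_legs_of !finset.inE /=.
apply/idP/mapP => [/LP[i <-]|[i _ ->]]; first by exists i; rewrite ?mem_enum.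
by apply/LP; exists i.
Qed.

Lemma open_generating_function_det (k : fieldType) (hk : [pchar k] =i pred0)
    (hADKMV : framed_ADKMV k) (X : toric_cy3) (n : nat) (L : 'I_n -> half_edge X)
    (hL : outer_branes L) (a : 'I_n -> int) (Z : ('I_n -> part) -> coef_ring k X 0)
    (hZ : open_generating_function L a Z) :
  exists A : 'I_n * nat -> 'I_n * nat -> coef_ring k X (nloops X),
    forall mu, subst_pow 2 (Z mu) =
      constant_term (det_pairs A (modes_pairs (enum 'I_n) mu)).
Proof.
have [Zt [a' [Z' [glueZ _ Z'E]]] ZE] := hZ.
have [_ _ [g Gg [c [A [c1 ZA]]]]] := gluing_invariantP hk hADKMV glueZ.
have -> : nloops X = g.
  rewrite /nloops; have -> : #|[pred h : half_edge X | compact_edge h]| =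
      #|finset (fun h : half_edge X => compact_edge h)|.
    by apply: eq_card => h; rewrite !finset.inE.
  by rewrite Gg cardsT card_ord doubleK; have := ncones_gt0 X; lia.
have [L_inj _] := hL; have pl := legs_of_outer_branes hL.
(* The values off the outer branes are immaterial, those half-edges being glued. *)
pose ext_mu (mu : 'I_n -> part) (h : half_edge X) : part :=
  if [pick i | L i == h] is Some i then mu i else part0.
have ext_muL mu : ext_mu mu \o L = mu.
  apply/funext => i; rewrite /ext_mu /=; case: pickP => [j /eqP/L_inj -> //|/(_ i)].
  by rewrite eqxx.
have ZtA mu : subst_pow 2 (Zt mu) = constant_term (c *
    det_pairs (fun x y => A (L x.1, x.2) (L y.1, y.2)) (modes_pairs (enum 'I_n) mu)).
  have <- : (fun i => ext_mu mu (L i)) = mu by exact: ext_muL.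
  rewrite -Z'E ZA (det_pairs_perm _ (modes_pairs_perm _ pl)) modes_pairs_map.
  congr (constant_term (c * _)).
  exact: (det_pairs_map (fun x : 'I_n * nat => (L x.1, x.2))).
have [A' A'E] := normalized_determinant (qfield_char0 hk)
  (fun x y : 'I_n * nat => A (L x.1, x.2) (L y.1, y.2)) c1.
exists A' => mu; apply: A'E; rewrite -ZtA -ZE (subst_powM (isT : 0 < 2)%N).
(* At empty partitions the determinant is 1, so the closed generating function is
   [constant_term c]. *)
by congr (_ * _); rewrite ZtA modes_pairs_part0 det_pairs_nil mulr1.
Qed.

Theorem theorem5p2 (k : fieldType) (hk : [pchar k]%R =i pred0)
    (hADKMV : framed_ADKMV k)
    (X : toric_cy3) (n : nat) (L : 'I_n -> half_edge X) (hL : outer_branes L)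
    (a : 'I_n -> int) (Z : ('I_n -> part) -> coef_ring k X 0)
    (hZ : open_generating_function L a Z) :
  (nloops X = 0%N ->
     exists (N : nat) (V : fock (coef_ring k X 0) n),
       [/\ (0 < N)%N, bogoliubov V &
           forall mu : 'I_n -> part, subst_pow N (Z mu) = bra mu V]) /\
  (forall g : nat, nloops X = g ->
     exists (N : nat) (V : fock (coef_ring k X g) n),
       [/\ (0 < N)%N, bogoliubov V &
           forall mu : 'I_n -> part,
             subst_pow N (Z mu) = constant_term (bra mu V)]).
Proof.
have [A AE] := open_generating_function_det hk hADKMV hL hZ.
have main g : nloops X = g ->
    exists (N : nat) (V : fock (coef_ring k X g) n),
       [/\ (0 < N)%N, bogoliubov V &
           forall mu : 'I_n -> part, subst_pow N (Z mu) = constant_term (bra mu V)].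
  move=> gE; case: _ / gE.
  (* 2 for the square roots of the Q's; the sign (-1)^p undoes the one in [contraction]. *)
  exists 2%N, (exp_vacuum (fun i j m p => A (i, m) (j, p) * (-1) ^+ p)).
  split=> [//||mu]; first by eexists.
  rewrite AE (bra_exp_vacuum (qfield_char0 hk)); congr constant_term.
  apply: det_pairs_eq => -[[i m] ?] [? [j p]] _ _ /=.
  by rewrite /contraction /= -mulrA -exprD addnn -muln2 exprM sqrr_sign mulr1.
split=> // /main[N [V [N0 bV VE]]]; exists N, V; split=> // mu.
by rewrite VE constant_term0E.
Qed.
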